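(* Let $\emptyset\neq\mathcal{A}\subseteq\mathbb{Q}^n$ and $\mathcal{B}\subseteq\mathbb{N}^n\setminus(2\mathbb{N})^n$ be finite and disjoint, and let $C_{\mathcal{S}}(\mathcal{A},\mathcal{B})$ be the corresponding (rational) $\mathcal{S}$-cone, whose elements are identified with their coefficient vectors in $\mathbb{R}^{\mathcal{A}\cup\mathcal{B}}$. (1) The dual cone $C_{\mathcal{S}}(\mathcal{A},\mathcal{B})^*$ is the projection of the lifted cone $\widehat{C}^*(\mathcal{A},\mathcal{B})$ on the coordinates $\mathbf{v}\in\mathbb{R}^{\mathcal{A}\cup\mathcal{B}}$. (2) The primal cone $C_{\mathcal{S}}(\mathcal{A},\mathcal{B})$ is the projection of the lifted cone $\widehat{C}(\mathcal{A},\mathcal{B})$ on the coordinates $\mathbf{c}\in\mathbb{R}^{\mathcal{A}\cup\mathcal{B}}$.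
   Context: $\mathbb{N}=\{0,1,2,\dots\}$, $[r]=\{1,\dots,r\}$, $\succeq 0$ means positive semidefinite, $\mathbf{v}_{|S}$ denotes restriction to coordinates indexed by $S$. $\mathcal{S}$-cone: let $\mathbb{R}[\mathcal{A},\mathcal{B}]$ be the space of functions $f(\mathbf{x})=\sum_{\alpha\in\mathcal{A}}c_\alpha|\mathbf{x}|^\alpha+\sum_{\beta\in\mathcal{B}}c_\beta\mathbf{x}^\beta$ with real coefficients, where $|\mathbf{x}|^\alpha=\prod_j|x_j|^{\alpha_j}$ (set to $\infty$ if some $x_j=0$ has negative exponent), $\mathbf{x}^\beta=\prod_jx_j^{\beta_j}$. $f$ is an even AG function if at most one $c_\alpha$ ($\alpha\in\mathcal{A}$) is negative and all $c_\beta$ ($\beta\in\mathcal{B}$) are zero; an odd AG function if all $c_\alpha$ ($\alpha\in\mathcal{A}$) are non-negative and at most one $c_\beta$ ($\beta\in\mathcal{B}$) is nonzero; an AG function if it is one of these. $C_{\mathcal{S}}(\mathcal{A},\mathcal{B})$ is the conic hull of all AG functions in $\mathbb{R}[\mathcal{A},\mathcal{B}]$ that are non-negative on $\mathbb{R}^n$; it is called rational if $\mathcal{A}\subseteq\mathbb{Q}^n$. The dual cone is $C_{\mathcal{S}}(\mathcal{A},\mathcal{B})^*=\{\mathbf{v}\in\mathbb{R}^{\mathcal{A}\cup\mathcal{B}}:\sum_{\gamma\in\mathcal{A}\cup\mathcal{B}}v_\gamma c_\gamma\ge0\text{ for all }f\in C_{\mathcal{S}}(\mathcal{A},\mathcal{B})\text{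 with coefficient vector }\mathbf{c}\}$. Reduced circuits: for finite $\mathcal{C}\subseteq\mathbb{R}^n$, $R(\mathcal{A},\mathcal{C})$ is the set of pairs $(A,\beta)$ with $A\subseteq\mathcal{A}$ affinely independent, $\beta\in\operatorname{relint}(\operatorname{conv}A)\cap(\mathcal{C}\setminus A)$ and $(\mathcal{A}\cap\operatorname{conv}A)\setminus(A\cup\{\beta\})=\emptyset$. Elements of $R(\mathcal{A},\mathcal{A})$ are even, those of $R(\mathcal{A},\mathcal{B})$ are odd reduced circuits. For a circuit $(A,\beta)$ let $\lambda_\alpha>0$ ($\alpha\in A$) be the unique barycentric coordinates, $\sum_{\alpha\in A}\lambda_\alpha\alpha=\beta$, $\sum_{\alpha\in A}\lambda_\alpha=1$; they are rational, $\lambda_\alpha=p_\alpha/p$ with $p_\alpha,p\in\mathbb{N}$, $p$ minimal; $m=\lceil\log_2p\rceil$, $\Lambda=\prod_{\alpha\in A}\lambda_\alpha^{\lambda_\alpha}$ (all depending on $(A,\beta)$). Dual circuit matrix: for $\mathbf{y}=(y_{k,i})$, $k\in[m-1]$, $i\in[2^{m-k}]$, and a scalar $z$, $C^*_{A,\beta}(\mathbf{v}_{|A},z,\mathbf{y})$ is the block diagonal matrix with blocks (i) $\begin{pmatrix} y_{k-1,2i-1} & y_{k,i} \\ y_{k,i} & y_{k-1,2i} \end{pmatrix}$, $k\in\{2,\dots,m-1\}$, $i\in[2^{m-k}]$; (ii) $\begin{pmatrix} y_{m-1,1} & z \\ z & y_{m-1,2} \end{pmatrix}$; (iii) the singleton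 block $(z)$; (iv) $2^{m-1}$ blocks $\begin{pmatrix} u & y_{1,l} \\ y_{1,l} & w \end{pmatrix}$, $l\in[2^{m-1}]$, with $u,w\in\{v_\alpha:\alpha\in A\}\cup\{z\}$ such that over all blocks (iv) each $v_\alpha$ appears $p_\alpha$ times and $z$ appears $2^m-p$ times (the order of appearance does not matter). Circuit matrix: for $\mathbf{x}=(x_\beta,(x_{k,i})_{k,i})$, $k\in[m]$, $i\in[2^{m-k}]$, $C_{A,\beta}(\mathbf{c}_{|A\cup\{\beta\}},x_\beta,\mathbf{x})$ is the block diagonal matrix with blocks (i) $\begin{pmatrix} x_{k-1,2i-1} & x_{k,i} \\ x_{k,i} & x_{k-1,2i} \end{pmatrix}$, $k\in\{2,\dots,m\}$, $i\in[2^{m-k}]$; (ii) the singleton blocks $(x_{m,1}-\Lambda x_\beta)$ and $(x_\beta+c_\beta)$; (iii) $2^{m-1}$ blocks $\begin{pmatrix} u & x_{1,l} \\ x_{1,l} & w \end{pmatrix}$, $l\in[2^{m-1}]$, with $u,w\in\{c_\alpha:\alpha\in A\}\cup\{\Lambda x_\beta\}$ such that over all blocks (iii) each $c_\alpha$ appears $p_\alpha$ times and $\Lambda x_\beta$ appears $2^m-p$ times. For odd reduced circuits, $\widehat C^*_{A,\beta}(\mathbf{v}_{|A\cup\{\beta\}},y_\beta,\mathbf{y})$ is the block diagonal matrix consisting of $C^*_{A,\beta}(\mathbf{v}_{|A},y_\beta,\mathbf{y})$ and $\begin{pmatrix} y_\beta & v_\beta \\ v_\beta & y_\beta \end{pmatrix}$,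 where $y_\beta$ is an additional variable, and $\widehat C_{A,\beta}(\mathbf{c}_{|A\cup\{\beta\}},x_\beta,\mathbf{x})$ is the block diagonal matrix consisting of $C_{A,\beta}(\mathbf{c}_{|A\cup\{\beta\}},x_\beta,\mathbf{x})$ and $\begin{pmatrix} x_\beta & c_\beta \\ c_\beta & x_\beta \end{pmatrix}$. Lifted cones: every circuit $(A,\beta)\in R(\mathcal{A},\mathcal{A}\cup\mathcal{B})$ has its own set of variables $\mathbf{y}^{A,\beta}$ (including $y_\beta^{A,\beta}$ for odd circuits) and $\mathbf{x}^{A,\beta}$; $\mathbf{y}^{\mathcal{A},\mathcal{B}}$, $\mathbf{x}^{\mathcal{A},\mathcal{B}}$ denote the collections of all of them. Define $\widehat C^*(\mathcal{A},\mathcal{B})$ as the set of $(\mathbf{v},\mathbf{y}^{\mathcal{A},\mathcal{B}})$ with $\mathbf{v}\in\mathbb{R}^{\mathcal{A}\cup\mathcal{B}}$, $\widehat C^*_{A,\beta}(\mathbf{v}_{|A\cup\{\beta\}},y^{A,\beta}_\beta,\mathbf{y}^{A,\beta})\succeq0$ for all $(A,\beta)\in R(\mathcal{A},\mathcal{B})$, and $C^*_{A,\beta}(\mathbf{v}_{|A},v_\beta,\mathbf{y}^{A,\beta})\succeq0$ for all $(A,\beta)\in R(\mathcal{A},\mathcal{A})$. For $(A,\beta)\in R(\mathcal{A},\mathcal{A})$ let $\widehat{P^{\mathrm{even}}_{A,\beta}}$ be the set of $(\mathbf{c},\mathbf{x}^{\mathcal{A},\mathcal{B}})$, $\mathbf{c}\in\mathbb{R}^{\mathcal{A}\cup\mathcal{B}}$,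 with $C_{A,\beta}(\mathbf{c}_{|A\cup\{\beta\}},x^{A,\beta}_\beta,\mathbf{x}^{A,\beta})\succeq0$ and $c_\gamma=0$ for $\gamma\in(\mathcal{A}\cup\mathcal{B})\setminus(A\cup\{\beta\})$; for $(A,\beta)\in R(\mathcal{A},\mathcal{B})$ let $\widehat{P^{\mathrm{odd}}_{A,\beta}}$ be defined likewise with $\widehat C_{A,\beta}$ in place of $C_{A,\beta}$. Then $$\widehat C(\mathcal{A},\mathcal{B})=\sum_{(A,\beta)\in R(\mathcal{A},\mathcal{A})}\widehat{P^{\mathrm{even}}_{A,\beta}}+\sum_{(A,\beta)\in R(\mathcal{A},\mathcal{B})}\widehat{P^{\mathrm{odd}}_{A,\beta}}$$ (Minkowski sum).
   Formalization: As printed, (1) and (2) fail if some α in A lies in no reduced circuit (e.g. A={α}, B empty). Proved: both equalities when no such α exists; in general, (1) with v_α≥0 added for such α, and (2) with the cone generated by these |x|^α added. *)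

(* Defs.v *)
From HB Require Import structures.
From mathcomp Require Import all_boot all_order all_algebra.
From mathcomp Require Import finmap.
From mathcomp Require Import all_classical all_reals all_analysis.

Set Implicit Arguments.
Unset Strict Implicit.
Unset Printing Implicit Defensive.

Import Order.TTheory GRing.Theory Num.Theory.
Import numFieldNormedType.Exports.

Local Open Scope classical_set_scope.
Local Open Scope fset_scope.
Local Open Scope ring_scope.

(* Vectors of R^S for a finite set S are finite functions {ffun S -> R};
   [fcoord v k] is the coordinate of v at k (and 0 if k is not in S). *)
Definition fcoord (R : nmodType) (K : choiceType) (S : {fset K})
    (v : {ffun S -> R}) (k : K) : R :=
  if insub k is Some i then v i else 0.

Section convexity.
Variables (R : realType) (U : lmodType R).

Definition conic_hull (S : set U) : set U :=
  [set x | exists k (t : 'I_k -> R) (s : 'I_k -> U),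
    [/\ forall i, S (s i), forall i, 0 <= t i & x = \sum_(i < k) t i *: s i]].

Definition affine_hull (S : set U) : set U :=
  [set x | exists k (t : 'I_k -> R) (s : 'I_k -> U),
    [/\ forall i, S (s i), \sum_(i < k) t i = 1
      & x = \sum_(i < k) t i *: s i]].

Definition convex_hull (S : set U) : set U :=
  [set x | exists k (t : 'I_k -> R) (s : 'I_k -> U),
    [/\ forall i, S (s i), forall i, 0 <= t i, \sum_(i < k) t i = 1
      & x = \sum_(i < k) t i *: s i]].

Definition affinely_independent (S : {fset U}) : Prop :=
  forall t : S -> R,
    \sum_s t s *: val s = 0 -> \sum_s t s = 0 -> forall s, t s = 0.

End convexity.

Definition minkowski_add (U : nmodType) (P Q : set U) : set U :=
  [set a + b | a in P & b in Q].

(* The empty sum is {0}. *)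
Definition minkowski_sum (U : nmodType) (I : choiceType) (r : {fset I})
    (P : I -> set U) : set U :=
  [set x | exists f : I -> U,
    (forall i, i \in r -> P i (f i)) /\ x = \sum_(i <- r) f i].

Definition psd (R : realType) (N : nat) (M : 'M[R]_N) : Prop :=
  M^T = M /\ forall u : 'rV[R]_N, 0 <= (u *m M *m u^T) 0 0.

Section blocks.
Variable R : realType.

Definition block1 (a : R) : {N : nat & 'M[R]_N} := existT _ 1%N a%:M.

Definition block2 (a b d : R) : {N : nat & 'M[R]_N} :=
  existT (fun N => 'M[R]_N) 2%N
    (\matrix_(i < 2, j < 2) if i != j then b else if i == 0 then a else d).

Definition block_diag (s : seq {N : nat & 'M[R]_N}) :=
  \mxdiag_(i < size s) tagged (tnth (in_tuple s) i).

End blocks.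

Section S_cone.
Variables (R : realType) (n : nat).
Local Notation V := 'rV[R]_n.

Definition relint (S : set V) : set V :=
  [set x | S x /\ \forall y \near x, affine_hull S y -> S y].

Definition rational_points : set V :=
  [set a | forall j, exists q : rat, a 0 j = ratr q].
Definition nat_points : set V :=
  [set b | forall j, exists k : nat, b 0 j = k%:R].
Definition even_points : set V :=
  [set b | forall j, exists k : nat, b 0 j = (2 * k)%:R].

Definition abs_monomial (a x : V) : \bar R :=
  if [exists j, (x 0 j == 0) && (a 0 j < 0)] then +oo%E
  else (\prod_j `|x 0 j| `^ a 0 j)%:E.

(* Only used for b in N^n, where truncn (b 0 j) = b 0 j. *)
Definition monomial (b x : V) : R := \prod_j x 0 j ^+ Num.truncn (b 0 j).

Section cone.
Variables A B : {fset V}.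
Local Notation coef := {ffun (A `|` B) -> R}.

(* The value of f at x, in R with infinity: the sum is the dual addition of
   extended reals, for which +oo + -oo = +oo; moreover 0 * +oo = 0, so that
   exponents with zero coefficient do not contribute.  The value is -oo when
   the only infinite term has a negative coefficient. *)
Definition S_eval (c : coef) (x : V) : \bar R :=
  (\sum_(a <- A) ((fcoord c a)%:E * abs_monomial a x : \bar^d R)
   + \sum_(b <- B) ((fcoord c b * monomial b x)%:E : \bar^d R))%dE.

Definition even_AG (c : coef) : Prop :=
  (forall a a', a \in A -> a' \in A -> fcoord c a < 0 -> fcoord c a' < 0 ->
     a = a')
  /\ (forall b, b \in B -> fcoord c b = 0).

Definition odd_AG (c : coef) : Prop :=
  (forall a, a \in A -> 0 <= fcoord c a)
  /\ (forall b b', b \in B -> b' \in B -> fcoord c b != 0 -> fcoord c b' != 0 ->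
        b = b').

Definition S_cone : set coef :=
  conic_hull [set c | (even_AG c \/ odd_AG c) /\ forall x, (0 <= S_eval c x)%E].

Definition dual_S_cone : set coef :=
  [set v | forall c, S_cone c -> 0 <= \sum_g v g * c g].

End cone.

Section circuits.

Local Notation circuit := ({fset V} * V)%type.

Definition is_reduced_circuit (A C : {fset V}) (q : circuit) : Prop :=
  [/\ affinely_independent q.1,
      (relint (convex_hull [set` q.1]) `&` ([set` C] `\` [set` q.1])) q.2
    & ([set` A] `&` convex_hull [set` q.1]) `\` ([set` q.1] `|` [set q.2])
      = set0 ]%classic.

Definition reduced_circuits (A C : {fset V}) : {fset circuit} :=
  [fset q in fpowerset A `*` C | `[< is_reduced_circuit A C q >]].

Variable q : circuit.

Definition barycentric : {ffun q.1 -> R} :=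
  xget 0 [set l : {ffun q.1 -> R} |
    [/\ forall a, 0 < l a, \sum_a l a *: val a = q.2 & \sum_a l a = 1]].

Definition lambda (a : V) : R := fcoord barycentric a.

Definition common_denominator (d : nat) : Prop :=
  (0 < d)%N /\ forall a, a \in q.1 -> exists k : nat, lambda a = k%:R / d%:R.

Definition denominator : nat :=
  xget 0%N [set d | common_denominator d
                    /\ forall d', common_denominator d' -> (d <= d')%N].

Definition numerator (a : V) : nat := Num.truncn (denominator%:R * lambda a).

Definition depth : nat := up_log 2 denominator.

Definition Lambda : R := \prod_(a <- q.1) lambda a `^ lambda a.

(* The entries u, w of the last group of blocks of the circuit matrices:
   [Some a] stands for the coordinate at a, and [None] for the additional
   entry (z in the dual, Lambda * x_beta in the primal). *)
Definition leaves : seq (option V) :=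
  flatten [seq nseq (numerator a) (Some a) | a <- q.1]
  ++ nseq (2 ^ depth - denominator) None.

(* The entries below are indexed from 1 as y k i.  [s] is the order in
   which the leaves are placed on the 2 ^ (depth - 1) blocks. *)

Definition leaf (s : seq (option V)) (v : V -> R) (z : R) (l : nat) : R :=
  if nth None s l is Some a then v a else z.

Definition tree_blocks (s : seq (option V)) (v : V -> R) (z : R)
    (y : nat -> nat -> R) : seq {N : nat & 'M[R]_N} :=
  [seq block2 (y k.-1 (2 * i).-1) (y k i) (y k.-1 (2 * i)%N)
     | k <- iota 2 depth.-1, i <- iota 1 (2 ^ (depth - k))]
  ++ [seq block2 (leaf s v z (2 * l).-2) (y 1%N l) (leaf s v z (2 * l).-1)
     | l <- iota 1 (2 ^ depth.-1)].

(* The entry of index (depth, 1) is z, so that the block for k = depth is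
   (y_(m-1,1), z; z, y_(m-1,2)) if m = depth > 1, and the only 2 x 2 block is
   (u, z; z, w) if m = 1. *)
Definition dual_blocks s (v : V -> R) (z : R) (y : nat -> nat -> R) :=
  block1 z
  :: tree_blocks s v z (fun k i => if k == depth then z else y k i).

Definition primal_blocks s (c : V -> R) (xb : R) (x : nat -> nat -> R) :=
  [:: block1 (x depth 1%N - Lambda * xb); block1 (xb + c q.2)]
  ++ tree_blocks s c (Lambda * xb) x.

Definition dual_matrix s v z y := block_diag (dual_blocks s v z y).

Definition primal_matrix s c xb x := block_diag (primal_blocks s c xb x).

Definition dual_matrix_odd s (v : V -> R) (yb : R) y :=
  block_diag (rcons (dual_blocks s v yb y) (block2 yb (v q.2) yb)).

Definition primal_matrix_odd s (c : V -> R) (xb : R) x :=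
  block_diag (rcons (primal_blocks s c xb x) (block2 xb (c q.2) xb)).

End circuits.

Section lifted_cones.
Variables A B : {fset V}.
Local Notation coef := {ffun (A `|` B) -> R}.
Local Notation circuit := ({fset V} * V)%type.

Definition even_circuits := reduced_circuits A A.
Definition odd_circuits := reduced_circuits A B.
Definition all_circuits := reduced_circuits A (A `|` B).

(* Index sets of the variables y_(k,i), x_(k,i) of all circuits. *)
Definition tree_index (K m : nat) : {fset nat * nat} :=
  [fset ki in [seq (k, i) | k <- iota 1 K, i <- iota 1 (2 ^ (m - k))]].
Definition dual_index : {fset circuit * (nat * nat)} :=
  [fset qki in [seq (q, ki) | q <- all_circuits,
                              ki <- tree_index (depth q).-1 (depth q)]].
Definition primal_index : {fset circuit * (nat * nat)} :=
  [fset qki in [seq (q, ki) | q <- all_circuits,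
                              ki <- tree_index (depth q) (depth q)]].

(* The first component collects the variables y_beta (of the odd circuits),
   resp. x_beta (of all circuits). *)
Definition dual_vars :=
  ({ffun odd_circuits -> R} * {ffun dual_index -> R})%type.
Definition primal_vars :=
  ({ffun all_circuits -> R} * {ffun primal_index -> R})%type.

Variable s : circuit -> seq (option V).

Definition lifted_dual : set (coef * dual_vars) :=
  [set w | let: (v, (yb, y)) := w in
    (forall q, q \in odd_circuits ->
       psd (dual_matrix_odd q (s q) (fcoord v) (fcoord yb q)
              (fun k i => fcoord y (q, (k, i)))))
    /\ (forall q, q \in even_circuits ->
       psd (dual_matrix q (s q) (fcoord v) (fcoord v q.2)
              (fun k i => fcoord y (q, (k, i)))))].

Definition supported_on (q : circuit) (c : coef) : Prop :=
  forall g, g \notin q.2 |` q.1 -> fcoord c g = 0.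

Definition lifted_even (q : circuit) : set (coef * primal_vars) :=
  [set w | let: (c, (xb, x)) := w in
    psd (primal_matrix q (s q) (fcoord c) (fcoord xb q)
           (fun k i => fcoord x (q, (k, i))))
    /\ supported_on q c].

Definition lifted_odd (q : circuit) : set (coef * primal_vars) :=
  [set w | let: (c, (xb, x)) := w in
    psd (primal_matrix_odd q (s q) (fcoord c) (fcoord xb q)
           (fun k i => fcoord x (q, (k, i))))
    /\ supported_on q c].

Definition lifted_primal : set (coef * primal_vars) :=
  minkowski_add (minkowski_sum even_circuits lifted_even)
                (minkowski_sum odd_circuits lifted_odd).

(* The exponents of A that occur in no reduced circuit.  The inequality
   v_a >= 0 (resp. the ray of |x|^a) for such an exponent a is visible in the
   S-cone, but no circuit matrix involves the coordinate a.  For instance, for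
   A = {0, 1} and B empty (n = 1) there is no reduced circuit at all: the
   S-cone and its dual are the non-negative quadrant, whereas the lifted cones
   project onto R^2 (dual) and {0} (primal). *)
Definition isolated_exponents : {fset V} :=
  [fset a in A | all (fun q => (a \notin q.1) && (a != q.2)) all_circuits].

Definition isolated_dual : set coef :=
  [set v | forall a, a \in isolated_exponents -> 0 <= fcoord v a].

Definition isolated_primal : set coef :=
  [set c | forall g, (g \in isolated_exponents -> 0 <= fcoord c g)
                     /\ (g \notin isolated_exponents -> fcoord c g = 0)].

End lifted_cones.
End S_cone.

Arguments rational_points R n : clear implicits.
Arguments nat_points R n : clear implicits.
Arguments even_points R n : clear implicits.
Arguments S_cone {R n} A B _.
Arguments dual_S_cone {R n} A B _.
Arguments lifted_dual {R n} A B s _.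
Arguments lifted_primal {R n} A B s _.
Arguments isolated_dual {R n} A B _.
Arguments isolated_primal {R n} A B _.

(* Main.v *)
(** Both parts reduce to the primal one.  Eliminating the auxiliary variables,
   a circuit matrix is feasible iff a weighted geometric mean of the
   coefficients at the vertices dominates the coefficient at the inner point, so
   that the lifted cones project onto sums of circuit cones, contained in the
   S-cone by the weighted AM-GM inequality.

   Conversely let [f = sum c_a |x|^a + c_b x^b] be a nonnegative AG function.
   On the open orthant this bounds [h t = sum c_a exp <a - b, t>] from below by
   [d = |c_b|].  Minimizing [h + eps |t|^2] and letting [eps] tend to 0 gives
   weights [nu] with barycenter [b], total mass at least [d] and relative entropy
   [sum nu_a ln (nu_a / c_a) <= 0].  By Caratheodory [nu] splits into weights on
   simplices, hence [f] into circuit functions.  A circuit function is split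
   further into reduced ones by letting a random walk jump from each point of
   [A] inside the simplex to the vertices of an empty simplex around it, until
   it is absorbed at the vertices of the original simplex. *)

Require Import Defs.
From HB Require Import structures.
From mathcomp Require Import all_boot all_order all_algebra.
From mathcomp Require Import finmap.
From mathcomp Require Import all_classical all_reals all_analysis.
From mathcomp Require Import lra ring zify.

Set Implicit Arguments.
Unset Strict Implicit.
Unset Printing Implicit Defensive.

Import Order.TTheory GRing.Theory Num.Theory.
Import numFieldNormedType.Exports.

Local Open Scope classical_set_scope.
Local Open Scope ring_scope.

(** * Positive semidefinite block matrices *)

Section psd_blocks.
Variable R : realType.

(** The weights [nu] split [f] thanks to a linearization. Put [rho = c / nu]. A simplex with weights
    [mu] and barycenter [b] supports circuit functions with vertex coefficients [mu a * rho a] and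
    an inner coefficient of absolute value up to [mass * exp (mean of ln rho)]. This is at least
    [mass + sum mu_a ln rho_a], which is linear in [mu] and so adds up over the simplices to
    [sum nu_a + sum nu_a ln rho_a >= d], the relative entropy being nonpositive. The regularization
    is there because [h] need not attain its infimum. Exponents of [A] that occur in no reduced
    circuit are invisible to the circuit cones. The cone compared with the S-cone is therefore
    [decomposable], the sum of the circuit cones and of the rays of these isolated exponents; every
    other ray [|x|^a] already lies in a circuit cone. For the dual part, a dual vector is tested
    against circuit functions for which the circuit inequality is an equality, with arbitrary
    scalings of the vertices. *)

Lemma psd_mxdiag (p : nat) (d : 'I_p -> nat) (B : forall i, 'M[R]_(d i)) :
  psd (\mxdiag_i B i) <-> forall i, psd (B i).
Proof.
have E (u : 'rV[R]_(\sum_i d i)) : (u *m \mxdiag_i B i *m u^T) 0 0 =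
    \sum_i (submxrow u i *m B i *m (submxrow u i)^T) 0 0.
  by rewrite -{1 2}(submxrowK u) mul_mxrow_mxdiag tr_mxrow mul_mxrow_mxcol summxE.
split=> [[Bsym Bge] i|BP]; split.
- by move: Bsym; rewrite tr_mxdiag => /eq_mxdiagP /(_ i).
- move=> u; pose w := \mxrow_j (if pselect (j = i) is left e
    then castmx (erefl, esym (congr1 d e)) u else 0).
  have := Bge w; rewrite E (bigD1 i) //= big1 ?addr0; last first.
    move=> j jNi; rewrite /w mxrowK; case: pselect => [e|_].
      by rewrite e eqxx in jNi.
    by rewrite !mul0mx mxE.
  rewrite /w mxrowK; case: pselect => // e.
  by rewrite (Prop_irrelevance e erefl) castmx_id.
- by rewrite tr_mxdiag; apply: eq_mxdiag => i; case: (BP i).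
- by move=> u; rewrite E; apply: sumr_ge0 => i _; case: (BP i) => _; apply.
Qed.

Lemma psd_block_diag (s : seq {N : nat & 'M[R]_N}) :
  psd (block_diag s) <-> forall M, M \in s -> psd (tagged M).
Proof.
rewrite psd_mxdiag; split=> sP.
  by move=> M /(tnthP (in_tuple s))[i ->].
by move=> i; apply/sP/mem_tnth.
Qed.

Lemma psd_block1 (a : R) : psd (tagged (block1 a)) <-> 0 <= a.
Proof.
rewrite /=; split=> [[_ /(_ 1%:M)]|a0].
  by rewrite mul1mx trmx1 mulmx1 mxE eqxx mulr1n.
split; first by rewrite tr_scalar_mx.
move=> u; rewrite mul_mx_scalar -scalemxAl mxE mulr_ge0 //.
by rewrite mxE big_ord1 mxE -expr2 sqr_ge0.
Qed.

Lemma psd_block2 (a b d : R) :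
  psd (tagged (block2 a b d)) <-> [/\ 0 <= a, 0 <= d & b ^+ 2 <= a * d].
Proof.
rewrite /=; set M := (\matrix_(_, _) _).
have E (u : 'rV[R]_2) : (u *m M *m u^T) 0 0 =
    a * u 0 0 ^+ 2 + b * (u 0 0 * u 0 1) *+ 2 + d * u 0 1 ^+ 2.
  rewrite !mxE !big_ord_recl !big_ord0 !mxE !big_ord_recl !big_ord0 !mxE /=.
  have -> : lift ord0 ord0 = 1 :> 'I_2 by apply/val_inj.
  ring.
have Msym : M^T = M.
  apply/matrixP => i j; rewrite !mxE eq_sym.
  by have [<-|] := eqVneq i j.
split=> [[_ MP]|[a0 d0 bad]].
  have F x y : 0 <= a * x ^+ 2 + b * (x * y) *+ 2 + d * y ^+ 2.
    have := MP (\row_(j < 2) if j == 0 then x else y).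
    by rewrite E !mxE /=.
  have a0 : 0 <= a by have := F 1 0; lra.
  have d0 : 0 <= d by have := F 0 1; lra.
  split=> //.
  have [d00|dn0] := eqVneq d 0.
    have H x : 0 <= a * x ^+ 2 + b * x *+ 2 by have := F x 1; rewrite d00; nra.
    have [->|bn0] := eqVneq b 0; first by rewrite expr2 mul0r mulr_ge0.
    (* With [d = 0] the form takes the value [- (a + 2) * b ^+ 2] at this vector, which contradicts
       [b != 0]. *)
    have := F (-b) (a + 1); rewrite d00.
    have b2 : 0 < b ^+ 2 by rewrite exprn_even_gt0.
    nra.
  have dp : 0 < d by rewrite lt_neqAle eq_sym dn0.
  have := F d (- b).
  have -> : a * d ^+ 2 + b * (d * - b) *+ 2 + d * (- b) ^+ 2
    = d * (a * d - b ^+ 2) by ring.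
  by rewrite pmulr_rge0 // subr_ge0.
split=> // u; rewrite E.
move: (u 0 0) (u 0 1) => x y.
have [a00|an0] := eqVneq a 0.
  move: bad; rewrite a00 mul0r => b2.
  have /eqP : b ^+ 2 = 0 by apply/le_anti; rewrite b2 sqr_ge0.
  by rewrite sqrf_eq0 => /eqP ->; have := sqr_ge0 y; nra.
have ap : 0 < a by rewrite lt_neqAle eq_sym an0.
rewrite -(pmulr_rge0 _ ap).
have -> : a * (a * x ^+ 2 + b * (x * y) *+ 2 + d * y ^+ 2)
  = (a * x + b * y) ^+ 2 + (a * d - b ^+ 2) * y ^+ 2 by ring.
by rewrite addr_ge0 ?sqr_ge0 // mulr_ge0 ?sqr_ge0 // subr_ge0.
Qed.

End psd_blocks.

(** * Binary trees of square roots *)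

Section sqrt_tree.
Variable R : realType.

(* If all the inequalities are equalities, the node [Y k i] is the geometric
   mean of the [2 ^ k] leaves below it. *)
Definition tree_ok (m : nat) (Y : nat -> nat -> R) : Prop :=
  forall k i, (k < m)%N -> (i < 2 ^ (m - k.+1))%N ->
    [/\ 0 <= Y k (2 * i)%N, 0 <= Y k (2 * i).+1
      & Y k.+1 i ^+ 2 <= Y k (2 * i)%N * Y k (2 * i).+1].

(** The leaves below node [i] of level [k.+1] form an interval whose two halves are the leaves below
    its children [2 * i] and [(2 * i).+1]. *)
Lemma prod_leaves_double (F : nat -> R) k i :
  \prod_(0 <= l < 2 ^ k.+1) F (i * 2 ^ k.+1 + l)%N =
  (\prod_(0 <= l < 2 ^ k) F (2 * i * 2 ^ k + l)%N)
  * \prod_(0 <= l < 2 ^ k) F ((2 * i).+1 * 2 ^ k + l)%N.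
Proof.
have e : (2 ^ k.+1 = 2 ^ k + 2 ^ k)%N by rewrite expnS mul2n addnn.
rewrite (@big_cat_nat _ _ _ (2 ^ k)) //=; last by rewrite e leq_addr.
congr (_ * _); first by apply: eq_bigr => l _; congr F; rewrite e; lia.
rewrite -{1}[X in \big[_/_]_(X <= _ < _) _]add0n big_addn.
have -> : (2 ^ k.+1 - 2 ^ k = 2 ^ k)%N by rewrite e addnK.
by apply: eq_bigr => l _; congr F; rewrite e; lia.
Qed.

(** Repeated squaring up the tree. A node enters its own inequality only through its square, so the
    root may have any sign. *)
Lemma tree_le m Y k i : tree_ok m Y -> (0 < k <= m)%N -> (i < 2 ^ (m - k))%N ->
  Y k i ^+ (2 ^ k) <= \prod_(0 <= l < 2 ^ k) Y 0%N (i * 2 ^ k + l)%N.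
Proof.
move=> YP; elim: k i => // k IH i /andP[_ km] im.
have [y0 y1 yy] := YP _ _ km im.
have {}IH j : (j < 2 ^ (m - k))%N -> 0 <= Y k j ->
    Y k j ^+ (2 ^ k) <= \prod_(0 <= l < 2 ^ k) Y 0%N (j * 2 ^ k + l)%N.
  case: k IH km im y0 y1 yy => [|k] IH km im y0 y1 yy jm yj.
    by rewrite big_nat1 expr1 expn0 muln1 addn0.
  exact: IH _ (ltnW km) jm.
have e : (2 ^ (m - k) = 2 * 2 ^ (m - k.+1))%N by rewrite -expnS -subSn.
rewrite prod_leaves_double expnS exprM.
apply: (le_trans (y := (Y k (2 * i)%N * Y k (2 * i).+1) ^+ (2 ^ k))).
  by rewrite lerXn2r // ?nnegrE ?sqr_ge0 // mulr_ge0.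
by rewrite exprMn ler_pM ?exprn_ge0 //; apply: IH => //; rewrite e; lia.
Qed.

(** Taking square roots from the leaves upwards turns every inequality of [tree_ok] into an
    equality. *)
Lemma tree_ex m (L : nat -> R) : (forall l, (l < 2 ^ m)%N -> 0 <= L l) ->
  exists Y, [/\ tree_ok m Y, forall l, Y 0%N l = L l, 0 <= Y m 0%N
    & Y m 0%N ^+ (2 ^ m) = \prod_(0 <= l < 2 ^ m) L l].
Proof.
move=> L0.
pose Y := fix Y k i := if k is k'.+1 then
  Num.sqrt (Y k' (2 * i)%N * Y k' (2 * i).+1) else L i.
have Y0 k i : (k <= m)%N -> (i < 2 ^ (m - k))%N -> 0 <= Y k i.
  by case: k => [|k] km im /=; [apply: L0; rewrite subn0 in im | exact: sqrtr_ge0].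
have e k : (k < m)%N -> (2 ^ (m - k) = 2 * 2 ^ (m - k.+1))%N.
  by move=> km; rewrite -expnS -subSn.
have Ysq k i : (k < m)%N -> (i < 2 ^ (m - k.+1))%N ->
    Y k.+1 i ^+ 2 = Y k (2 * i)%N * Y k (2 * i).+1.
  move=> km im /=; rewrite sqr_sqrtr //.
  by rewrite mulr_ge0 //; apply: Y0; rewrite ?(ltnW km) // (e _ km); lia.
have YE k i : (k <= m)%N -> (i < 2 ^ (m - k))%N ->
    Y k i ^+ (2 ^ k) = \prod_(0 <= l < 2 ^ k) L (i * 2 ^ k + l)%N.
  elim: k i => [|k IH] i km im.
    by rewrite big_nat1 expr1 expn0 muln1 addn0.
  rewrite prod_leaves_double expnS exprM Ysq // exprMn.
  by rewrite !IH ?(ltnW km) // (e _ km); lia.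
exists Y; split=> //.
- move=> k i km im; split; last by rewrite Ysq.
    by apply: Y0; rewrite ?(ltnW km) // (e _ km); lia.
  by apply: Y0; rewrite ?(ltnW km) // (e _ km); lia.
- by apply: Y0; rewrite // subnn.
- by rewrite YE // ?subnn //.
Qed.

End sqrt_tree.

(** * Convex geometry of finite point sets *)

Section simplices.
Variables (R : realType) (n : nat).
Local Notation V := 'rV[R]_n.
Implicit Types (X Y : {fset V}) (mu nu : V -> R).

Definition dot (x y : V) : R := \sum_j x 0 j * y 0 j.

Lemma dotC x y : dot x y = dot y x.
Proof. by apply: eq_bigr => j _; rewrite mulrC. Qed.

Lemma dotDl x y z : dot (x + y) z = dot x z + dot y z.
Proof. by rewrite -big_split; apply: eq_bigr => j _; rewrite mxE mulrDl. Qed.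

Lemma dotZl a x z : dot (a *: x) z = a * dot x z.
Proof. by rewrite /dot mulr_sumr; apply: eq_bigr => j _; rewrite mxE mulrA. Qed.

Lemma dotBl x y z : dot (x - y) z = dot x z - dot y z.
Proof. by rewrite dotDl -scaleN1r dotZl mulN1r. Qed.

Lemma dot0l z : dot 0 z = 0.
Proof. by rewrite -(scale0r 0) dotZl mul0r. Qed.

Lemma dot_suml (I : Type) (r : seq I) (F : I -> V) z :
  dot (\sum_(i <- r) F i) z = \sum_(i <- r) dot (F i) z.
Proof.
elim: r => [|i r IH]; first by rewrite !big_nil dot0l.
by rewrite !big_cons dotDl IH.
Qed.

Lemma dot_ge0 x : 0 <= dot x x.
Proof. by apply: sumr_ge0 => j _; rewrite -expr2 sqr_ge0. Qed.

Lemma dot_eq0 x : (dot x x == 0) = (x == 0).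
Proof.
apply/eqP/eqP => [/eqP|->]; last by rewrite dot0l.
rewrite psumr_eq0; last by move=> j _; rewrite -expr2 sqr_ge0.
move=> /allP x0; apply/rowP => j; rewrite mxE; apply/eqP.
by rewrite -sqrf_eq0 expr2; apply: x0; rewrite mem_index_enum.
Qed.

Lemma dot_continuous z : continuous (fun x : V => dot x z).
Proof.
move=> x; have FF := nbhs_filter x.
apply: (@cvg_big _ _ _ _ _ _ _ (nbhs x)) => [|j _]; first exact: add_continuous.
by apply: cvgMl; exact: coord_continuous.
Qed.

Definition mass X mu : R := \sum_(a <- X) mu a.
Definition moment X mu : V := \sum_(a <- X) mu a *: a.

Lemma massD X mu nu : mass X (fun a => mu a + nu a) = mass X mu + mass X nu.
Proof. exact: big_split. Qed.

Lemma massZ X t mu : mass X (fun a => t * mu a) = t * mass X mu.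
Proof. by rewrite /mass mulr_sumr. Qed.

Lemma momentD X mu nu :
  moment X (fun a => mu a + nu a) = moment X mu + moment X nu.
Proof. by rewrite -big_split; apply: eq_bigr => a _; rewrite scalerDl. Qed.

Lemma momentZ X t mu : moment X (fun a => t * mu a) = t *: moment X mu.
Proof. by rewrite scaler_sumr; apply: eq_bigr => a _; rewrite scalerA. Qed.

Lemma eq_mass X mu nu : {in X, mu =1 nu} -> mass X mu = mass X nu.
Proof. by move=> E; apply: eq_big_seq. Qed.

Lemma eq_moment X mu nu : {in X, mu =1 nu} -> moment X mu = moment X nu.
Proof. by move=> E; apply: eq_big_seq => a /E ->. Qed.

Lemma big_seq_support (U : nmodType) X Y (F : V -> U) : (X `<=` Y)%fset ->
  {in Y, forall a, a \notin X -> F a = 0} ->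
  \sum_(a <- X) F a = \sum_(a <- Y) F a.
Proof.
move=> XY F0; rewrite [RHS](big_fsetID _ (mem X)) /=.
rewrite [X in _ + X]big_seq [X in _ + X]big1 ?addr0; last first.
  by move=> a; rewrite !inE => /andP[aY aX]; exact: F0.
apply: eq_fbigl => a; rewrite !inE andbC.
by case aX: (a \in X) => //=; rewrite (fsubsetP XY).
Qed.

Lemma mass_sub X Y mu : (X `<=` Y)%fset -> {in Y, forall a, a \notin X -> mu a = 0} ->
  mass X mu = mass Y mu.
Proof. exact: big_seq_support. Qed.

Lemma moment_sub X Y mu : (X `<=` Y)%fset ->
  {in Y, forall a, a \notin X -> mu a = 0} -> moment X mu = moment Y mu.
Proof.
by move=> XY m0; apply: big_seq_support => // a aY aX; rewrite m0 ?scale0r.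
Qed.

Lemma sum_dirac (U : lmodType R) X g (F : V -> U) : g \in X ->
  \sum_(a <- X) (a == g)%:R *: F a = F g.
Proof.
move=> gX; rewrite (big_fsetD1 g) //= eqxx scale1r big_seq big1 ?addr0 //.
by move=> a; rewrite !inE => /andP[/negPf -> _]; rewrite scale0r.
Qed.

Lemma mass_dirac X g : g \in X -> mass X (fun a => (a == g)%:R) = 1.
Proof.
by move=> gX; rewrite -[RHS](sum_dirac (U := R^o) (fun=> 1) gX); apply: eq_bigr => a _; rewrite /GRing.scale /= mulr1.
Qed.

Lemma moment_dirac X g : g \in X -> moment X (fun a => (a == g)%:R) = g.
Proof. exact: sum_dirac. Qed.

Lemma aff_indepP X : affinely_independent X <-> forall tau,
  moment X tau = 0 -> mass X tau = 0 -> forall a, a \in X -> tau a = 0.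
Proof.
split=> [XI tau m0 t0 a aX|XI t m0 t0 [a aX]].
  apply: (XI (fun s => tau (val s)) _ _ [` aX]%fset).
  - by rewrite -(big_seq_fsetE _ _ predT (fun a => tau a *: a)).
  - by rewrite -(big_seq_fsetE _ _ predT (fun a => tau a)).
pose tau a := if insub a is Some s then t s else 0.
have tE s : tau (val s) = t s by rewrite /tau valK.
rewrite -tE; apply: XI => //.
- by rewrite /moment big_seq_fsetE /=; under eq_bigr do rewrite tE.
- by rewrite /mass big_seq_fsetE /=; under eq_bigr do rewrite tE.
Qed.

Lemma aff_indep_inj X mu nu : affinely_independent X ->
  mass X mu = mass X nu -> moment X mu = moment X nu -> {in X, mu =1 nu}.
Proof.
move=> /aff_indepP XI e1 e2 a aX; apply/eqP; rewrite -subr_eq0; apply/eqP.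
pose tau a := mu a + -1 * nu a.
have -> : mu a - nu a = tau a by rewrite /tau mulN1r.
apply: XI => //; first by rewrite momentD momentZ e2 scaleN1r subrr.
by rewrite massD massZ e1 mulN1r subrr.
Qed.

(** The predicate on the weights treats convex and affine hulls at once. A combination may repeat a
    point, so the weights of its occurrences are added up, which is where closure of [P] under
    addition enters. *)
Lemma hullE (P : R -> Prop) X x : (forall a b, P a -> P b -> P (a + b)) -> P 0 ->
  (exists k (t : 'I_k -> R) (s : 'I_k -> V),
    [/\ forall i, [set` X] (s i), forall i, P (t i), \sum_(i < k) t i = 1
      & x = \sum_(i < k) t i *: s i]) <->
  exists mu, [/\ {in X, forall a, P (mu a)}, mass X mu = 1 & moment X mu = x].
Proof.
move=> PD P0; split=> [[k [t [s [sX tP t1 ->]]]]|[mu [muP mu1 <-]]].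
  exists (fun a => \sum_(i < k | s i == a) t i); split.
  - by move=> a _; elim/big_ind: _ => // i _; exact: tP.
  - rewrite /mass (exchange_big_dep xpredT) //= -t1; apply: eq_bigr => i _.
    rewrite big_fset_condE /= (_ : [fset a in X | s i == a]%fset = [fset s i]%fset).
      by rewrite big_seq_fset1.
    by apply/fsetP => a; rewrite !inE eq_sym; case: eqVneq => [->|]; rewrite ?andbF // sX.
  rewrite /moment; under eq_bigr do rewrite scaler_suml.
  rewrite (exchange_big_dep xpredT) //=; apply: eq_bigr => i _.
  rewrite big_fset_condE /= (_ : [fset a in X | s i == a]%fset = [fset s i]%fset).
    by rewrite big_seq_fset1.
  by apply/fsetP => a; rewrite !inE eq_sym; case: eqVneq => [->|]; rewrite ?andbF // sX.
exists (size X), (fun i => mu (tnth (in_tuple X) i)), (tnth (in_tuple X)).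
have inX i : tnth (in_tuple X) i \in X by exact: mem_tnth.
split=> //; first by move=> i; exact: muP.
  by rewrite -(big_tnth _ _ _ predT).
by rewrite -(big_tnth _ _ _ predT (fun a => mu a *: a)).
Qed.

Lemma convex_hullP X x : convex_hull [set` X] x <->
  exists mu, [/\ {in X, forall a, 0 <= mu a}, mass X mu = 1 & moment X mu = x].
Proof. by apply: (hullE (P := fun r => 0 <= r)) => //; exact: addr_ge0. Qed.

Lemma affine_hullP X x : affine_hull [set` X] x <->
  exists mu, mass X mu = 1 /\ moment X mu = x.
Proof.
have := hullE (P := fun _ => True) X x (fun _ _ _ _ => I) I.
case=> H1 H2; split=> [[k [t [s [? ? ?]]]]|[mu [? ?]]].
  by have [|mu []] := H1; [exists k, t, s | exists mu].
by have [|k [t [s [? ? ? ?]]]] := H2; [exists mu | exists k, t, s].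
Qed.

(** The matrix with rows [(a, 1)] is row free by affine independence, so its pseudo-inverse recovers
    the weights from moment and mass. The pseudo-inverse commutes with the embedding of [rat],
    whence rational coefficients for rational vertices. *)
Lemma affine_coordinate X a : affinely_independent X -> a \in X ->
  exists (L : V) (b : R),
    (forall mu, mass X mu = 1 -> mu a = dot (moment X mu) L + b)
    /\ ([set` X] `<=` rational_points R n ->
        rational_points R n L /\ exists q : rat, b = ratr q).
Proof.
move=> XI aX.
pose pt (i : 'I_(size X)) := tnth (in_tuple X) i.
have ptX i : pt i \in X by exact: mem_tnth.
pose A : 'M[R]_(size X, n) := \matrix_(i, j) pt i 0 j.
pose M := row_mx A (const_mx 1 : 'M[R]_(size X, 1)).
have rowE mu : (\row_i mu (pt i)) *m M = row_mx (moment X mu) (const_mx (mass X mu)).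
  rewrite mul_mx_row; congr row_mx; apply/rowP => j; rewrite !mxE.
    rewrite /moment [in RHS]big_tnth summxE; apply: eq_bigr => i _; by rewrite !mxE.
  by rewrite /mass [in RHS]big_tnth; apply: eq_bigr => i _; rewrite !mxE mulr1.
have Mfree : row_free M.
  apply: inj_row_free => v vM.
  pose tau c := \sum_(i | pt i == c) v 0 i.
  have ptI i j : (pt j == pt i) = (j == i).
    apply/eqP/eqP => [|-> //]; rewrite /pt !(tnth_nth 0) /= => /eqP.
    by rewrite nth_uniq ?fset_uniq // => /eqP /val_inj.
  have tauE i : tau (pt i) = v 0 i.
    by rewrite /tau (big_pred1 i) // => j; exact: ptI.
  have vE : v = \row_i tau (pt i) by apply/rowP => i; rewrite mxE tauE.
  move: vM; rewrite vE rowE -row_mx0 => /eq_row_mx [m0 t0].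
  apply/rowP => i; rewrite -vE -tauE mxE.
  apply: ((aff_indepP X).1 XI) => //.
  by have := congr1 (fun m : 'M[R]_1 => m 0 0) t0; rewrite !mxE.
have /tnthP[i ai] : a \in (in_tuple X : seq V) by [].
pose N := pinvmx M.
exists (\row_j N (lshift 1 j) i); exists (N (rshift n 0) i); split.
  move=> mu mu1.
  have : (\row_i mu (pt i)) *m M *m N = \row_i mu (pt i).
    by rewrite -mulmxA mulmxVp // mulmx1.
  rewrite rowE => /(congr1 (fun m : 'rV[R]_(size X) => m 0 i)).
  rewrite [in RHS]mxE /pt -ai => <-.
  rewrite mxE big_split_ord /= big_ord1 row_mxEr mxE mu1 mul1r; congr (_ + _).
  by apply: eq_bigr => j _; rewrite row_mxEl mxE.
move=> Xrat.
have {Xrat} MQ i0 j0 : exists q : rat, M i0 j0 = ratr q.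
  rewrite mxE; case: splitP => j _; last by exists 1; rewrite mxE rmorph1.
  by rewrite mxE; apply: (Xrat (pt i0)); exact: ptX.
have [M0 M0E] : exists M0 : 'M[rat]_(size X, n + 1), M = map_mx ratr M0.
  have [f fE] := choice (fun ij => MQ ij.1 ij.2).
  exists (\matrix_(i0, j0) f (i0, j0)); apply/matrixP => i0 j0.
  by rewrite !mxE -(fE (i0, j0)) mxE.
have NE : N = map_mx ratr (pinvmx M0) by rewrite /N M0E map_pinvmx.
by split=> [j|]; rewrite NE !mxE; eexists.
Qed.

(** A point of the relative interior can be moved a little away from a vertex [a] without leaving
    the simplex; the weight of [a] becomes [(1 + t) * mu a - t >= 0], so [mu a > 0]. Conversely,
    barycentric coordinates are affine, hence continuous, and positive ones stay positive nearby. *)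
Lemma relint_simplexP X x : affinely_independent X ->
  relint (convex_hull [set` X]) x <->
  exists mu, [/\ {in X, forall a, 0 < mu a}, mass X mu = 1 & moment X mu = x].
Proof.
move=> XI.
have hull_sub y : affine_hull (convex_hull [set` X]) y -> affine_hull [set` X] y.
  move=> [k [t [s [sP t1 ->]]]]; apply/affine_hullP.
  have [f fP] := choice (fun i => (convex_hullP X (s i)).1 (sP i)).
  exists (fun a => \sum_(i < k) t i * f i a).
  split; rewrite /mass /moment.
    rewrite exchange_big /= -t1; apply: eq_bigr => i _.
    by case: (fP i) => _ f1 _; rewrite -mulr_sumr -/(mass X _) f1 mulr1.
  under eq_bigr do rewrite scaler_suml.
  rewrite exchange_big /=; apply: eq_bigr => i _.
  case: (fP i) => _ _ <-; rewrite /moment scaler_sumr.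
  by apply: eq_bigr => a _; rewrite scalerA.
split=> [[/convex_hullP[mu [mu0 mu1 mux]] nearx]|[mu [mu0 mu1 mux]]].
  exists mu; split=> // a aX.
  have /filter_ex : \forall t \near (0 : R)^'+, 0 < t /\
      (affine_hull (convex_hull [set` X]) (x + t *: (x - a)) ->
       convex_hull [set` X] (x + t *: (x - a))).
    apply: filterI; first exact: nbhs_right_gt.
    apply: cvg_within; rewrite -/(nbhs _ _).
    have H : (fun t : R => x + t *: (x - a)) @ (0 : R) --> x.
      rewrite -[X in _ --> X]addr0 -(scale0r (x - a)).
      by apply: cvgD; [exact: cvg_cst | apply: cvgZl; exact: cvg_id].
    exact: (H _ nearx).
  move=> [t [t0 tP]].
  have /tP/convex_hullP[nu [nu0 nu1 nuE]] :
      affine_hull (convex_hull [set` X]) (x + t *: (x - a)).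
    have aH b : b \in X -> convex_hull [set` X] b.
      move=> bX; apply/convex_hullP; exists (fun c => (c == b)%:R).
      by rewrite mass_dirac ?moment_dirac //; split=> // c _; rewrite ler0n.
    have xH : convex_hull [set` X] x by apply/convex_hullP; exists mu.
    exists 2%N, (fun i => if i == 0 then 1 + t else - t),
      (fun i => if i == 0 then x else a); split.
    - by move=> i; case: (i == 0); rewrite //; exact: aH.
    - by rewrite !big_ord_recl big_ord0 /=; ring.
    - rewrite !big_ord_recl big_ord0 /= addr0 scalerDl scale1r scaleNr scalerBr.
      by rewrite addrA.
  have : nu a = (1 + t) * mu a + - t * (a == a)%:R.
    apply: (@aff_indep_inj X nu
      (fun c => (1 + t) * mu c + - t * (c == a)%:R)) => //.
      by rewrite massD !massZ mass_dirac // mu1 nu1; ring.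
    rewrite momentD !momentZ moment_dirac // nuE mux scalerDl scale1r scaleNr.
    by rewrite scalerBr addrA.
  have := nu0 a aX; rewrite eqxx => + E; rewrite E mulr1; nra.
split; first by apply/convex_hullP; exists mu; split=> // a aX; exact: ltW (mu0 a aX).
have H (a : X) : \forall y \near x, forall nu, mass X nu = 1 -> moment X nu = y ->
    0 <= nu (val a).
  have [L [b [LE _]]] := affine_coordinate XI (valP a).
  have : dot x L + b > 0 by rewrite -mux -LE // mu0 ?(valP a).
  move=> pos.
  have FF := nbhs_filter x.
  have cvgx : (fun y : V => dot y L + b) @ x --> dot x L + b.
    by apply: cvgD; [exact: dot_continuous | exact: cvg_cst].
  have P := cvgr_gt _ cvgx _ pos.
  near=> y => nu nu1 nuy; rewrite LE // nuy; apply: ltW.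
  by near: y; exact: P.
have {}H := filter_forall (nbhs_filter x) H.
apply: filterS H => y Hy /hull_sub/affine_hullP[nu [nu1 nuy]].
apply/convex_hullP; exists nu; split=> // a aX.
exact: (Hy [` aX]%fset nu).
Unshelve. all: by end_near.
Qed.

End simplices.

(** * Caratheodory's theorem, empty simplices and absorbing walks *)

Section caratheodory.
Variables (R : realType) (n : nat).
Local Notation V := 'rV[R]_n.
Implicit Types (X Y : {fset V}) (mu nu : V -> R).

Definition energy X mu : R := \sum_(a <- X) mu a * dot a a.

Lemma energyD X mu nu :
  energy X (fun a => mu a + nu a) = energy X mu + energy X nu.
Proof. by rewrite -big_split; apply: eq_bigr => a _; rewrite mulrDl. Qed.

Lemma energyZ X t mu : energy X (fun a => t * mu a) = t * energy X mu.
Proof. by rewrite /energy mulr_sumr; apply: eq_bigr => a _; rewrite mulrA. Qed.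

Lemma energy_dirac X g : g \in X -> energy X (fun a => (a == g)%:R) = dot g g.
Proof. exact: (sum_dirac (U := R^o) (fun a => dot a a)). Qed.

Lemma energy_sub X Y mu : (X `<=` Y)%fset ->
  {in Y, forall a, a \notin X -> mu a = 0} -> energy X mu = energy Y mu.
Proof.
by move=> XY m0; apply: big_seq_support => // a aY aX; rewrite m0 ?mul0r.
Qed.

(** The difference of the two sides is the variance [sum mu_a |a - g|^2], which vanishes only if all
    the weight sits at [g]. *)
Lemma energy_moment X mu g : {in X, forall a, 0 <= mu a} -> mass X mu = 1 ->
  moment X mu = g -> g \notin X -> dot g g < energy X mu.
Proof.
move=> mu0 mu1 mug gX.
have E : \sum_(a <- X) mu a * dot (a - g) (a - g) = energy X mu - dot g g.
  have H a : mu a * dot (a - g) (a - g) =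
      mu a * dot a a - mu a * dot a g *+ 2 + mu a * dot g g.
    by rewrite !dotBl !(dotC _ (_ - _)) !dotBl (dotC g a); ring.
  under eq_bigr do rewrite H.
  rewrite !big_split /= sumrN -/(energy X mu) -mulr_suml -/(mass X mu) mu1 mul1r.
  rewrite sumrMnl.
  have -> : \sum_(a <- X) mu a * dot a g = dot g g.
    rewrite -{2}mug dot_suml; by apply: eq_bigr => a _; rewrite dotZl.
  ring.
have ge0 a : a \in X -> 0 <= mu a * dot (a - g) (a - g).
  by move=> aX; rewrite mulr_ge0 ?dot_ge0 ?mu0.
rewrite -subr_gt0 -E lt_neqAle big_seq sumr_ge0 ?andbT //.
apply/eqP => /esym/eqP; rewrite psumr_eq0 // => /allP E0.
have : mass X mu = 0.
  rewrite /mass big_seq big1 // => a aX; have := E0 a aX.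
  rewrite aX /= mulf_eq0 dot_eq0 subr_eq0 => /orP[/eqP //|/eqP ag].
  by move: gX; rewrite -ag aX.
by rewrite mu1 => /eqP; rewrite oner_eq0.
Qed.

(** The ratio test of the simplex method: [s] is the least [nu a / - tau a] over the points with
    [tau a < 0]. *)
Lemma exit_time Y nu tau a0 : {in Y, forall a, 0 <= nu a} ->
  {in Y, forall a, tau a < 0 -> 0 < nu a} -> a0 \in Y -> tau a0 < 0 ->
  exists s, [/\ 0 < s, {in Y, forall a, 0 <= nu a + s * tau a}
    & exists2 a, a \in Y & nu a + s * tau a = 0].
Proof.
move=> nu0 nup a0Y ta0.
pose F (i : Y) := nu (val i) / - tau (val i).
pose P (i : Y) := tau (val i) < 0.
have Pi0 : P [` a0Y]%fset by [].
case: (arg_minP F Pi0) => i Pi Fi; exists (F i); split.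
- by rewrite divr_gt0 ?oppr_gt0 // nup // (valP i).
- move=> a aY; have [ta|ta] := ltP (tau a) 0; last first.
    rewrite addr_ge0 ?nu0 // mulr_ge0 // divr_ge0 ?nu0 ?(valP i) //.
    by rewrite oppr_ge0 ltW.
  have := Fi [` aY]%fset ta; rewrite [X in _ <= X]/F /=.
  by rewrite ler_pdivlMr ?oppr_gt0 // mulrN -subr_ge0 opprK.
- exists (val i); first exact: valP.
  by rewrite /F invrN mulrN mulNr divfK ?subrr // lt_eqF.
Qed.

(** Caratheodory's theorem as an induction on the size of the support. An affinely dependent support
    carries a nonzero signed [tau] with zero mass and moment; moving along [tau] and along [- tau]
    until some weight vanishes gives two measures of smaller support, and [nu] is a convex
    combination of them. *)
Lemma caratheodory_ind X (b : V) (Q : (V -> R) -> Prop) :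
  (forall mu nu, Q mu -> Q nu -> Q (fun a => mu a + nu a)) ->
  (forall Y nu, (Y `<=` X)%fset -> affinely_independent Y ->
     {in Y, forall a, 0 < nu a} -> (forall a, a \notin Y -> nu a = 0) ->
     moment Y nu = mass Y nu *: b -> Q nu) ->
  forall nu, (forall a, 0 <= nu a) -> (forall a, a \notin X -> nu a = 0) ->
    moment X nu = mass X nu *: b -> Q nu.
Proof.
move=> QD QI nu.
pose supp mu := [fset a in X | mu a != 0]%fset.
have [m] := ubnP #|` supp nu|.
elim: m nu => // m IH nu /ltnSE Hm nu0 nuX nub.
set Y := supp nu in Hm.
have YX : (Y `<=` X)%fset by apply/fsubsetP => a; rewrite !inE => /andP[].
have nuY a : a \notin Y -> nu a = 0.
  rewrite !inE; have [aX|aX _] := boolP (a \in X); last exact: nuX.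
  by rewrite negbK => /eqP.
have nup a : a \in Y -> 0 < nu a.
  by rewrite !inE => /andP[_]; rewrite lt_neqAle eq_sym nu0 andbT.
have mE : mass Y nu = mass X nu by apply: mass_sub => // a _; exact: nuY.
have ME : moment Y nu = moment X nu by apply: moment_sub => // a _; exact: nuY.
have [YI|] := pselect (affinely_independent Y).
  by apply: (QI Y) => //; rewrite ME mE.
move=> /aff_indepP/existsNP[tau0] /not_implyP[M0] /not_implyP[m0].
move=> /existsNP[c] /not_implyP[cY /eqP tc0].
pose tau a := if a \in Y then tau0 a else 0.
have tauY a : a \notin Y -> tau a = 0 by rewrite /tau => /negPf ->.
have tauE : {in Y, tau =1 tau0} by move=> a; rewrite /tau => ->.
have {}M0 : moment X tau = 0.
  rewrite -M0 -(moment_sub YX); last by move=> a _; exact: tauY.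
  exact: eq_moment.
have {}m0 : mass X tau = 0.
  rewrite -m0 -(mass_sub YX); last by move=> a _; exact: tauY.
  exact: eq_mass.
(* Having zero total mass and a nonzero value, [tau] takes both signs. *)
have neg sg : sg != 0 -> exists2 a, a \in Y & sg * tau a < 0.
  move=> sg0; apply: contrapT => noneg.
  have ge0 a : a \in X -> 0 <= sg * tau a.
    move=> aX; rewrite leNgt; apply/negP => lt0; apply: noneg; exists a => //.
    by have [//|/tauY ta] := boolP (a \in Y); rewrite ta mulr0 ltxx in lt0.
  have : \sum_(a <- X) sg * tau a = 0 by rewrite -mulr_sumr -/(mass X tau) m0 mulr0.
  rewrite big_seq => /eqP; rewrite psumr_eq0 // => /allP /(_ c).
  by rewrite (fsubsetP YX _ cY) /= mulf_eq0 (negPf sg0) tauE // (negPf tc0) => /(_ isT).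
(* The factor [t] is built in because [Q] is assumed additive but not homogeneous. *)
have shift sg : sg != 0 -> exists s, [/\ 0 < s,
    (forall a, 0 <= nu a + s * (sg * tau a)) &
    forall t, 0 <= t -> Q (fun a => t * (nu a + s * (sg * tau a)))].
  move=> /neg[a0 a0Y ta0].
  have [||s [s0 sP [a1 a1Y sa1]]] := @exit_time Y nu (fun a => sg * tau a) a0 _ _ a0Y ta0.
  - by move=> a _; exact: nu0.
  - by move=> a aY _; exact: nup.
  have ge0 a : 0 <= nu a + s * (sg * tau a).
    have [/sP //|aY] := boolP (a \in Y).
    by rewrite (nuY _ aY) (tauY _ aY) !mulr0 addr0.
  exists s; split=> // t t0; apply: IH.
  - apply: leq_trans Hm; apply: fproper_ltn_card.
    rewrite fproperE; apply/andP; split.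
      apply/fsubsetP => a; rewrite !inE => /andP[-> ]; rewrite /=.
      apply: contraNN => /eqP na; rewrite na add0r.
      have -> : tau a = 0 by rewrite /tau !inE na eqxx andbF.
      by rewrite !mulr0.
    apply/negP => /fsubsetP /(_ a1 a1Y).
    by rewrite !inE sa1 mulr0 eqxx andbF.
  - by move=> a; rewrite mulr_ge0.
  - move=> a aX; rewrite nuX // tauY ?mulr0 ?addr0 ?mulr0 //.
    by apply: contraNN aX; exact: (fsubsetP YX).
  - rewrite momentZ massZ momentD massD !momentZ !massZ M0 m0 !scaler0 !mulr0.
    by rewrite !addr0 nub scalerA.
have [s1 [s10 _ Q1]] := shift 1 (oner_neq0 _).
have [|s2 [s20 _ Q2]] := shift (-1); first by rewrite oppr_eq0 oner_neq0.
have s12 : 0 < s1 + s2 by rewrite addr_gt0.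
(* With these two weights the displacements [s1 * tau] and [- s2 * tau] cancel. *)
have := QD _ _ (Q1 (s2 / (s1 + s2)) (divr_ge0 (ltW s20) (ltW s12)))
  (Q2 (s1 / (s1 + s2)) (divr_ge0 (ltW s10) (ltW s12))).
congr Q; apply/funext => a; field.
exact: lt0r_neq0.
Qed.

Definition barycenter Y mu g :=
  [/\ {in Y, forall a, 0 < mu a}, mass Y mu = 1 & moment Y mu = g].

(* Among the simplices with vertices in [D] that have [g] in their interior,
   one of minimal energy contains no further point of [D]: moving some weight
   to such a point would decrease the energy. *)
Lemma empty_simplex (D : {fset V}) g : g \notin D -> convex_hull [set` D] g ->
  exists Y mu, [/\ (Y `<=` D)%fset, affinely_independent Y, barycenter Y mu g
    & forall a, a \in D -> convex_hull [set` Y] a -> a \in Y].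
Proof.
move=> gD /convex_hullP[nu0 [nu0_ge0 nu01 nu0g]].
pose good Y mu := affinely_independent Y /\ barycenter Y mu g.
(* A lower bound for the energy on simplices extends to all weights on [D] with barycenter [g],
   since both sides are linear in the weights. *)
have caraD (C : R) : (forall Y mu, (Y `<=` D)%fset -> good Y mu -> C <= energy Y mu) ->
    forall nu, {in D, forall a, 0 <= nu a} -> mass D nu = 1 -> moment D nu = g ->
    C <= energy D nu.
  move=> minC nu nu_ge0 nu1 nug.
  pose nu' a := if a \in D then nu a else 0.
  have nuE : {in D, nu' =1 nu} by move=> a; rewrite /nu' => ->.
  have : C * mass D nu' <= energy D nu'.
    apply: (@caratheodory_ind D g (fun mu => C * mass D mu <= energy D mu)).
    - by move=> mu1 mu2 H1 H2; rewrite massD energyD mulrDr lerD.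
    - move=> Y mu YD YI mup muY mug.
      rewrite -(mass_sub YD); last by move=> a _; exact: muY.
      rewrite -(energy_sub YD); last by move=> a _; exact: muY.
      have m_ge0 : 0 <= mass Y mu.
        by rewrite /mass big_seq sumr_ge0 // => a /mup/ltW.
      have [m0|mN0] := eqVneq (mass Y mu) 0.
        rewrite m0 mulr0 /energy big_seq sumr_ge0 // => a /mup mua.
        by rewrite mulr_ge0 ?dot_ge0 // ltW.
      have mp : 0 < mass Y mu by rewrite lt_neqAle eq_sym mN0.
      have := minC Y (fun a => (mass Y mu)^-1 * mu a) YD.
      rewrite energyZ ler_pdivlMl // mulrC; apply.
      split=> //; split.
      + by move=> a /mup mua; rewrite mulr_gt0 ?invr_gt0.
      + by rewrite massZ mulVf.
      + by rewrite momentZ mug scalerA mulVf // scale1r.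
    - by move=> a; rewrite /nu'; case: ifP => // /nu_ge0.
    - by move=> a; rewrite /nu' => /negPf ->.
    - by rewrite (eq_moment nuE) (eq_mass nuE) nu1 nug scale1r.
  rewrite (eq_mass nuE) nu1 mulr1.
  by rewrite /energy; under [X in _ <= X]eq_big_seq => a aD do rewrite nuE //.
(* There are finitely many vertex sets, and affine independence makes the weights [F Y] unique, so a
   simplex of minimal energy exists once [K] is nonempty. *)
pose K := [fset Y in fpowerset D | `[< exists mu, good Y mu >]]%fset.
have [F FP] : {F : {fset V} -> V -> R &
    forall Y, (exists mu, good Y mu) -> good Y (F Y)}.
  apply: (@choice {fset V} (V -> R) (fun Y mu => (exists mu, good Y mu) -> good Y mu)).
  move=> Y; have [[mu gmu]|noY] := pselect (exists mu, good Y mu); first by exists mu.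
  by exists (fun=> 0).
have KP Y : Y \in K -> (Y `<=` D)%fset /\ good Y (F Y).
  by rewrite !inE fpowersetE => /andP[YD /asboolP/FP].
have inK Y mu : (Y `<=` D)%fset -> good Y mu -> Y \in K.
  by move=> YD gmu; rewrite !inE fpowersetE YD; apply/asboolP; exists mu.
have FE Y mu : good Y mu -> energy Y mu = energy Y (F Y).
  move=> gmu; have [YI [_ m1 mg]] := gmu.
  have [_ [_ F1 Fg]] := FP Y (ex_intro _ mu gmu).
  have E := aff_indep_inj YI (etrans m1 (esym F1)) (etrans mg (esym Fg)).
  by apply: eq_big_seq => a aY; rewrite E.
have [Y0 Y0K] : exists Y, Y \in K.
  (* Without any simplex the hypothesis of [caraD] is vacuous, and every real number would be a
     lower bound for the energy of [nu0]. *)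
  apply: contrapT => noK.
  have H C : C <= energy D nu0.
    apply: caraD => // Y mu YD gmu; exfalso; apply: noK; exists Y.
    exact: inK gmu.
  by have := H (energy D nu0 + 1); rewrite gerDl ler10.
pose P (i : K) := true.
have [] := @arg_minP _ _ _ [` Y0K]%fset P (fun i : K => energy (val i) (F (val i))) isT.
move=> [Y YK] _ /= Ymin.
have [YD [YI [Fp F1 Fg]]] := KP _ YK.
have minE Y' mu : (Y' `<=` D)%fset -> good Y' mu -> energy Y (F Y) <= energy Y' mu.
  move=> Y'D gmu; rewrite (FE _ _ gmu).
  exact: (Ymin [` inK _ _ Y'D gmu]%fset).
exists Y, (F Y); split=> // a aD /convex_hullP[mu [mu0 mu1 mua]].
have [//|aY] := boolP (a \in Y); exfalso.
pose ext (nu : V -> R) c := if c \in Y then nu c else 0.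
have extY nu c : c \notin Y -> ext nu c = 0 by rewrite /ext => /negPf ->.
have extE nu : {in Y, ext nu =1 nu} by move=> c; rewrite /ext => ->.
have extm nu : mass D (ext nu) = mass Y nu.
  by rewrite -(mass_sub YD) ?(eq_mass (extE nu)) // => c _; exact: extY.
have extM nu : moment D (ext nu) = moment Y nu.
  by rewrite -(moment_sub YD) ?(eq_moment (extE nu)) // => c _; exact: extY.
have exte nu : energy D (ext nu) = energy Y nu.
  rewrite -(energy_sub YD); last by move=> c _; exact: extY.
  by apply: eq_big_seq => c cY; rewrite extE.
have [c0 c0Y c0p] : exists2 c, c \in Y & 0 < mu c.
  apply: contrapT => noc; have : mass Y mu = 0.
    rewrite /mass big_seq big1 // => c cY; apply/eqP; rewrite eq_le mu0 // andbT.
    by rewrite leNgt; apply/negP => cp; apply: noc; exists c.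
  by rewrite mu1 => /eqP; rewrite oner_eq0.
(* The part [s * mu] of the weights [F Y] is replaced by a mass [s] at [a]. The barycenter remains
   [g], while the energy changes by [s * (dot a a - energy Y mu)], which is negative. *)
have [|||s [s0 sP _]] := @exit_time Y (F Y) (fun c => - mu c) c0 _ _ c0Y.
- by move=> c /Fp/ltW.
- by move=> c /Fp.
- by rewrite oppr_lt0.
pose tau c := (c == a)%:R + -1 * ext mu c.
have := caraD (energy Y (F Y)) minE (fun c => ext (F Y) c + s * tau c).
rewrite massD massZ massD massZ momentD momentZ momentD momentZ !extm !extM.
rewrite mass_dirac // moment_dirac // mu1 mua F1 Fg scaleN1r subrr scaler0 addr0.
rewrite mulN1r subrr mulr0 addr0 energyD energyZ energyD energyZ !exte energy_dirac //.
move=> /(_ _ erefl erefl) H.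
have {H} : energy Y (F Y) <= energy Y (F Y) + s * (dot a a + -1 * energy Y mu).
  apply: H => c cD; rewrite /tau.
  have [cY|cY] := boolP (c \in Y).
    have := sP c cY; rewrite !extE //; have := ler0n R (c == a); nra.
  by rewrite !extY // add0r mulr0 addr0 mulr_ge0 ?ler0n // ltW.
rewrite lerDl pmulr_rge0 // mulN1r subr_ge0 leNgt.
by rewrite (energy_moment mu0 mu1 mua aY).
Qed.

(* Absorbing random walk: the transient states [S \ T] are eliminated one by one;
   each step strictly increases the expectation of [phi], so that no transient
   state is left with probability 0. *)
Lemma eliminate (S T : {fset V}) (phi : V -> R) (Z : (V -> R) -> Prop) :
  (forall z w, Z z -> Z w -> Z (fun a => z a + w a)) ->
  (forall t z, 0 <= t -> Z z -> Z (fun a => t * z a)) ->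
  (forall z, Z z -> mass S z = 0) ->
  {in S, forall g, g \notin T -> exists nu,
     [/\ forall a, 0 <= nu a, forall a, a \notin S -> nu a = 0,
         Z (fun a => nu a - (a == g)%:R)
       & 0 < \sum_(a <- S) (nu a - (a == g)%:R) * phi a]} ->
  {in S, forall g, g \notin T -> exists nu,
     [/\ forall a, 0 <= nu a, forall a, a \notin T -> nu a = 0
       & Z (fun a => nu a - (a == g)%:R)]}.
Proof.
move=> ZD ZZ Zm step.
pose Phi z := \sum_(a <- S) z a * phi a.
have PhiD z w : Phi (fun a => z a + w a) = Phi z + Phi w.
  by rewrite /Phi -big_split; apply: eq_bigr => a _; rewrite mulrDl.
have PhiZ t z : Phi (fun a => t * z a) = t * Phi z.
  by rewrite /Phi mulr_sumr; apply: eq_bigr => a _; rewrite mulrA.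
(* Generalized for induction: [U] lists the states eliminated so far. *)
have main (U : seq V) : {subset U <= [predD S & T]} ->
    forall g, g \in S -> g \notin T -> exists nu,
     [/\ forall a, 0 <= nu a, forall a, a \notin S -> nu a = 0,
         forall a, a \in U -> nu a = 0,
         Z (fun a => nu a - (a == g)%:R)
       & 0 < Phi (fun a => nu a - (a == g)%:R)].
  elim: U => [_ g gS gT|h U IH UST].
    by have [nu [? ? ? ?]] := step g gS gT; exists nu.
  have /IH {}IH : {subset U <= [predD S & T]}.
    by move=> a aU; apply: UST; rewrite inE aU orbT.
  have /andP[hT hS] : h \in [predD S & T] by apply: UST; rewrite mem_head.
  have [nu [nu0 nuS nuU nuZ nuP]] := IH h hS hT.
  have nu1 : mass S nu = 1.
    have := Zm _ nuZ; rewrite massD.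
    have -> : mass S (fun a => - (a == h)%:R) = -1.
      by rewrite /mass sumrN -/(mass S _) mass_dirac.
    by move=> /eqP; rewrite subr_eq0 => /eqP.
  have nuh : nu h < 1.
    rewrite ltNge; apply/negP => h1.
    have nu0' a : a \in S -> a != h -> nu a = 0.
      move=> aS ah; apply/eqP; rewrite eq_le nu0 andbT.
      move: nu1; rewrite /mass (big_fsetD1 h) //= (big_fsetD1 a) /=; last by rewrite !inE ah.
      have : 0 <= \sum_(i <- ((S `\ h) `\ a)%fset) nu i by rewrite sumr_ge0.
      lra.
    have h1' : nu h = 1.
      rewrite -nu1 /mass (big_fsetD1 h) //= big_seq big1 ?addr0 // => a.
      by rewrite !inE => /andP[ah aS]; exact: nu0'.
    move: nuP; rewrite /Phi big_seq big1 ?ltxx // => a aS.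
    have [->|ah] := eqVneq a h; first by rewrite h1' subrr mul0r.
    by rewrite nu0' // subrr mul0r.
  have d0 : 0 < 1 - nu h by rewrite subr_gt0.
  (* The law of the next state conditioned on leaving [h]. *)
  pose nu' a := if a == h then 0 else nu a / (1 - nu h).
  have E : (fun a => nu' a - (a == h)%:R) = (fun a => (1 - nu h)^-1 * (nu a - (a == h)%:R)).
    apply/funext => a; rewrite /nu'; case: eqVneq => [->|_].
      by rewrite -[nu h - _]opprB mulrN mulVf ?sub0r // gt_eqF.
    by rewrite /= !subr0 mulrC.
  have nu'0 a : 0 <= nu' a by rewrite /nu'; case: ifP => // _; rewrite divr_ge0 // ltW.
  have nu'Z : Z (fun a => nu' a - (a == h)%:R) by rewrite E; apply: ZZ => //; rewrite invr_ge0 ltW.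
  have nu'P : 0 <= Phi (fun a => nu' a - (a == h)%:R).
    by rewrite E PhiZ mulr_ge0 ?invr_ge0 // ltW.
  move=> g gS gT; have [mu [mu0 muS muU muZ muP]] := IH g gS gT.
  (* The mass that [mu] puts on [h] is redistributed according to [nu']. *)
  have Emu : (fun a => (if a == h then 0 else mu a) + mu h * nu' a - (a == g)%:R) =
      (fun a => (mu a - (a == g)%:R) + mu h * (nu' a - (a == h)%:R)).
    apply/funext => a; case: eqVneq => [->|_]; last by rewrite subr0; ring.
    by rewrite /nu' eqxx mulr1n; ring.
  exists (fun a => (if a == h then 0 else mu a) + mu h * nu' a); split.
  - by move=> a; rewrite addr_ge0 ?mulr_ge0 //; case: ifP.
  - move=> a aS; rewrite muS // if_same /nu' nuS // mul0r if_same mulr0 addr0 //.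
  - move=> a; rewrite inE /nu'; case: eqVneq => [_ _|_ /= aU]; first by rewrite mulr0 addr0.
    by rewrite muU // nuU // mul0r mulr0 addr0.
  - by rewrite Emu; apply: ZD => //; exact: ZZ.
  - by rewrite Emu PhiD PhiZ ltr_wpDr // mulr_ge0.
move=> g gS gT.
have [|nu [nu0 nuS nuU nuZ _]] := main (S `\` T)%fset _ g gS gT.
  by move=> a; rewrite !inE.
exists nu; split=> // a aT; have [aS|/nuS //] := boolP (a \in S).
by apply: nuU; rewrite !inE aT.
Qed.

End caratheodory.

(** * Entropy certificates for exponential sums *)

Section entropy.
Variable R : realType.

(** From [expR (- x) >= 1 - x] one gets [(1 - x) * expR x <= 1], and [(1 - x) * (1 + x + 2 * x ^+ 2)
    = 1 + x ^+ 2 * (1 - 2 * x)] is at least 1. *)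
Lemma expR_le_quad (x : R) : `|x| <= 2^-1 -> expR x <= 1 + x + 2 * x ^+ 2.
Proof.
rewrite ler_norml => /andP[x1 x2].
have := expR_ge1Dx (- x); rewrite expRN => H.
have e0 := expR_gt0 x.
have {}H : (1 - x) * expR x <= 1.
  by rewrite -ler_pdivlMr // div1r.
have E : 0 <= x ^+ 2 * (1 - 2 * x) by rewrite mulr_ge0 ?sqr_ge0 //; lra.
have xp : 0 < 1 - x by lra.
rewrite -(ler_pM2l xp); apply: (le_trans H); nra.
Qed.

(** Fermat's rule without derivatives: for small [s] of the sign opposite to [G], the linear term
    outweighs the quadratic one. *)
Lemma quad_ge0_lin (s0 G K : R) : 0 < s0 -> 0 <= K ->
  (forall s, `|s| <= s0 -> 0 <= s * G + s ^+ 2 * K) -> G = 0.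
Proof.
move=> s0p K0 H.
have half G' : (forall s, `|s| <= s0 -> 0 <= s * G' + s ^+ 2 * K) -> 0 <= G'.
  move=> H'; rewrite leNgt; apply/negP => G0.
  have K1 : 0 < 2 * (K + 1) by lra.
  pose r := Num.min s0 (- G' / (2 * (K + 1))).
  have r0 : 0 < r by rewrite lt_min s0p divr_gt0 // oppr_gt0.
  have r1 : r <= s0 by rewrite ge_min lexx.
  have r2 : r * (2 * (K + 1)) <= - G' by rewrite -ler_pdivlMr // ge_min lexx orbT.
  have := H' r; rewrite (gtr0_norm r0) => /(_ r1).
  rewrite expr2 -mulrA -mulrDr pmulr_rge0 //; nra.
apply/eqP; rewrite eq_le half // andbT -oppr_ge0; apply: half => s.
by rewrite -normrN => /H; rewrite sqrrN mulrN mulNr.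
Qed.

Section family.
Variables (n k : nat) (c : 'I_k -> R) (u : 'I_k -> 'rV[R]_n) (d : R).
Hypothesis c_gt0 : forall i, 0 < c i.

Let h (t : 'rV[R]_n) := \sum_i c i * expR (dot (u i) t).

Lemma partition_continuous : continuous h.
Proof.
move=> t; have FF := nbhs_filter t.
apply: (@cvg_big _ _ _ _ _ _ _ (nbhs t)) => [|i _]; first exact: add_continuous.
apply: cvgMr; apply: (@continuous_comp _ _ _ (fun t => dot (u i) t) expR).
  by rewrite (funext (dotC _)); exact: dot_continuous.
exact: continuous_expR.
Qed.

Lemma dot_self_continuous m : continuous (fun t : 'rV[R]_m => dot t t).
Proof.
move=> t; have FF := nbhs_filter t.
apply: (@cvg_big _ _ _ _ _ _ _ (nbhs t)) => [|j _]; first exact: add_continuous.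
by apply: cvgM; exact: coord_continuous.
Qed.

Lemma box_compact m (a b : R) :
  compact [set v : 'rV[R]_m | forall i, v 0 i \in `[a, b]].
Proof. by apply: (@rV_compact _ _ (fun=> `[a, b]%classic)) => i; exact: segment_compact. Qed.

(** Outside a large box the term [e * dot t t] alone reaches the value [h 0] at the origin, so a
    minimizer over the box is a global one. *)
Lemma regularized_min (e : R) : 0 < e -> exists t0, forall t,
  h t0 + e * dot t0 t0 <= h t + e * dot t t.
Proof.
move=> e0; pose F t := h t + e * dot t t.
have h0 : 0 <= h 0 by apply: sumr_ge0 => i _; rewrite mulr_ge0 ?expR_ge0 // ltW.
(* The summand 1 ensures [M ^+ 2 >= M], and [e * M >= h 0]. *)
pose M := h 0 / e + 1.
have M1 : 1 <= M by rewrite lerDr divr_ge0 // ltW.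
have MM : h 0 <= e * M ^+ 2.
  rewrite mulrC -ler_pdivrMr //; apply: (@le_trans _ _ M); first by rewrite lerDl.
  by rewrite expr2 ler_peMl // (le_trans ler01).
pose B := [set v : 'rV[R]_n | forall i, v 0 i \in `[- M, M]].
have B0 : B 0 by move=> i; rewrite mxE in_itv /=; lra.
have [||t0 _ t0min] := @compact_EVT_min _ _ F B _ (@box_compact n (- M) M).
- by exists 0.
- apply: continuous_subspaceT => t; have FF := nbhs_filter t; apply: cvgD; first exact: partition_continuous.
  by apply: cvgMr; exact: dot_self_continuous.
exists t0 => t; have [tB|/existsNP[j tj]] := pselect (B t).
  by apply: t0min; rewrite inE.
apply: (@le_trans _ _ (F 0)); first by apply: t0min; rewrite inE.
rewrite /F dot0l mulr0 addr0; apply: (@le_trans _ _ (e * t 0 j ^+ 2)).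
  apply: (le_trans MM); rewrite ler_pM2l //.
  rewrite -(real_normK (num_real M)) -(real_normK (num_real (t 0 j))).
  rewrite lerXn2r ?nnegrE // (ger0_norm (le_trans ler01 M1)) leNgt.
  apply/negP => tM; apply: tj; rewrite in_itv /= -ler_norml ltW //.
rewrite -[leLHS]add0r lerD ?ler_pM2l //.
  by apply: sumr_ge0 => i _; rewrite mulr_ge0 ?expR_ge0 // ltW.
rewrite /dot (bigD1 j) //= -expr2 lerDl sumr_ge0 // => i _.
by rewrite -expr2 sqr_ge0.
Qed.

(** Compare the minimizer with [t0 + s *: w]. For [|s| <= (2 * (1 + S))^-1] every [s * g i] has
    modulus at most 1/2, so [expR_le_quad] bounds the increment by a quadratic polynomial in [s]
    whose linear coefficient must vanish. *)
Lemma regularized_critical (e : R) (t0 : 'rV[R]_n) : 0 < e ->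
  (forall t, h t0 + e * dot t0 t0 <= h t + e * dot t t) -> forall w,
  \sum_i c i * expR (dot (u i) t0) * dot (u i) w + 2 * e * dot t0 w = 0.
Proof.
move=> e0 t0min w; pose nu i := c i * expR (dot (u i) t0).
have nu0 i : 0 < nu i by rewrite mulr_gt0 ?expR_gt0.
pose g i := dot (u i) w; pose S := \sum_i `|g i|.
have gS i : `|g i| <= S by rewrite /S (bigD1 i) //= lerDl sumr_ge0.
have S0 : 0 < 2 * (1 + S).
  have : 0 <= S by rewrite sumr_ge0.
  lra.
apply: (@quad_ge0_lin (2 * (1 + S))^-1 _ (\sum_i nu i * (2 * g i ^+ 2) + e * dot w w)).
- by rewrite invr_gt0.
- apply: addr_ge0; last by rewrite mulr_ge0 ?dot_ge0 // ltW.
  apply: sumr_ge0 => i _; apply: mulr_ge0; first exact: ltW.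
  by apply: mulr_ge0 => //; exact: sqr_ge0.
move=> s ss; have := t0min (t0 + s *: w).
have -> : dot (t0 + s *: w) (t0 + s *: w) =
    dot t0 t0 + s * (2 * dot t0 w) + s ^+ 2 * dot w w.
  rewrite dotDl dotZl !(dotC _ (t0 + _)) !dotDl !dotZl (dotC w t0); ring.
have : h (t0 + s *: w) <= \sum_i nu i * (1 + s * g i + 2 * (s * g i) ^+ 2).
  apply: ler_sum => i _; rewrite dotC dotDl dotZl !(dotC _ (u i)) expRD mulrA.
  rewrite (ler_pM2l (nu0 i)); apply: expR_le_quad; rewrite normrM.
  apply: (@le_trans _ _ ((2 * (1 + S))^-1 * (1 + S))).
    by rewrite ler_pM // (le_trans (gS i)) // lerDr.
  by rewrite invfM -mulrA mulVf ?mulr1 // lt0r_neq0 //; lra.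
have -> : \sum_i nu i * (1 + s * g i + 2 * (s * g i) ^+ 2) =
   h t0 + s * \sum_i nu i * g i + s ^+ 2 * \sum_i nu i * (2 * g i ^+ 2).
  rewrite !mulr_sumr -!big_split /=; apply: eq_bigr => i _; rewrite -/(nu i); ring.
rewrite -/g.
set A1 := \sum_i nu i * g i; set A2 := \sum_i nu i * _; lra.
Qed.

Hypothesis h_ge : forall t, d <= h t.

(* The third property is [sum nu_i ln (nu_i / c_i) <= 0] in Legendre dual form:
   as it is linear in [nu], it passes to limits without continuity of x ln x. *)
Lemma near_balanced (e : R) : 0 < e -> exists nu : 'rV[R]_k,
  [/\ forall i, 0 <= nu 0 i <= h 0, d <= \sum_i nu 0 i,
      forall s : 'I_k -> R,
        \sum_i (nu 0 i * (s i + 1)) <= \sum_i c i * expR (s i)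
    & dot (\sum_i nu 0 i *: u i) (\sum_i nu 0 i *: u i) <= e].
Proof.
move=> e0.
have h0 : 0 <= h 0 by apply: sumr_ge0 => i _; rewrite mulr_ge0 ?expR_ge0 // ltW.
(* By stationarity the squared imbalance is [4 * e' ^+ 2 * dot t t]. As [e' * dot t t <= h 0], it is
   at most [4 * e' * h 0 <= e]. *)
pose e' := e / (4 * (h 0 + 1)).
have h1 : 0 < 4 * (h 0 + 1) by lra.
have e'0 : 0 < e' by rewrite divr_gt0.
have [t tmin] := regularized_min e'0.
have crit := regularized_critical e'0 tmin.
pose nu := \row_i (c i * expR (dot (u i) t)).
have nu0 i : 0 <= nu 0 i by rewrite mxE mulr_ge0 ?expR_ge0 // ltW.
have hE : \sum_i nu 0 i = h t by apply: eq_bigr => i _; rewrite mxE.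
have ht : h t + e' * dot t t <= h 0 by have := tmin 0; rewrite dot0l mulr0 addr0.
have tt := dot_ge0 t.
have ett : 0 <= e' * dot t t by rewrite mulr_ge0 // ltW.
have nuE w : \sum_i nu 0 i * dot (u i) w =
    \sum_i c i * expR (dot (u i) t) * dot (u i) w.
  by apply: eq_bigr => i _; rewrite mxE.
exists nu; split.
- move=> i; rewrite nu0 /=; apply: le_trans (_ : h t <= _); last lra.
  by rewrite -hE (bigD1 i) //= lerDl sumr_ge0.
- by rewrite hE.
- move=> s; have crit_t : \sum_i nu 0 i * dot (u i) t <= 0.
    have -> : \sum_i nu 0 i * dot (u i) t = - (2 * e' * dot t t).
      by apply/eqP; rewrite -addr_eq0 nuE crit.
    by rewrite oppr_le0 -mulrA mulr_ge0.
  (* This is [expR r >= 1 + r] at [r = s i - dot (u i) t], multiplied by [nu 0 i]; the sum of the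
     [nu 0 i * dot (u i) t] is nonpositive by stationarity. *)
  apply: (@le_trans _ _ (\sum_i (nu 0 i * dot (u i) t + c i * expR (s i)))).
    apply: ler_sum => i _; rewrite mxE; set x := dot _ _.
    have -> : s i = x + (s i - x) by rewrite addrC subrK.
    move: (s i - x) => r; rewrite expRD.
    have := expR_ge1Dx r; have : 0 < c i * expR x by rewrite mulr_gt0 ?expR_gt0.
    rewrite mulrA; nra.
  by rewrite big_split /= gerDr.
- set z := \sum_i _; have zE w : dot z w = - (2 * e' * dot t w).
    apply/eqP; rewrite -addr_eq0 dot_suml; apply/eqP.
    by under eq_bigr do rewrite dotZl; rewrite nuE crit.
  rewrite zE dotC zE mulrN opprK.
  have hht : e' * dot t t <= h 0.
    by apply: le_trans ht; rewrite lerDr -hE sumr_ge0.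
  apply: (@le_trans _ _ (4 * e' * h 0)); first by nra.
  by rewrite -[leRHS](divfK (lt0r_neq0 h1)) -/e'; nra.
Qed.

(** Compactness replaces the limit of [near_balanced]: the constraints other than balance define a
    compact [K], on which the squared imbalance attains its infimum 0. Testing the Legendre form
    with [s i = ln (nu i / c i)] gives back the entropy. *)
Lemma balanced_of_lower_bound : exists nu : 'I_k -> R,
  [/\ forall i, 0 <= nu i, d <= \sum_i nu i, \sum_i nu i *: u i = 0
    & \sum_i nu i * ln (nu i / c i) <= 0].
Proof.
pose one : 'rV[R]_k := const_mx 1.
have dot1 (v : 'rV[R]_k) : dot v one = \sum_i v 0 i.
  by apply: eq_bigr => i _; rewrite mxE mulr1.
pose tilt (s : 'I_k -> R) : 'rV[R]_k := \row_i (s i + 1).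
have dotE (v : 'rV[R]_k) s : dot v (tilt s) = \sum_i v 0 i * (s i + 1).
  by apply: eq_bigr => i _; rewrite mxE.
pose K := [set v : 'rV[R]_k | forall i, v 0 i \in `[0, h 0]]
  `&` ([set v | d <= dot v one]
  `&` \bigcap_(s in [set: 'I_k -> R]) [set v | dot v (tilt s) <= \sum_i c i * expR (s i)]).
have Kcompact : compact K.
  apply: compact_closedI; first exact: box_compact.
  apply: closedI.
    apply: (@preimage_closed _ _ (fun v => dot v one) [set x | d <= x]).
      by move=> v _; exact: dot_continuous.
    exact: closed_ge.
  apply: closed_bigI => s _.
  apply: (@preimage_closed _ _ (fun v => dot v (tilt s)) [set x | x <= \sum_i c i * expR (s i)]).
    by move=> v _; exact: dot_continuous.
  exact: closed_le.
have approx e : 0 < e -> exists2 v, K v &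
    dot (\sum_i v 0 i *: u i) (\sum_i v 0 i *: u i) <= e.
  move=> /near_balanced[v [v1 v2 v3 v4]]; exists v => //; split.
    by move=> i; rewrite in_itv; exact: v1.
  by split=> [|s _] /=; rewrite ?dot1 // dotE.
pose G (v : 'rV[R]_k) := dot (\sum_i v 0 i *: u i) (\sum_i v 0 i *: u i).
have Gcont : continuous G.
  move=> v; have FF := nbhs_filter v.
  pose S (v : 'rV[R]_k) := \sum_i v 0 i *: u i.
  rewrite -[G]/((fun t : 'rV[R]_n => dot t t) \o S); apply: continuous_comp.
    apply: (@cvg_big _ _ _ _ _ _ _ (nbhs v)) => [|j _]; first exact: add_continuous.
    by apply: cvgZl; exact: coord_continuous.
  exact: dot_self_continuous.
have [|v /set_mem[v0 [vd vs]] vmin] := compact_EVT_min _ Kcompact (continuous_subspaceT Gcont).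
  by have [v Kv _] := approx 1 ltr01; exists v.
have nu0 i : 0 <= v 0 i by have := v0 i; rewrite in_itv /= => /andP[].
exists (fun i => v 0 i); split=> //.
- by rewrite -dot1.
- apply/eqP; rewrite -dot_eq0 eq_le dot_ge0 andbT.
  apply/ler_addgt0Pr => e /approx[w Kw we]; rewrite add0r.
  by apply: le_trans we; apply: vmin; rewrite inE.
apply/ler_addgt0Pr => e e0; rewrite add0r.
pose C := \sum_i c i.
have C0 : 0 <= C by apply: sumr_ge0 => i _; exact: ltW.
have C1 : 0 < C + 1 by lra.
(* Where the weight vanishes, the optimal [s i] would be minus infinity; the value
   [ln (e / (C + 1))] costs at most [e] in total. *)
pose s i := if v 0 i == 0 then ln (e / (C + 1)) else ln (v 0 i / c i).
have := vs s I; rewrite /= dotE => H.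
have : \sum_i v 0 i * (s i + 1) <= \sum_i (v 0 i + c i * (e / (C + 1))).
  apply: (le_trans H); apply: ler_sum => i _; rewrite /s.
  have e1 : 0 < e / (C + 1) by rewrite divr_gt0.
  case: (eqVneq (v 0 i) 0) => [vi0|viN0]; first by rewrite lnK ?posrE // vi0 add0r.
  have vip : 0 < v 0 i by rewrite lt_neqAle eq_sym viN0 nu0.
  rewrite lnK; last by rewrite posrE divr_gt0.
  by rewrite mulrC divfK ?lt0r_neq0 // lerDl mulr_ge0 // ltW.
rewrite big_split /= -mulr_suml -/C.
have -> : \sum_i v 0 i * (s i + 1) = \sum_i v 0 i * ln (v 0 i / c i) + \sum_i v 0 i.
  rewrite -big_split; apply: eq_bigr => i _; rewrite /s /=.
  by case: (eqVneq (v 0 i) 0) => [->|_]; [rewrite !mul0r addr0|rewrite mulrDr mulr1].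
have : C * (e / (C + 1)) <= e.
  by rewrite mulrCA ger_pMr // ler_pdivrMr // mul1r; lra.
lra.
Qed.

End family.
End entropy.

(** * Circuits and circuit matrices *)

Section circuits.
Variables (R : realType) (n : nat).
Local Notation V := 'rV[R]_n.
Local Notation circuit := ({fset V} * V)%type.
Implicit Types (A C : {fset V}) (q : circuit).

Lemma reduced_circuitsP A C q : q \in reduced_circuits A C <->
  [/\ (q.1 `<=` A)%fset /\ q.2 \in C, affinely_independent q.1,
      exists mu, barycenter q.1 mu q.2, q.2 \notin q.1
    & forall a, a \in A -> convex_hull [set` q.1] a -> a \in q.1 \/ a = q.2].
Proof.
rewrite !inE fpowersetE; split.
  move=> /andP[/andP[qA qC] /asboolP[qI [qr [_ /negP qN]] qe]]; split=> //.
    by apply/relint_simplexP.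
  move=> a aA aq; apply: contrapT => /not_orP[a1 a2].
  suff : (set0 : set V) a by [].
  by rewrite -qe; split=> // -[].
move=> [[qA qC] qI qb qN qe]; rewrite qA qC /=; apply/asboolP; split=> //.
  by split; [apply/relint_simplexP | split=> //; exact/negP].
by apply/seteqP; split=> // a [[aA aq]] /not_orP[a1 a2]; case: (qe a aA aq).
Qed.

Lemma lambdaP q : (exists mu, barycenter q.1 mu q.2) ->
  barycenter q.1 (lambda q) q.2.
Proof.
move=> [mu [mu0 mu1 mug]].
pose l : {ffun q.1 -> R} := [ffun a => mu (val a)].
have lP : [set l : {ffun q.1 -> R} |
    [/\ forall a, 0 < l a, \sum_a l a *: val a = q.2 & \sum_a l a = 1]] l.
  split.
  - by move=> a; rewrite ffunE mu0 // (valP a).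
  - rewrite -[RHS]mug /moment big_seq_fsetE /=.
    by apply: eq_bigr => a _; rewrite ffunE.
  - rewrite -[RHS]mu1 /mass big_seq_fsetE /=.
    by apply: eq_bigr => a _; rewrite ffunE.
have [b0 b1 b2] := xgetPex 0 (ex_intro _ l lP).
rewrite -/(barycentric q) in b0 b1 b2.
have lE (a : q.1) : lambda q (val a) = barycentric q a by rewrite /lambda /fcoord valK.
split.
- by move=> a aq; rewrite (lE [` aq]%fset).
- by rewrite /mass big_seq_fsetE /= -[RHS]b2; apply: eq_bigr => a _; rewrite lE.
- by rewrite /moment big_seq_fsetE /= -[RHS]b1; apply: eq_bigr => a _; rewrite lE.
Qed.

Lemma ratr_gt0_fraction (x : R) : 0 < x -> (exists r : rat, x = ratr r) ->
  exists k d : nat, (0 < d)%N /\ x = k%:R / d%:R.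
Proof.
move=> + [r xr]; rewrite xr ltr0q => r0.
exists `|numq r|%N, `|denq r|%N; split; first by rewrite absz_gt0 denq_neq0.
by rewrite !natr_absz gtr0_norm ?numq_gt0 // gtr0_norm ?denq_gt0 //.
Qed.

(** The last clause says that [denominator] is a genuine common denominator and not the default
    value 0 of [xget]; rationality of the exponents guarantees it. *)
Definition valid_circuit q :=
  [/\ affinely_independent q.1, barycenter q.1 (lambda q) q.2, q.2 \notin q.1
    & common_denominator q (denominator q)].

(** By [affine_coordinate] the barycentric coordinates of a rational point are rational; the product
    of their denominators serves. *)
Lemma common_denominator_ex q (S : set V) : S `<=` rational_points R n ->
  [set` q.1] `<=` S -> S q.2 -> affinely_independent q.1 ->
  barycenter q.1 (lambda q) q.2 -> exists d, common_denominator q d.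
Proof.
move=> Srat qS q2S qI [l0 l1 lb].
have frac (a : q.1) : exists kd : nat * nat, (0 < kd.2)%N /\
    lambda q (val a) = kd.1%:R / kd.2%:R.
  have [L [b [LE]]] := affine_coordinate qI (valP a).
  move=> /(_ (subset_trans qS Srat))[Lrat [br bE]].
  have [|k [d kd]] := ratr_gt0_fraction (l0 _ (valP a)); last by exists (k, d).
  rewrite LE // lb bE.
  have [f fE] := choice (fun j => Srat _ q2S j).
  have [f' f'E] := choice Lrat.
  exists (\sum_j f j * f' j + br); rewrite rmorphD /= rmorph_sum; congr (_ + _).
  by apply: eq_bigr => j _; rewrite rmorphM /= -fE -f'E.
have [f fP] := choice frac.
exists (\prod_a (f a).2)%N; split.
  by rewrite prodn_gt0 // => a; case: (fP a).
move=> a aq; have [d0 e] := fP [` aq]%fset.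
exists ((f [` aq]%fset).1 * \prod_(b | b != [` aq]%fset) (f b).2)%N.
rewrite [X in _ / X%:R](bigD1 [` aq]%fset) //= !natrM -mulf_div divff ?mulr1 //.
rewrite pnatr_eq0 -lt0n prodn_cond_gt0 // => b _; by case: (fP b).
Qed.

Lemma denominatorP q : (exists d, common_denominator q d) ->
  common_denominator q (denominator q).
Proof.
move=> dex.
have dex' : exists d, `[< common_denominator q d >].
  by have [d dP] := dex; exists d; apply/asboolP.
have [d /asboolP dP dmin] := find_ex_minn dex'.
have H : [set d | common_denominator q d
    /\ forall d', common_denominator q d' -> (d <= d')%N] d.
  by split=> // d' d'P; apply: dmin; apply/asboolP.
by case: (xgetPex 0%N (ex_intro _ d H)).
Qed.

Lemma reduced_circuit_valid A C q (S : set V) : S `<=` rational_points R n ->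
  [set` A] `<=` S -> [set` C] `<=` S ->
  q \in reduced_circuits A C -> valid_circuit q.
Proof.
move=> Srat AS CS /reduced_circuitsP[[qA qC] qI qb qN _].
have lb := lambdaP qb; split=> //; apply: denominatorP.
apply: (common_denominator_ex Srat _ _ qI lb); last exact: CS.
by move=> a aq; apply: AS; exact: (fsubsetP qA).
Qed.

Section valid.
Variable q : circuit.
Hypothesis q_valid : valid_circuit q.

Lemma lambda_gt0 : {in q.1, forall a, 0 < lambda q a}.
Proof. by case: q_valid => _ []. Qed.

Lemma sum_lambda : \sum_(a <- q.1) lambda q a = 1.
Proof. by case: q_valid => _ []. Qed.

Lemma denominator_gt0 : (0 < denominator q)%N.
Proof. by case: q_valid => _ _ _ []. Qed.

Lemma numeratorE : {in q.1, forall a,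
  (numerator q a)%:R = (denominator q)%:R * lambda q a}.
Proof.
case: q_valid => _ _ _ [d0 H] a aq; have [k kE] := H a aq.
by rewrite /numerator kE mulrC divfK ?natrK // pnatr_eq0 -lt0n.
Qed.

Lemma numerator_gt0 : {in q.1, forall a, (0 < numerator q a)%N}.
Proof.
move=> a aq; rewrite -(ltr0n R) numeratorE // mulr_gt0 ?lambda_gt0 //.
by rewrite ltr0n denominator_gt0.
Qed.

Lemma sum_numerator : (\sum_(a <- q.1) numerator q a)%N = denominator q.
Proof.
apply/eqP; rewrite -(eqr_nat R) natr_sum.
by rewrite (eq_big_seq _ numeratorE) -mulr_sumr sum_lambda mulr1.
Qed.

(** With denominator 1 some coordinate would equal 1 and the inner point would be a vertex. Hence
    the tree has depth at least 1. *)
Lemma denominator_gt1 : (1 < denominator q)%N.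
Proof.
rewrite ltn_neqAle denominator_gt0 andbT eq_sym; apply/eqP => d1.
have [_ [l0 l1 lb] qN _] := q_valid.
have [a aq] : exists a, a \in q.1.
  apply: contrapT => noa; move: sum_lambda; rewrite big_seq big1.
    by move/eqP; rewrite eq_sym oner_eq0.
  by move=> a aq; case: noa; exists a.
have la : lambda q a = 1.
  apply/eqP; rewrite eq_le; apply/andP; split.
    rewrite -sum_lambda (big_fsetD1 a) //= lerDl big_seq sumr_ge0 // => b.
    by rewrite !inE => /andP[_ /l0/ltW].
  have := numeratorE aq; rewrite d1 mul1r => <-.
  by rewrite ler1n numerator_gt0.
have lE b : b \in (q.1 `\ a)%fset -> lambda q b = 0.
  have := sum_lambda; rewrite (big_fsetD1 a) //= la => /eqP.
  rewrite -subr_eq0 addrAC subrr add0r big_seq psumr_eq0.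
    move=> /allP H bq; have /implyP/(_ bq)/eqP // := H b bq.
  by move=> c; rewrite !inE => /andP[_ /l0/ltW].
suff qa : q.2 = a by rewrite qa aq in qN.
rewrite -lb /moment (big_fsetD1 a) //= la scale1r big_seq big1 ?addr0 //.
by move=> b /lE ->; rewrite scale0r.
Qed.

Lemma denominator_le : (denominator q <= 2 ^ depth q)%N.
Proof. exact: up_logP. Qed.

Lemma depth_gt0 : (0 < depth q)%N.
Proof. by rewrite /depth up_log_gt0 denominator_gt1. Qed.

Lemma size_leaves (s : seq (option V)) : perm_eq s (leaves q) ->
  size s = (2 ^ depth q)%N.
Proof.
move=> s_leaves.
rewrite (perm_size s_leaves) size_cat size_flatten size_nseq /shape -map_comp.
rewrite sumnE big_map /=; under eq_bigr do rewrite size_nseq.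
by rewrite sum_numerator subnKC // denominator_le.
Qed.

Lemma prod_leaves (s : seq (option V)) (v : V -> R) z : perm_eq s (leaves q) ->
  \prod_(0 <= l < 2 ^ depth q) leaf s v z l =
  (\prod_(a <- q.1) v a ^+ numerator q a) * z ^+ (2 ^ depth q - denominator q).
Proof.
move=> s_leaves.
have prod_nseq k (x : option V) (F : option V -> R) :
    \prod_(y <- nseq k x) F y = F x ^+ k.
  by rewrite big_nseq; elim: k => //= k ->; rewrite exprS.
have size_s := size_leaves s_leaves.
rewrite -size_s /leaf -(big_nth None xpredT (fun x => if x is Some a then v a else z)).
rewrite (perm_big _ s_leaves) big_cat big_flatten big_map /=.
congr (_ * _); last by rewrite prod_nseq size_s.
by apply: eq_bigr => a _; rewrite prod_nseq.
Qed.

Lemma leaf_ge0 (s : seq (option V)) (v : V -> R) z : perm_eq s (leaves q) ->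
  {in q.1, forall a, 0 <= v a} -> 0 <= z -> forall l, 0 <= leaf s v z l.
Proof.
move=> s_leaves v0 z0 l; rewrite /leaf.
have [ls|ls] := ltnP l (size s); last by rewrite nth_default.
have := mem_nth None ls; rewrite (perm_mem s_leaves) mem_cat => /orP[].
  by move=> /flatten_mapP[a aq]; rewrite mem_nseq => /andP[_ /eqP ->]; exact: v0.
by rewrite mem_nseq => /andP[_ /eqP ->].
Qed.

(** All numerators are positive, so each vertex occurs among the leaves. *)
Lemma leaf_ge0_vertex (s : seq (option V)) (v : V -> R) z : perm_eq s (leaves q) ->
  (forall l, (l < 2 ^ depth q)%N -> 0 <= leaf s v z l) ->
  {in q.1, forall a, 0 <= v a}.
Proof.
move=> s_leaves H a aq.
have sa : Some a \in s.
  rewrite (perm_mem s_leaves) mem_cat; apply/orP; left; apply/flatten_mapP.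
  by exists a => //; rewrite mem_nseq numerator_gt0 //=.
have ls : (index (Some a) s < 2 ^ depth q)%N by rewrite -(size_leaves s_leaves) index_mem.
by have := H _ ls; rewrite /leaf nth_index.
Qed.

(** Passes from the indices of the matrices, which start at 1, to those of [tree_ok], which start at
    0, and adds the leaves as level 0. *)
Definition tree_of (s : seq (option V)) (v : V -> R) z (y : nat -> nat -> R) k i :=
  if k is k'.+1 then y k i.+1 else leaf s v z i.

Lemma tree_blocks_psd (s : seq (option V)) (v : V -> R) z y :
  (forall M, M \in tree_blocks q s v z y -> psd (tagged M)) <->
  tree_ok (depth q) (tree_of s v z y).
Proof.
have m0 := depth_gt0; have dbl i : (2 * i.+1 = (2 * i).+2)%N by rewrite mulnS.
split=> [H k i km im|H M].
  apply/psd_block2; apply: H; rewrite mem_cat; case: k km im => [|k] km im.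
    apply/orP; right; apply/mapP; exists i.+1; last first.
      by rewrite dbl.
    by rewrite mem_iota /= add1n ltnS -subn1.
  apply/orP; left; apply/allpairsPdep; exists k.+2, i.+1; split.
  - by rewrite mem_iota /=; lia.
  - by rewrite mem_iota /= add1n ltnS.
  - by rewrite dbl.
rewrite mem_cat => /orP[/allpairsPdep[k [i [kin iin ->]]]|/mapP[i iin ->]].
  move: kin iin; rewrite !mem_iota => /andP[k2 km] /andP[i1 im].
  case: k k2 km im => [|[|k]] // _ km im; case: i i1 im => // i _ im.
  by rewrite dbl; apply/psd_block2; apply: (H k.+1 i); lia.
move: iin; rewrite mem_iota => /andP[i1 im].
case: i i1 im => // i _ im; rewrite dbl.
by apply/psd_block2; apply: (H 0%N i) => //; rewrite subn1; lia.
Qed.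

End valid.
End circuits.

(** * Weighted geometric means and elimination of the auxiliary variables *)

Section circuit_matrices.
Variables (R : realType) (n : nat).
Local Notation V := 'rV[R]_n.
Local Notation circuit := ({fset V} * V)%type.

Definition geomean (q : circuit) (v : V -> R) : R :=
  \prod_(a <- q.1) v a `^ lambda q a.

Variable q : circuit.
Hypothesis q_valid : valid_circuit q.
Implicit Types (u v w : V -> R).

Lemma geomean_ge0 v : 0 <= geomean q v.
Proof. by rewrite /geomean prodr_ge0 // => a _; exact: powR_ge0. Qed.

Lemma LambdaE : Lambda q = geomean q (lambda q).
Proof. by []. Qed.

Lemma geomean_gt0 v : {in q.1, forall a, 0 < v a} -> 0 < geomean q v.
Proof.
by move=> v0; rewrite /geomean big_seq prodr_gt0 // => a /v0; exact: powR_gt0.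
Qed.

Lemma Lambda_gt0 : 0 < Lambda q.
Proof. by rewrite LambdaE; apply: geomean_gt0 => a; exact: lambda_gt0. Qed.

Lemma eq_geomean v w : {in q.1, v =1 w} -> geomean q v = geomean q w.
Proof. by move=> vw; apply: eq_big_seq => a /vw ->. Qed.

Lemma geomeanM v w : {in q.1, forall a, 0 <= v a} -> {in q.1, forall a, 0 <= w a} ->
  geomean q (fun a => v a * w a) = geomean q v * geomean q w.
Proof.
move=> v0 w0; rewrite /geomean -big_split /=; apply: eq_big_seq => a aq.
by rewrite powRM ?v0 ?w0.
Qed.

Lemma geomean_const t : 0 <= t -> geomean q (fun=> t) = t.
Proof.
move=> t0; rewrite /geomean.
have [->|tN0] := eqVneq t 0.
  have [b bq] : exists b, b \in q.1.
    apply: contrapT => nob; move: (sum_lambda q_valid); rewrite big_seq big1.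
      by move/eqP; rewrite eq_sym oner_eq0.
    by move=> a aq; case: nob; exists a.
  by rewrite (big_fsetD1 b) //= powR0 ?mul0r // gt_eqF // lambda_gt0.
have e s : \prod_(a <- s) t `^ lambda q a = t `^ \sum_(a <- s) lambda q a.
  elim: s => [|a s IH]; first by rewrite !big_nil powRr0.
  by rewrite !big_cons IH powRD // tN0 implybT.
by rewrite e sum_lambda // powRr1.
Qed.

Lemma geomeanZ t v : 0 <= t -> {in q.1, forall a, 0 <= v a} ->
  geomean q (fun a => t * v a) = t * geomean q v.
Proof. by move=> t0 v0; rewrite geomeanM // geomean_const. Qed.

Lemma geomean_eq0 v a : a \in q.1 -> v a = 0 -> geomean q v = 0.
Proof.
move=> aq va; rewrite /geomean (big_fsetD1 a) //= va powR0 ?mul0r //.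
by rewrite gt_eqF // lambda_gt0.
Qed.

Lemma geomean_expR v : {in q.1, forall a, 0 < v a} ->
  geomean q v = expR (\sum_(a <- q.1) lambda q a * ln (v a)).
Proof.
move=> v0; rewrite expR_sum; apply: eq_big_seq => a /v0 va.
by rewrite /powR gt_eqF.
Qed.

(** Weighted AM-GM from the tangent of the exponential: if [L] is the weighted mean of the
    [ln (v a)], each [v a] is at least [expR L * (1 + (ln (v a) - L))], and these bounds have
    weighted mean [expR L]. A vanishing [v a] makes the left side 0. *)
Lemma geomean_le v : {in q.1, forall a, 0 <= v a} ->
  geomean q v <= \sum_(a <- q.1) lambda q a * v a.
Proof.
move=> v0; have [[a aq /eqP va]|noz] := pselect (exists2 a, a \in q.1 & v a == 0).
  rewrite (geomean_eq0 aq va) big_seq sumr_ge0 // => b bq.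
  by rewrite mulr_ge0 ?v0 // ltW // lambda_gt0.
have {}v0 : {in q.1, forall a, 0 < v a}.
  move=> a aq; rewrite lt_neqAle v0 // andbT eq_sym; apply/negP => va.
  by apply: noz; exists a.
rewrite geomean_expR //; set L := \sum_(a <- _) _.
have -> : expR L = \sum_(a <- q.1) lambda q a * (expR L * (1 + (ln (v a) - L))).
  have H a : lambda q a * (expR L * (1 + (ln (v a) - L))) =
     expR L * (lambda q a * ln (v a)) + (expR L * (1 - L)) * lambda q a by ring.
  under eq_bigr do rewrite H.
  rewrite big_split /= -!mulr_sumr -/L (sum_lambda q_valid); ring.
rewrite !big_seq; apply: ler_sum => a aq; rewrite ler_pM2l ?lambda_gt0 //.
apply: (@le_trans _ _ (expR L * expR (ln (v a) - L))).
  by rewrite ler_pM2l ?expR_gt0 // expR_ge1Dx.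
by rewrite -expRD addrC subrK lnK // posrE v0.
Qed.

(** AM-GM for the [v a / lambda q a], since [Lambda q] is the geometric mean of the weights
    themselves. *)
Lemma geomean_le_Lambda v : {in q.1, forall a, 0 <= v a} ->
  geomean q v <= Lambda q * \sum_(a <- q.1) v a.
Proof.
move=> v0.
have l0 : {in q.1, forall a, 0 <= lambda q a} by move=> a aq; rewrite ltW ?lambda_gt0.
have vl0 : {in q.1, forall a, 0 <= v a / lambda q a}.
  by move=> a aq; rewrite divr_ge0 ?v0 ?l0.
rewrite (@eq_geomean v (fun a => lambda q a * (v a / lambda q a))); last first.
  by move=> a aq; rewrite /= mulrC divfK // gt_eqF // lambda_gt0.
rewrite geomeanM // ler_pM2l ?Lambda_gt0 //; apply: le_trans (geomean_le vl0) _.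
rewrite !big_seq; apply: ler_sum => a aq.
by rewrite mulrC divfK // gt_eqF // lambda_gt0.
Qed.

(** AM-GM for the fractions [v / (v + w)] and [w / (v + w)], whose weighted means add up to 1. This
    superadditivity makes the circuit cones convex. *)
Lemma geomeanD v w : {in q.1, forall a, 0 <= v a} -> {in q.1, forall a, 0 <= w a} ->
  geomean q v + geomean q w <= geomean q (fun a => v a + w a).
Proof.
move=> v0 w0; have vw0 : {in q.1, forall a, 0 <= v a + w a}.
  by move=> a aq; rewrite addr_ge0 ?v0 ?w0.
have [[a aq]|noz] := pselect (exists2 a, a \in q.1 & v a + w a == 0).
  rewrite paddr_eq0 ?v0 ?w0 // => /andP[/eqP va /eqP wa].
  by rewrite (geomean_eq0 aq va) (geomean_eq0 aq wa) addr0 geomean_ge0.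
have nz a : a \in q.1 -> v a + w a != 0.
  by move=> aq; apply/negP => vwa; apply: noz; exists a.
have frac u : {in q.1, forall a, 0 <= u a} ->
   geomean q u <= geomean q (fun a => v a + w a)
       * \sum_(a <- q.1) lambda q a * (u a / (v a + w a)).
  move=> u0; rewrite (@eq_geomean u (fun a => (v a + w a) * (u a / (v a + w a)))).
    have r0 : {in q.1, forall a, 0 <= u a / (v a + w a)}.
      by move=> a aq; rewrite divr_ge0 ?u0 ?vw0.
    by rewrite geomeanM // ler_wpM2l ?geomean_ge0 // geomean_le.
  by move=> a aq /=; rewrite mulrC divfK // nz.
apply: le_trans (lerD (frac v v0) (frac w w0)) _.
rewrite -mulrDr -big_split /=.
rewrite (_ : \sum_(a <- _) _ = 1) ?mulr1 // -[RHS](sum_lambda q_valid).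
by apply: eq_big_seq => a aq; rewrite -mulrDr -mulrDl divff ?mulr1 // nz.
Qed.

Lemma geomean_exp v : {in q.1, forall a, 0 <= v a} ->
  geomean q v ^+ denominator q = \prod_(a <- q.1) v a ^+ numerator q a.
Proof.
move=> v0; rewrite /geomean -prodrXl; apply: eq_big_seq => a aq.
rewrite -[_ ^+ denominator q]powR_mulrn ?powR_ge0 // -powRrM mulrC.
by rewrite -numeratorE // powR_mulrn // v0.
Qed.

(** The power of [x] on the right comes from the padding leaves; once it is cancelled, what remains
    is [x ^+ denominator q <= geomean q v ^+ denominator q]. *)
Lemma root_le v x t : {in q.1, forall a, 0 <= v a} -> 0 <= x -> x <= t ->
  t ^+ (2 ^ depth q) <=
    (\prod_(a <- q.1) v a ^+ numerator q a) * x ^+ (2 ^ depth q - denominator q) ->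
  x <= geomean q v.
Proof.
move=> v0 x0 xt H; have [->|xN0] := eqVneq x 0; first exact: geomean_ge0.
have xp : 0 < x by rewrite lt_neqAle eq_sym xN0.
have p0 := denominator_gt0 q_valid.
rewrite -(ler_pXn2r p0) ?nnegrE ?geomean_ge0 // geomean_exp //.
rewrite -(ler_pM2r (exprn_gt0 (2 ^ depth q - denominator q) xp)).
apply: le_trans H; rewrite -exprD subnKC ?denominator_le //.
by rewrite lerXn2r // nnegrE (le_trans x0).
Qed.

Lemma root_ge v x t : {in q.1, forall a, 0 <= v a} -> 0 <= x ->
  x <= geomean q v -> 0 <= t ->
  t ^+ (2 ^ depth q) =
    (\prod_(a <- q.1) v a ^+ numerator q a) * x ^+ (2 ^ depth q - denominator q) ->
  x <= t.
Proof.
move=> v0 x0 xG t0 E.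
have m0 : (0 < 2 ^ depth q)%N by rewrite expn_gt0.
rewrite -(ler_pXn2r m0) ?nnegrE // E -geomean_exp //.
rewrite -{1}(subnKC (denominator_le q)) exprD ler_wpM2r ?exprn_ge0 //.
by rewrite lerXn2r ?nnegrE ?geomean_ge0.
Qed.

Variable s : seq (option V).
Hypothesis s_leaves : perm_eq s (leaves q).

Lemma tree_ok_vertex_ge0 v z y : tree_ok (depth q) (tree_of s v z y) ->
  {in q.1, forall a, 0 <= v a}.
Proof.
move=> yP; apply: (leaf_ge0_vertex q_valid s_leaves (z := z)) => l lm.
have m0 := depth_gt0 q_valid.
have e : (2 ^ depth q = 2 * 2 ^ (depth q - 1))%N.
  by rewrite subn1 -expnS prednK.
have [|y0 y1 _] := yP 0%N l./2 m0; first by lia.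
have := odd_double_half l; rewrite -mul2n; case: (odd l) => <- //.
Qed.

Lemma tree_ok_root_le v z y : tree_ok (depth q) (tree_of s v z y) ->
  y (depth q) 1%N ^+ (2 ^ depth q) <=
    (\prod_(a <- q.1) v a ^+ numerator q a) * z ^+ (2 ^ depth q - denominator q).
Proof.
move=> yP; have m0 := depth_gt0 q_valid.
have := @tree_le _ (depth q) _ (depth q) 0%N yP; rewrite m0 leqnn subnn.
move=> /(_ isT isT); under [X in _ <= X]eq_bigr do rewrite mul0n add0n.
by rewrite /= (prod_leaves q_valid v z s_leaves) /tree_of; case: (depth q) m0.
Qed.

Lemma tree_ok_ex v z : {in q.1, forall a, 0 <= v a} -> 0 <= z ->
  exists y, [/\ tree_ok (depth q) (tree_of s v z y), 0 <= y (depth q) 1%N &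
    y (depth q) 1%N ^+ (2 ^ depth q) =
    (\prod_(a <- q.1) v a ^+ numerator q a) * z ^+ (2 ^ depth q - denominator q)].
Proof.
move=> v0 z0; have m0 := depth_gt0 q_valid.
have [|Y [YP YL Y0 YE]] := @tree_ex _ (depth q) (leaf s v z).
  by move=> l _; exact: leaf_ge0 s_leaves v0 z0 l.
exists (fun k i => Y k i.-1); rewrite /= -(prod_leaves q_valid v z s_leaves).
split=> //; have -> // : tree_of s v z (fun k i => Y k i.-1) = Y.
by apply/funext => -[|k]; apply/funext => i //=; rewrite YL.
Qed.

Lemma tree_ok_ext m (Y Y' : nat -> nat -> R) :
  (forall k i, (k <= m)%N -> (i < 2 ^ (m - k))%N -> Y k i = Y' k i) ->
  tree_ok m Y -> tree_ok m Y'.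
Proof.
move=> YY' YP k i km im; have e : (2 ^ (m - k) = 2 * 2 ^ (m - k.+1))%N.
  by rewrite -expnS -subSn.
by rewrite -!YY' ?(ltnW km) ?e //; [exact: YP | lia | lia].
Qed.

Lemma psd_cons (M : {N : nat & 'M[R]_N}) l :
  psd (block_diag (M :: l)) <->
  psd (tagged M) /\ (forall M', M' \in l -> psd (tagged M')).
Proof.
rewrite psd_block_diag; split=> [H|[HM Hl] M'].
  by split=> [|M' M'l]; apply: H; rewrite inE ?eqxx // M'l orbT.
by rewrite inE => /orP[/eqP -> //|]; exact: Hl.
Qed.

Lemma psd_rcons (M : {N : nat & 'M[R]_N}) l :
  psd (block_diag (rcons l M)) <-> psd (block_diag l) /\ psd (tagged M).
Proof.
rewrite !psd_block_diag; split=> [H|[Hl HM] M'].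
  by split=> [M' M'l|]; apply: H; rewrite mem_rcons inE ?eqxx // M'l orbT.
by rewrite mem_rcons inE => /orP[/eqP -> //|]; exact: Hl.
Qed.

Lemma psd_block2_sym (a b : R) : psd (tagged (block2 a b a)) <-> `|b| <= a.
Proof.
rewrite psd_block2; split=> [[a0 _ ba]|ba].
  by rewrite -[a]ger0_norm // -ler_sqr ?nnegrE // !real_normK ?num_real // expr2.
have a0 : 0 <= a by exact: le_trans ba.
by split=> //; rewrite -expr2 -real_normK ?num_real // ler_sqr.
Qed.

Lemma dual_matrix_le v z y : psd (dual_matrix q s v z y) ->
  [/\ {in q.1, forall a, 0 <= v a}, 0 <= z & z <= geomean q v].
Proof.
move=> /psd_cons[/psd_block1 z0 /(tree_blocks_psd q_valid) yP].
have v0 := tree_ok_vertex_ge0 yP; split=> //.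
apply: (root_le v0 z0 (lexx z)).
by have := tree_ok_root_le yP; rewrite eqxx.
Qed.

(** The root of the tree of square roots is at least [z] by [root_ge], so it may be lowered to [z].
    The quantification over [y'] is there because the lifted variables are finite functions, which
    can reproduce [y] only on the index range. *)
Lemma dual_matrix_ex v z : {in q.1, forall a, 0 <= v a} -> 0 <= z ->
  z <= geomean q v -> exists y, forall y',
  (forall k i, (0 < k < depth q)%N -> (0 < i <= 2 ^ (depth q - k))%N ->
     y' k i = y k i) -> psd (dual_matrix q s v z y').
Proof.
move=> v0 z0 zG; have m0 := depth_gt0 q_valid.
have [y [yP yr0 yrE]] := tree_ok_ex v0 z0.
have zy := root_ge v0 z0 zG yr0 yrE.
exists y => y' yy'; apply/psd_cons; split; first exact/psd_block1.
apply/(tree_blocks_psd q_valid) => k i km im.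
have e : (2 ^ (depth q - k) = 2 * 2 ^ (depth q - k.+1))%N.
  by rewrite -expnS -subSn.
have E j : (j < 2 ^ (depth q - k))%N ->
    tree_of s v z (fun k i => if k == depth q then z else y' k i) k j =
    tree_of s v z y k j.
  case: k km im {e} => //= k km im jk; rewrite ltn_eqF // yy' ?km //=.
rewrite !E ?e; [|lia|lia].
have [t0 t1 tt] := yP k i km im; split=> //; apply: le_trans tt.
rewrite /=; case: eqVneq => [km'|kNm].
  have i0 : i = 0%N by move: im; rewrite km' subnn; case: (i).
  by rewrite i0 km' ler_sqr.
have kd : (k.+1 < depth q)%N by rewrite ltn_neqAle kNm.
by rewrite yy' // kd.
Qed.

(** When the denominator is a power of 2, no leaf carries [Lambda q * xb] and the matrix allows a
    negative [xb]; hence the premise of the last bound. *)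
Lemma primal_matrix_le v xb x : psd (primal_matrix q s v xb x) ->
  [/\ {in q.1, forall a, 0 <= v a}, - v q.2 <= xb
    & 0 <= xb -> xb * Lambda q <= geomean q v].
Proof.
move=> /psd_cons[/psd_block1 rootP /psd_block_diag/psd_cons[/psd_block1 xbP]].
move=> /(tree_blocks_psd q_valid) xP; have v0 := tree_ok_vertex_ge0 xP; split=> //.
  by rewrite -subr_ge0 opprK.
move=> xb0; rewrite mulrC; apply: (root_le v0 _ _ (tree_ok_root_le xP)).
  by rewrite mulr_ge0 // ltW // Lambda_gt0.
by rewrite -subr_ge0.
Qed.

Lemma primal_matrix_ex v xb : {in q.1, forall a, 0 <= v a} -> 0 <= xb ->
  - v q.2 <= xb -> xb * Lambda q <= geomean q v -> exists x, forall x',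
  (forall k i, (0 < k <= depth q)%N -> (0 < i <= 2 ^ (depth q - k))%N ->
     x' k i = x k i) -> psd (primal_matrix q s v xb x').
Proof.
move=> v0 x0 vx xG; have m0 := depth_gt0 q_valid.
have z0 : 0 <= Lambda q * xb by rewrite mulr_ge0 // ltW // Lambda_gt0.
have [x [xP xr0 xrE]] := tree_ok_ex v0 z0.
rewrite mulrC in xG; have zx := root_ge v0 z0 xG xr0 xrE.
exists x => x' xx'; apply/psd_cons; split.
  by apply/psd_block1; rewrite subr_ge0 xx' // ?m0 ?leqnn // subnn.
apply/psd_block_diag/psd_cons; split.
  by apply/psd_block1; rewrite -lerBlDr sub0r.
apply/(tree_blocks_psd q_valid); apply: tree_ok_ext xP => -[|k] i // km im.
by rewrite /= xx'.
Qed.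

End circuit_matrices.

(** * Circuit cones *)

Section cones.
Variables (R : realType) (U : lmodType R).
Implicit Types (S K : set U).

Definition convex_cone K : Prop :=
  [/\ K 0, forall x y, K x -> K y -> K (x + y)
    & forall t x, 0 <= t -> K x -> K (t *: x)].

Lemma convex_cone_sum K (I : Type) (r : seq I) (P : pred I) (F : I -> U) :
  convex_cone K -> (forall i, P i -> K (F i)) -> K (\sum_(i <- r | P i) F i).
Proof. by move=> [K0 KD _] KF; elim/big_ind: _. Qed.

Lemma conic_hull_cone S : convex_cone (conic_hull S).
Proof.
split.
- by exists 0%N, (fun=> 0), (fun=> 0); split=> [[]//|[]//|]; rewrite big_ord0.
- move=> _ _ [k [t [x [xS t0 ->]]]] [k' [t' [x' [x'S t'0 ->]]]].
  exists (k + k')%N, (fun i => match fintype.split i with inl j => t j | inr j => t' j end),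
    (fun i => match fintype.split i with inl j => x j | inr j => x' j end); split.
  + by move=> i; case: fintype.split.
  + by move=> i; case: fintype.split.
  + rewrite big_split_ord /=; congr (_ + _); apply: eq_bigr => i _.
      by rewrite -[lshift _ _]/(unsplit (inl i)) unsplitK.
    by rewrite -[rshift _ _]/(unsplit (inr i)) unsplitK.
- move=> r _ r0 [k [t [x [xS t0 ->]]]]; exists k, (fun i => r * t i), x; split=> //.
    by move=> i; rewrite mulr_ge0.
  by rewrite scaler_sumr; apply: eq_bigr => i _; rewrite scalerA.
Qed.

Lemma sub_conic_hull S : S `<=` conic_hull S.
Proof.
move=> x Sx; exists 1%N, (fun=> 1), (fun=> x); split=> //.
by rewrite big_ord1 scale1r.
Qed.

Lemma conic_hull_min S K : convex_cone K -> S `<=` K -> conic_hull S `<=` K.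
Proof.
move=> KP SK _ [k [t [x [xS t0 ->]]]]; apply: convex_cone_sum => // i _.
by case: KP => _ _; apply=> //; exact: SK.
Qed.

Lemma minkowski_add_cone K K' :
  convex_cone K -> convex_cone K' -> convex_cone (minkowski_add K K').
Proof.
move=> [K0 KD KZ] [K'0 K'D K'Z]; split.
- by exists 0 => //; exists 0 => //; rewrite addr0.
- move=> _ _ [x Kx [x' K'x' <-]] [y Ky [y' K'y' <-]].
  exists (x + y); first exact: KD.
  by exists (x' + y'); [exact: K'D | rewrite addrACA].
- move=> t _ t0 [x Kx [x' K'x' <-]]; exists (t *: x); first exact: KZ.
  by exists (t *: x'); [exact: K'Z | rewrite scalerDr].
Qed.

Lemma minkowski_sum_cone (I : choiceType) (r : {fset I}) (P : I -> set U) :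
  {in r, forall i, convex_cone (P i)} -> convex_cone (minkowski_sum r P).
Proof.
move=> Pc; split.
- by exists (fun=> 0); split=> [i /Pc[]//|]; rewrite big1.
- move=> _ _ [f [fP ->]] [g [gP ->]]; exists (fun i => f i + g i).
  split=> [i ir|]; last by rewrite big_split.
  by have [_ PD _] := Pc i ir; apply: PD; [exact: fP | exact: gP].
- move=> t _ t0 [f [fP ->]]; exists (fun i => t *: f i).
  split=> [i ir|]; last by rewrite scaler_sumr.
  by have [_ _ PZ] := Pc i ir; apply: PZ => //; exact: fP.
Qed.

Lemma minkowski_sum_sub (I : choiceType) (r : {fset I}) (P : I -> set U) i :
  {in r, forall j, convex_cone (P j)} -> i \in r -> P i `<=` minkowski_sum r P.
Proof.
move=> Pc ir x Px; exists (fun j => if j == i then x else 0); split.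
  by move=> j jr; case: eqVneq => [->//|_]; case: (Pc j jr).
rewrite (big_fsetD1 i) //= eqxx big_seq big1 ?addr0 // => j.
by rewrite !inE => /andP[/negPf ->].
Qed.

Lemma minkowski_sum_min (I : choiceType) (r : {fset I}) (P : I -> set U) K :
  convex_cone K -> {in r, forall i, P i `<=` K} -> minkowski_sum r P `<=` K.
Proof.
move=> Kc PK _ [f [fP ->]]; rewrite big_seq; apply: convex_cone_sum => // i ir.
by apply: (PK i ir); exact: fP.
Qed.

Lemma minkowski_add_min K1 K2 K : convex_cone K -> K1 `<=` K -> K2 `<=` K ->
  minkowski_add K1 K2 `<=` K.
Proof.
by move=> [_ KD _] K1K K2K _ [x /K1K Kx [y /K2K Ky <-]]; exact: KD.
Qed.

Lemma minkowski_add_subl K1 K2 : convex_cone K2 -> K1 `<=` minkowski_add K1 K2.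
Proof. by move=> [K20 _ _] x Kx; exists x => //; exists 0; rewrite ?addr0. Qed.

Lemma minkowski_add_subr K1 K2 : convex_cone K1 -> K2 `<=` minkowski_add K1 K2.
Proof. by move=> [K10 _ _] x Kx; exists 0 => //; exists x; rewrite ?add0r. Qed.

End cones.

(** * Projections of Minkowski sums *)

Section projections.
Variables (U W : nmodType).

Lemma fst_minkowski_add (P Q : set (U * W)%type) :
  fst @` minkowski_add P Q = minkowski_add (fst @` P) (fst @` Q).
Proof.
apply/seteqP; split=> [_ [_ [p Pp [p' Qp' <-]] <-]|_ [_ [p Pp <-] [_ [p' Qp' <-] <-]]].
  by exists p.1; [exists p | exists p'.1 => //; exists p'].
by exists (p + p') => //; exists p => //; exists p'.
Qed.

Lemma fst_minkowski_sum (I : choiceType) (r : {fset I}) (P : I -> set (U * W)%type) :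
  fst @` minkowski_sum r P = minkowski_sum r (fun i => fst @` P i).
Proof.
have fst_sum (s : seq I) (f : I -> U * W) :
    (\sum_(i <- s) f i).1 = \sum_(i <- s) (f i).1.
  by elim: s => [|i s IH]; rewrite ?big_nil // !big_cons -IH.
apply/seteqP; split=> [_ [_ [f [fP ->]] <-]|_ [f [fP ->]]].
  by exists (fun i => (f i).1); split=> [i /fP Pi|]; [exists (f i) | rewrite fst_sum].
have [g gP] : {g : I -> U * W & forall i, i \in r -> P i (g i) /\ (g i).1 = f i}.
  apply: (@choice I (U * W)%type (fun i w => i \in r -> P i w /\ w.1 = f i)) => i.
  have [/fP[w Pw wf]|_] := boolP (i \in r); first by exists w.
  by exists 0.
exists (\sum_(i <- r) g i).
  by exists g; split=> // i /gP[].
by rewrite fst_sum; apply: eq_big_seq => i /gP[].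
Qed.

Lemma eq_minkowski_sum (I : choiceType) (r : {fset I}) (P Q : I -> set U) :
  {in r, P =1 Q} -> minkowski_sum r P = minkowski_sum r Q.
Proof.
move=> PQ; apply/seteqP; split=> _ [f [fP ->]]; exists f; split=> // i ir.
  by rewrite -(PQ i ir); exact: fP.
by rewrite (PQ i ir); exact: fP.
Qed.

End projections.

(** * Coordinate vectors *)

Section coordinates.
Variables (R : realType) (K : choiceType) (S : {fset K}).
Implicit Types (u v : {ffun S -> R}) (f : K -> R).

Lemma fcoord_val v (i : S) : fcoord v (val i) = v i.
Proof. by rewrite /fcoord valK. Qed.

Lemma fcoord_out v g : g \notin S -> fcoord v g = 0.
Proof. by move=> gS; rewrite /fcoord insubF // (negPf gS). Qed.

Lemma fcoord_inj u v : (forall g, g \in S -> fcoord u g = fcoord v g) -> u = v.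
Proof.
by move=> uv; apply/ffunP => i; have := uv (val i) (valP i); rewrite !fcoord_val.
Qed.

Lemma fcoordD u v g : fcoord (u + v) g = fcoord u g + fcoord v g.
Proof.
have [gS|gS] := boolP (g \in S); last by rewrite !fcoord_out // addr0.
by rewrite -[g]/(val [` gS]%fset) !fcoord_val ffunE.
Qed.

Lemma fcoordZ t v g : fcoord (t *: v) g = t * fcoord v g.
Proof.
have [gS|gS] := boolP (g \in S); last by rewrite !fcoord_out // mulr0.
by rewrite -[g]/(val [` gS]%fset) !fcoord_val ffunE.
Qed.

Lemma fcoord0 g : fcoord (0 : {ffun S -> R}) g = 0.
Proof.
have [gS|gS] := boolP (g \in S); last by rewrite !fcoord_out.
by rewrite -[g]/(val [` gS]%fset) !fcoord_val ffunE.
Qed.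

Definition coord_vec f : {ffun S -> R} := [ffun i => f (val i)].

Lemma coord_vecE f g : g \in S -> fcoord (coord_vec f) g = f g.
Proof. by move=> gS; rewrite -[g]/(val [` gS]%fset) fcoord_val ffunE. Qed.

Lemma coord_vecD f f' :
  coord_vec (fun g => f g + f' g) = coord_vec f + coord_vec f'.
Proof. by apply/ffunP => i; rewrite !ffunE. Qed.

Lemma coord_vecZ t f : coord_vec (fun g => t * f g) = t *: coord_vec f.
Proof. by apply/ffunP => i; rewrite !ffunE. Qed.

Lemma eq_coord_vec f f' : {in S, f =1 f'} -> coord_vec f = coord_vec f'.
Proof. by move=> ff'; apply/ffunP => i; rewrite !ffunE ff' ?(valP i). Qed.

Lemma coord_vec_fcoord v : coord_vec (fcoord v) = v.
Proof. by apply: fcoord_inj => g gS; rewrite coord_vecE. Qed.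

End coordinates.

(** * The projected cones of single circuits *)

Section circuit_cones.
Local Opaque geomean Lambda.
Variables (R : realType) (n : nat) (A B : {fset 'rV[R]_n}).
Local Notation V := 'rV[R]_n.
Local Notation circuit := ({fset V} * V)%type.
Local Notation coef := {ffun (A `|` B)%fset -> R}.

(** The quotient of [geomean q (fcoord c)] by [Lambda q] is the circuit number, the product of the
    powers of [c_a / lambda_a] with exponents [lambda_a]; the last condition is the classical bound
    on the inner coefficient, cleared of denominators. *)
Definition even_circuit_cone (q : circuit) : set coef :=
  [set c | [/\ supported_on q c, {in q.1, forall a, 0 <= fcoord c a}
    & - fcoord c q.2 * Lambda q <= geomean q (fcoord c)]].

Definition odd_circuit_cone (q : circuit) : set coef :=
  [set c | [/\ supported_on q c, {in q.1, forall a, 0 <= fcoord c a}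
    & `|fcoord c q.2| * Lambda q <= geomean q (fcoord c)]].

Lemma fcoord_addE (c d : coef) : fcoord (c + d) = (fun a => fcoord c a + fcoord d a).
Proof. by apply/funext => a; exact: fcoordD. Qed.

Lemma fcoord_scaleE t (c : coef) : fcoord (t *: c) = (fun a => t * fcoord c a).
Proof. by apply/funext => a; exact: fcoordZ. Qed.

Lemma even_circuit_cone_cone q : valid_circuit q -> convex_cone (even_circuit_cone q).
Proof.
move=> qV; split.
- split=> [g _|a _|]; rewrite ?fcoord0 //.
  by rewrite oppr0 mul0r; exact: geomean_ge0.
- move=> c d [cs c0 cG] [ds d0 dG]; split.
  + by move=> g gq; rewrite fcoordD cs // ds // addr0.
  + by move=> a aq; rewrite fcoordD addr_ge0 ?c0 ?d0.
  + rewrite fcoordD opprD mulrDl fcoord_addE; apply: le_trans (lerD cG dG) _.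
    exact: geomeanD.
- move=> t c t0 [cs c0 cG]; split.
  + by move=> g gq; rewrite fcoordZ cs // mulr0.
  + by move=> a aq; rewrite fcoordZ mulr_ge0 ?c0.
  + by rewrite fcoordZ -mulrN -mulrA fcoord_scaleE geomeanZ // ler_wpM2l.
Qed.

Lemma odd_circuit_cone_cone q : valid_circuit q -> convex_cone (odd_circuit_cone q).
Proof.
move=> qV; have L0 := ltW (Lambda_gt0 qV); split.
- split=> [g _|a _|]; rewrite ?fcoord0 //.
  by rewrite normr0 mul0r; exact: geomean_ge0.
- move=> c d [cs c0 cG] [ds d0 dG]; split.
  + by move=> g gq; rewrite fcoordD cs // ds // addr0.
  + by move=> a aq; rewrite fcoordD addr_ge0 ?c0 ?d0.
  + rewrite fcoordD fcoord_addE.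
    apply: le_trans (geomeanD qV c0 d0); apply: le_trans (lerD cG dG).
    by rewrite -mulrDl ler_wpM2r // ler_normD.
- move=> t c t0 [cs c0 cG]; split.
  + by move=> g gq; rewrite fcoordZ cs // mulr0.
  + by move=> a aq; rewrite fcoordZ mulr_ge0 ?c0.
  + by rewrite fcoordZ normrM ger0_norm // -mulrA fcoord_scaleE geomeanZ // ler_wpM2l.
Qed.

Lemma tree_index_mem K m k i :
  ((k, i) \in tree_index K m) = (0 < k <= K)%N && (0 < i <= 2 ^ (m - k))%N.
Proof.
rewrite !inE; apply/idP/idP.
  move=> /allpairsPdep[k' [i' [kin iin [-> ->]]]]; move: kin iin.
  by rewrite !mem_iota !add1n !ltnS => -> ->.
move=> /andP[kK im]; apply/allpairsPdep; exists k, i.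
by rewrite !mem_iota !add1n !ltnS; split.
Qed.

Lemma all_circuitsP q : q \in all_circuits A B <->
  q \in even_circuits A \/ q \in odd_circuits A B.
Proof.
rewrite /all_circuits /even_circuits /odd_circuits; split.
  move=> /reduced_circuitsP[[qA qC] qI qb qN qe]; move: qC; rewrite in_fsetU.
  by case/orP => qC; [left|right]; apply/reduced_circuitsP; split.
by case=> /reduced_circuitsP[[qA qC] qI qb qN qe]; apply/reduced_circuitsP;
  split=> //; split=> //; rewrite in_fsetU qC ?orbT.
Qed.

Variable s : circuit -> seq (option V).
Hypothesis s_leaves : forall q, q \in all_circuits A B -> perm_eq (s q) (leaves q).
Hypothesis valid : forall q, q \in all_circuits A B -> valid_circuit q.

Lemma primal_vars_ex q (xb : R) (x : nat -> nat -> R) : q \in all_circuits A B ->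
  exists w : primal_vars A B, fcoord w.1 q = xb /\
    forall k i, (0 < k <= depth q)%N -> (0 < i <= 2 ^ (depth q - k))%N ->
      fcoord w.2 (q, (k, i)) = x k i.
Proof.
move=> qall; exists ([ffun=> xb], [ffun g => x (val g).2.1 (val g).2.2]).
split; first by rewrite -[q]/(val [` qall]%fset) fcoord_val ffunE.
move=> k i km im.
have gin : (q, (k, i)) \in primal_index A B.
  rewrite !inE; apply/allpairsPdep; exists q, (k, i); split=> //.
  by rewrite tree_index_mem km.
by rewrite -[(q, (k, i))]/(val [` gin]%fset) fcoord_val ffunE.
Qed.

Lemma fst_lifted_even q : q \in even_circuits A ->
  fst @` lifted_even (A := A) (B := B) s q = even_circuit_cone q.
Proof.
move=> qe; have qall : q \in all_circuits A B by apply/all_circuitsP; left.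
have qV := valid qall; have ql := s_leaves qall.
apply/seteqP; split=> [_ [[c [xb x]] [/(primal_matrix_le qV ql)[c0 cxb xbG] cs] <-]|c].
  split=> //=; have [xb0|xb0] := leP 0 (fcoord xb q).
    by apply: le_trans (xbG xb0); rewrite ler_pM2r // Lambda_gt0.
  apply: le_trans (geomean_ge0 q (fcoord c)).
  by rewrite pmulr_lle0 ?Lambda_gt0 // (le_trans cxb) // ltW.
(* The least nonnegative [x_beta] allowed by the block [x_beta + c_beta]. *)
move=> [cs c0 cG]; pose xb := Num.max 0 (- fcoord c q.2).
have xb0 : 0 <= xb by rewrite le_max lexx.
have cxb : - fcoord c q.2 <= xb by rewrite le_max lexx orbT.
have xbG : xb * Lambda q <= geomean q (fcoord c).
  by rewrite /xb maxEle; case: ifP => // _; rewrite mul0r geomean_ge0.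
have [x xP] := primal_matrix_ex qV ql c0 xb0 cxb xbG.
have [[xb' x'] [xbE xE]] := primal_vars_ex xb x qall.
exists (c, (xb', x')) => //; split=> //=; rewrite /= in xbE xE; rewrite xbE.
exact: xP.
Qed.

Lemma fst_lifted_odd q : q \in odd_circuits A B ->
  fst @` lifted_odd (A := A) (B := B) s q = odd_circuit_cone q.
Proof.
move=> qe; have qall : q \in all_circuits A B by apply/all_circuitsP; right.
have qV := valid qall; have ql := s_leaves qall.
apply/seteqP; split=> [_ [[c [xb x]] [/psd_rcons[+ /psd_block2_sym cxb] cs] <-]|c].
  move=> /(primal_matrix_le qV ql)[c0 _ xbG]; split=> //=.
  have xb0 : 0 <= fcoord xb q by exact: le_trans cxb.
  by apply: le_trans (xbG xb0); rewrite ler_pM2r // Lambda_gt0.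
move=> [cs c0 cG]; pose xb := `|fcoord c q.2|.
have cxb : - fcoord c q.2 <= xb by rewrite /xb -normrN ler_norm.
have [x xP] := primal_matrix_ex qV ql c0 (normr_ge0 _) cxb cG.
have [[xb' x'] [xbE xE]] := primal_vars_ex xb x qall.
rewrite /= in xbE xE.
have P : psd (primal_matrix_odd q (s q) (fcoord c) xb
    (fun k i => fcoord x' (q, (k, i)))).
  by apply/psd_rcons; split; [exact: xP | exact/psd_block2_sym].
by exists (c, (xb', x')) => //; split=> //; rewrite xbE.
Qed.

Definition circuit_cone_sum : set coef :=
  minkowski_add (minkowski_sum (even_circuits A) even_circuit_cone)
                (minkowski_sum (odd_circuits A B) odd_circuit_cone).

Lemma fst_lifted_primal : fst @` lifted_primal A B s = circuit_cone_sum.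
Proof.
rewrite /lifted_primal fst_minkowski_add !fst_minkowski_sum.
by congr minkowski_add; apply: eq_minkowski_sum => q qin;
  rewrite ?fst_lifted_even ?fst_lifted_odd.
Qed.

Lemma isolated_primal_cone : convex_cone (isolated_primal A B).
Proof.
split.
- by move=> g; rewrite fcoord0.
- move=> c d cI dI g; have [c1 c2] := cI g; have [d1 d2] := dI g.
  rewrite fcoordD; split=> gI; first by rewrite addr_ge0 ?c1 ?d1.
  by rewrite c2 // d2 // addr0.
- move=> t c t0 cI g; have [c1 c2] := cI g.
  rewrite fcoordZ; split=> gI; first by rewrite mulr_ge0 ?c1.
  by rewrite c2 // mulr0.
Qed.

Lemma even_sum_cone : convex_cone (minkowski_sum (even_circuits A) even_circuit_cone).
Proof.
apply: minkowski_sum_cone => q qe; apply: even_circuit_cone_cone.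
by apply: valid; apply/all_circuitsP; left.
Qed.

Lemma odd_sum_cone : convex_cone (minkowski_sum (odd_circuits A B) odd_circuit_cone).
Proof.
apply: minkowski_sum_cone => q qe; apply: odd_circuit_cone_cone.
by apply: valid; apply/all_circuitsP; right.
Qed.

Lemma circuit_cone_sum_cone : convex_cone circuit_cone_sum.
Proof. exact: minkowski_add_cone even_sum_cone odd_sum_cone. Qed.

Definition decomposable : set coef :=
  minkowski_add circuit_cone_sum (isolated_primal A B).

Lemma decomposable_cone : convex_cone decomposable.
Proof. exact: minkowski_add_cone circuit_cone_sum_cone isolated_primal_cone. Qed.

Lemma even_decomposable q : q \in even_circuits A -> even_circuit_cone q `<=` decomposable.
Proof.
move=> qe c cq; apply: (minkowski_add_subl isolated_primal_cone).
apply: (minkowski_add_subl odd_sum_cone); apply: minkowski_sum_sub cq => // q' q'e.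
by apply: even_circuit_cone_cone; apply: valid; apply/all_circuitsP; left.
Qed.

Lemma odd_decomposable q : q \in odd_circuits A B -> odd_circuit_cone q `<=` decomposable.
Proof.
move=> qe c cq; apply: (minkowski_add_subl isolated_primal_cone).
apply: (minkowski_add_subr even_sum_cone); apply: minkowski_sum_sub cq => // q' q'e.
by apply: odd_circuit_cone_cone; apply: valid; apply/all_circuitsP; right.
Qed.

Lemma isolated_decomposable : isolated_primal A B `<=` decomposable.
Proof. exact: (minkowski_add_subr circuit_cone_sum_cone). Qed.

Lemma decomposable_min (K : set coef) : convex_cone K ->
  (forall q, q \in even_circuits A -> even_circuit_cone q `<=` K) ->
  (forall q, q \in odd_circuits A B -> odd_circuit_cone q `<=` K) ->
  isolated_primal A B `<=` K -> decomposable `<=` K.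
Proof.
move=> Kc Ke Ko Ki; do 2?apply: minkowski_add_min => //; exact: minkowski_sum_min.
Qed.

End circuit_cones.

(** * Nonnegativity of circuit functions *)

Section evaluation.
Variables (R : realType) (n : nat).
Local Notation V := 'rV[R]_n.
Local Notation circuit := ({fset V} * V)%type.
Implicit Types (a b x t : V) (q : circuit).

Definition abs_value a x : R := \prod_j `|x 0 j| `^ a 0 j.

Lemma abs_value_ge0 a x : 0 <= abs_value a x.
Proof. by apply: prodr_ge0 => j _; exact: powR_ge0. Qed.

Lemma abs_monomial_fin a x : (forall j, x 0 j = 0 -> 0 <= a 0 j) ->
  abs_monomial a x = (abs_value a x)%:E.
Proof.
move=> xa; rewrite /abs_monomial; case: existsP => // -[j /andP[/eqP xj aj]].
by have := xa j xj; rewrite leNgt aj.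
Qed.

Lemma abs_monomialP a x :
  abs_monomial a x = +oo%E \/ (forall j, x 0 j = 0 -> 0 <= a 0 j).
Proof.
rewrite /abs_monomial; case: existsP => [_|H]; [by left | right=> j xj].
by rewrite leNgt; apply/negP => aj; apply: H; exists j; rewrite xj eqxx.
Qed.

Lemma norm_monomial b x : nat_points R n b -> `|monomial b x| = abs_value b x.
Proof.
move=> bN; rewrite normr_prod; apply: eq_bigr => j _.
by have [k ->] := bN j; rewrite natrK normrX powR_mulrn.
Qed.

Lemma powR_prod (I : Type) (r : seq I) (F : I -> R) y : (forall i, 0 <= F i) ->
  (\prod_(i <- r) F i) `^ y = \prod_(i <- r) F i `^ y.
Proof.
move=> F0; elim: r => [|i r IH]; first by rewrite !big_nil powR1.
by rewrite !big_cons powRM ?IH // prodr_ge0.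
Qed.

(** The delicate case is [y = 0], where [powR] gives 1 for exponent 0 and 0 otherwise. Both sides
    are then 1 or 0 according to whether all exponents vanish, because nonnegative exponents cannot
    cancel in the sum. *)
Lemma prod_powR (X : {fset V}) (l e : V -> R) y : 0 <= y ->
  {in X, forall a, 0 < l a} -> (y = 0 -> {in X, forall a, 0 <= e a}) ->
  \prod_(a <- X) (y `^ e a) `^ l a = y `^ \sum_(a <- X) l a * e a.
Proof.
move=> y0 l0 ye; have [y00|yN0] := eqVneq y 0; last first.
  elim: (X : seq V) => [|a r IH]; first by rewrite !big_nil powRr0.
  by rewrite !big_cons IH -powRrM powRD ?yN0 ?implybT // [e a * _]mulrC.
have {}ye := ye y00; rewrite y00.
have [[a aX ea]|noe] := pselect (exists2 a, a \in X & e a != 0).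
  have ea0 : 0 < e a by rewrite lt_neqAle eq_sym ea ye.
  have rest : 0 <= \sum_(c <- (X `\ a)%fset) l c * e c.
    rewrite big_seq sumr_ge0 // => c; rewrite !inE => /andP[_ cX].
    by rewrite mulr_ge0 ?ye // ltW // l0.
  have : 0 < \sum_(c <- X) l c * e c.
    by rewrite (big_fsetD1 a) //= ltr_pwDl // mulr_gt0 // l0.
  move=> /gt_eqF s0; rewrite (big_fsetD1 a) //= powR0 // powR0 ?gt_eqF ?l0 //.
  by rewrite mul0r powR0 // s0.
have e0 a : a \in X -> e a = 0.
  by move=> aX; apply/eqP; apply: contrapT => /negP ea; apply: noe; exists a.
rewrite [X in _ `^ X]big_seq [X in _ `^ X]big1 => [|a /e0 ->]; last by rewrite mulr0.
by rewrite powRr0 big_seq big1 // => a /e0 ->; rewrite powRr0 powR1.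
Qed.

Lemma barycenter_coord q j : valid_circuit q ->
  q.2 0 j = \sum_(a <- q.1) lambda q a * a 0 j.
Proof.
move=> [_ [_ _ lb] _ _]; rewrite -[in LHS]lb /moment summxE.
by apply: eq_bigr => a _; rewrite mxE.
Qed.

Lemma geomean_abs_value q x : valid_circuit q ->
  {in q.1, forall a j, x 0 j = 0 -> 0 <= a 0 j} ->
  geomean q (fun a => abs_value a x) = abs_value q.2 x.
Proof.
move=> qV xq; rewrite /geomean.
under eq_bigr do rewrite /abs_value powR_prod //; rewrite exchange_big /=.
apply: eq_bigr => j _; rewrite (barycenter_coord j qV) prod_powR //.
  exact: lambda_gt0.
by move=> /eqP; rewrite normr_eq0 => /eqP xj a aq; exact: xq aq j xj.
Qed.

(** Multiply the hypothesis by the mean of [m], merge the two means into that of [c * m] and apply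
    [geomean_le_Lambda]; a factor [Lambda q] cancels. With monomials for [m] this yields
    nonnegativity, with a dual vector the pairing. *)
Lemma circuit_amgm q (c m : V -> R) r : valid_circuit q ->
  {in q.1, forall a, 0 <= c a} -> {in q.1, forall a, 0 <= m a} ->
  r * Lambda q <= geomean q c -> r * geomean q m <= \sum_(a <- q.1) c a * m a.
Proof.
move=> qV c0 m0 rc; have L0 := Lambda_gt0 qV.
rewrite -(ler_pM2l L0); apply: (@le_trans _ _ (geomean q (fun a => c a * m a))).
  rewrite geomeanM // mulrCA mulrA ler_wpM2r ?geomean_ge0 //.
apply: geomean_le_Lambda => // a aq; by rewrite mulr_ge0 ?c0 ?m0.
Qed.

Variables A B : {fset V}.
Local Notation coef := {ffun (A `|` B)%fset -> R}.

Lemma S_eval_fin (c : coef) x :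
  {in A, forall a, fcoord c a != 0 -> forall j, x 0 j = 0 -> 0 <= a 0 j} ->
  S_eval c x = (\sum_(a <- A) fcoord c a * abs_value a x
                + \sum_(b <- B) fcoord c b * monomial b x)%:E.
Proof.
move=> cx; rewrite /S_eval DualAddTheoryNumDomain.dsumEFin.
have -> : (\sum_(a <- A) ((fcoord c a)%:E * abs_monomial a x : \bar^d R))%dE =
    (\sum_(a <- A) ((fcoord c a * abs_value a x)%:E : \bar^d R))%dE.
  apply: eq_big_seq => a aA; have [->|/(cx _ aA)/abs_monomial_fin -> //] :=
    eqVneq (fcoord c a) 0.
  by rewrite mul0e mul0r.
by rewrite DualAddTheoryNumDomain.dsumEFin.
Qed.

Lemma S_eval_pinfty (c : coef) x a : a \in A -> 0 < fcoord c a ->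
  abs_monomial a x = +oo%E -> S_eval c x = +oo%E.
Proof.
move=> aA ca xa; rewrite /S_eval.
have -> : (\sum_(a <- A) ((fcoord c a)%:E * abs_monomial a x : \bar^d R))%dE = +oo%dE.
  apply/DualAddTheoryNumDomain.desum_eqyP; exists a; split=> //.
  by rewrite xa gt0_muley.
exact: DualAddTheoryNumDomain.daddye.
Qed.

Lemma S_eval_ge0 (c : coef) x : {in A, forall a, 0 <= fcoord c a} ->
  {in B, forall b, fcoord c b = 0} -> (0 <= S_eval c x)%E.
Proof.
move=> cA cB.
have [[a aA [ca xa]]|fin] := pselect (exists2 a, a \in A &
    0 < fcoord c a /\ abs_monomial a x = +oo%E).
  by rewrite (S_eval_pinfty aA ca xa).
rewrite S_eval_fin; last first.
  move=> a aA ca; have [xa|//] := abs_monomialP a x; exfalso; apply: fin.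
  by exists a => //; rewrite lt_neqAle eq_sym ca cA.
rewrite lee_fin [X in _ + X]big_seq [X in _ + X]big1 ?addr0; last first.
  by move=> b /cB ->; rewrite mul0r.
rewrite big_seq sumr_ge0 // => a aA; by rewrite mulr_ge0 ?cA ?abs_value_ge0.
Qed.

Hypothesis AB_disj : [disjoint A & B]%fset.

Lemma disjAB a : a \in A -> a \notin B.
Proof. by move=> aA; apply/negP => aB; move/fdisjointP: AB_disj => /(_ a aA); rewrite aB. Qed.

Section on_circuit.
Variables (q : circuit) (c : coef) (x : V).
Hypotheses (qV : valid_circuit q) (qA : (q.1 `<=` A)%fset)
  (c_supp : supported_on q c) (c_ge0 : {in q.1, forall a, 0 <= fcoord c a}).

Lemma supported_off g : g \notin q.1 -> g != q.2 -> fcoord c g = 0.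
Proof. by move=> gq g2; apply: c_supp; rewrite !inE negb_or g2. Qed.

(** A positive mean means positive vertex coefficients, so one infinite vertex monomial makes the
    value infinite. If none is infinite, the inner monomial is finite too: in a vanishing variable
    its exponent is a mean of nonnegative ones. *)
Lemma S_eval_circuit : 0 < geomean q (fcoord c) ->
  S_eval c x = +oo%E \/
  abs_value q.2 x = geomean q (fun a => abs_value a x) /\
  S_eval c x = (\sum_(a <- A) fcoord c a * abs_value a x
                + \sum_(b <- B) fcoord c b * monomial b x)%:E.
Proof.
move=> G0.
have cp : {in q.1, forall a, 0 < fcoord c a}.
  move=> a aq; rewrite lt_neqAle c_ge0 // andbT eq_sym; apply/eqP => ca.
  by rewrite (geomean_eq0 qV aq ca) ltxx in G0.
have [[a aq xa]|fin] := pselect (exists2 a, a \in q.1 & abs_monomial a x = +oo%E).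
  by left; apply: S_eval_pinfty xa; [exact: (fsubsetP qA) | exact: cp].
have {}fin : {in q.1, forall a j, x 0 j = 0 -> 0 <= a 0 j}.
  move=> a aq; have [xa|//] := abs_monomialP a x.
  by exfalso; apply: fin; exists a.
right; split; first by rewrite geomean_abs_value.
apply: S_eval_fin => a aA ca; have [/fin //|aq] := boolP (a \in q.1).
have [->|a2] := eqVneq a q.2; last by rewrite supported_off ?eqxx in ca.
move=> j xj; rewrite (barycenter_coord j qV) big_seq sumr_ge0 // => d dq.
by rewrite mulr_ge0 ?fin // ltW // lambda_gt0.
Qed.

Lemma even_circuit_S_eval : q.2 \in A ->
  - fcoord c q.2 * Lambda q <= geomean q (fcoord c) -> (0 <= S_eval c x)%E.
Proof.
move=> q2A cG; have [_ _ q2N _] := qV.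
have cB : {in B, forall b, fcoord c b = 0}.
  move=> b bB; apply: supported_off.
    by apply: contraL bB => /(fsubsetP qA)/disjAB.
  by apply: contraL bB => /eqP ->; exact: disjAB.
have [c2|c2] := leP 0 (fcoord c q.2).
  apply: S_eval_ge0 => // a aA; have [/c_ge0 //|aq] := boolP (a \in q.1).
  by have [->//|a2] := eqVneq a q.2; rewrite supported_off.
have G0 : 0 < geomean q (fcoord c).
  by apply: lt_le_trans cG; rewrite mulr_gt0 ?Lambda_gt0 // oppr_gt0.
have [->|[gE ->]] := S_eval_circuit G0; first by rewrite leey.
rewrite lee_fin [X in _ + X]big_seq [X in _ + X]big1 ?addr0; last first.
  by move=> b /cB ->; rewrite mul0r.
rewrite -(big_seq_support (X := (q.2 |` q.1)%fset)); first last.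
- by move=> a _; rewrite !inE negb_or => /andP[a2 aq]; rewrite supported_off ?mul0r.
- by rewrite fsubUset fsub1set q2A.
rewrite big_fsetU1 //= -[X in X + _]opprK addrC subr_ge0 -mulNr gE.
by apply: circuit_amgm => // a _; exact: abs_value_ge0.
Qed.

Lemma odd_circuit_S_eval : q.2 \in B -> nat_points R n q.2 ->
  `|fcoord c q.2| * Lambda q <= geomean q (fcoord c) -> (0 <= S_eval c x)%E.
Proof.
move=> q2B q2N cG; have [_ _ q2q _] := qV.
have q2A : q.2 \notin A by apply: contraL q2B; exact: disjAB.
have cB : {in B, forall b, b != q.2 -> fcoord c b = 0}.
  move=> b bB b2; apply: supported_off => //.
  by apply: contraL bB => /(fsubsetP qA)/disjAB.
have [c2|c2] := eqVneq (fcoord c q.2) 0.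
  apply: S_eval_ge0 => [a aA|b bB]; last first.
    by have [->//|] := eqVneq b q.2; exact: cB.
  have [/c_ge0 //|aq] := boolP (a \in q.1).
  by have [->|a2] := eqVneq a q.2; [rewrite c2 | rewrite supported_off].
have G0 : 0 < geomean q (fcoord c).
  by apply: lt_le_trans cG; rewrite mulr_gt0 ?Lambda_gt0 // normr_gt0.
have [->|[gE ->]] := S_eval_circuit G0; first by rewrite leey.
rewrite lee_fin (big_fsetD1 q.2 q2B) /= [X in _ + (_ + X)]big_seq.
rewrite [X in _ + (_ + X)]big1 ?addr0; last first.
  by move=> b; rewrite !inE => /andP[b2 bB]; rewrite cB // mul0r.
rewrite -(big_seq_support (X := q.1)) //; last first.
  move=> a aA aq; rewrite supported_off ?mul0r //.
  by apply: contraTneq aA => ->.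
rewrite -lerBlDr sub0r; apply: le_trans (ler_norm _) _.
rewrite normrN normrM norm_monomial // gE.
by apply: circuit_amgm => // a _; exact: abs_value_ge0.
Qed.

End on_circuit.

Lemma abs_value_expR a x t : (forall j, `|x 0 j| = expR (t 0 j)) ->
  abs_value a x = expR (dot a t).
Proof.
move=> xt; rewrite expR_sum; apply: eq_bigr => j _.
by rewrite xt /powR gt_eqF ?expR_gt0 // expRK.
Qed.

Lemma S_eval_expR (c : coef) x t : (forall j, `|x 0 j| = expR (t 0 j)) ->
  S_eval c x = (\sum_(a <- A) fcoord c a * expR (dot a t)
                + \sum_(b <- B) fcoord c b * monomial b x)%:E.
Proof.
move=> xt; rewrite S_eval_fin.
  by congr ((_ + _)%:E); apply: eq_bigr => a _; rewrite (abs_value_expR a xt).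
move=> a _ _ j xj; have := expR_gt0 (t 0 j).
by rewrite -xt xj normr0 ltxx.
Qed.

(* The sign comes from negating one variable whose exponent in [b] is odd. *)
Lemma monomial_sign b t (sg : bool) : nat_points R n b -> ~ even_points R n b ->
  exists x, (forall j, `|x 0 j| = expR (t 0 j)) /\
    monomial b x = (-1) ^+ sg * expR (dot b t).
Proof.
move=> bN bE.
have [k kE] := choice bN.
have [j0 kj0] : exists j, odd (k j).
  apply: contrapT => nok; apply: bE => j; exists (k j)./2.
  rewrite kE mul2n -[in LHS](odd_double_half (k j)).
  by case: (boolP (odd (k j))) => [kj|]; [exfalso; apply: nok; exists j|].
pose x : V := \row_j ((-1) ^+ (sg && (j == j0)) * expR (t 0 j)).
have xt j : `|x 0 j| = expR (t 0 j).
  by rewrite mxE normrM normrX normrN1 expr1n mul1r ger0_norm ?expR_ge0.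
exists x; split=> //; rewrite /monomial.
under eq_bigr do rewrite kE natrK mxE exprMn -expRM_natl -kE.
rewrite big_split /= -expR_sum; congr (_ * _).
rewrite (bigD1 j0) //= eqxx andbT big1 ?mulr1; last first.
  by move=> j /negPf ->; rewrite andbF expr0 expr1n.
by rewrite exprAC -[in LHS](signr_odd _ (k j0)) kj0 expr1.
Qed.

End evaluation.

(** * Decomposition into reduced circuits *)

Section decomposition.
Variables (R : realType) (n : nat).
Local Notation V := 'rV[R]_n.
Local Notation circuit := ({fset V} * V)%type.

Lemma convex_hull_trans (X Y : {fset V}) a :
  {in X, forall c, convex_hull [set` Y] c} ->
  convex_hull [set` X] a -> convex_hull [set` Y] a.
Proof.
move=> XY /convex_hullP[mu [mu0 mu1 mua]]; apply/convex_hullP.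
have [f fP] : {f : V -> V -> R & forall c, c \in X ->
    [/\ {in Y, forall d, 0 <= f c d}, mass Y (f c) = 1 & moment Y (f c) = c]}.
  apply: (@choice V (V -> R) (fun c f => c \in X ->
    [/\ {in Y, forall d, 0 <= f d}, mass Y f = 1 & moment Y f = c])) => c.
  have [/XY/convex_hullP[g gP]|_] := boolP (c \in X); first by exists g.
  by exists (fun=> 0).
exists (fun d => \sum_(c <- X) mu c * f c d); split.
- move=> d dY; rewrite big_seq sumr_ge0 // => c cX.
  by have [f0 _ _] := fP c cX; rewrite mulr_ge0 ?mu0 ?f0.
- rewrite /mass exchange_big /= -[RHS]mu1; apply: eq_big_seq => c cX.
  by have [_ f1 _] := fP c cX; rewrite -mulr_sumr -/(mass Y _) f1 mulr1.
- rewrite /moment; under eq_bigr do rewrite scaler_suml.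
  rewrite exchange_big /= -[RHS]mua; apply: eq_big_seq => c cX.
  have [_ _ fc] := fP c cX; rewrite -[X in _ = _ *: X]fc /moment scaler_sumr.
  by apply: eq_bigr => d _; rewrite scalerA.
Qed.

Lemma sub_convex_hull (X : {fset V}) a : a \in X -> convex_hull [set` X] a.
Proof.
move=> aX; apply/convex_hullP; exists (fun c => (c == a)%:R).
by rewrite mass_dirac ?moment_dirac //; split=> // c _; rewrite ler0n.
Qed.

Variables A B : {fset V}.
Local Notation coef := {ffun (A `|` B)%fset -> R}.
Hypothesis AB_disj : [disjoint A & B]%fset.
Hypothesis valid : forall q, q \in all_circuits A B -> valid_circuit q.

Definition dec (f : V -> R) : Prop := @decomposable R n A B (coord_vec (A `|` B)%fset f).

Lemma decD f g : dec f -> dec g -> dec (fun a => f a + g a).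
Proof.
by have [_ KD _] := decomposable_cone valid; rewrite /dec coord_vecD; exact: KD.
Qed.

Lemma decZ t f : 0 <= t -> dec f -> dec (fun a => t * f a).
Proof.
by have [_ _ KZ] := decomposable_cone valid; rewrite /dec coord_vecZ; exact: KZ.
Qed.

Lemma dec0 : dec (fun=> 0).
Proof.
have [K0 _ _] := decomposable_cone valid; rewrite /dec.
by rewrite (_ : coord_vec _ _ = 0) //; apply/ffunP => i; rewrite !ffunE.
Qed.

Lemma eq_dec f g : {in (A `|` B)%fset, f =1 g} -> dec f -> dec g.
Proof. by move=> fg; rewrite /dec (eq_coord_vec fg). Qed.

(** A non-isolated exponent lies in some circuit, and the single coefficient [t] satisfies the
    inequality of that circuit. For an odd circuit the inner point is in [B], hence different from
    [a]. *)
Lemma dec_monomial a t : a \in A -> 0 <= t -> dec (fun g => t * (g == a)%:R).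
Proof.
move=> aA t0; set f := (fun _ => _).
have aS : a \in (A `|` B)%fset by rewrite in_fsetU aA.
have f0 : forall g, 0 <= f g by move=> g; rewrite mulr_ge0 // ler0n.
have fE g : g \in (A `|` B)%fset -> fcoord (coord_vec (A `|` B)%fset f) g = f g.
  exact: coord_vecE.
have fz g : g != a -> fcoord (coord_vec (A `|` B)%fset f) g = 0.
  move=> ga; have [/fE ->|/fcoord_out //] := boolP (g \in (A `|` B)%fset).
  by rewrite /f (negPf ga) mulr0.
have fge g : 0 <= fcoord (coord_vec (A `|` B)%fset f) g.
  by have [/fE ->|/fcoord_out ->] := boolP (g \in (A `|` B)%fset).
have [aI|] := boolP (a \in isolated_exponents A B).
  apply: (isolated_decomposable valid) => g; split=> // gI.
  by apply: fz; apply: contraNneq gI => ->.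
rewrite !inE aA /= => /negP noiso.
have [q qall aq] : exists2 q, q \in all_circuits A B & (a \in q.1) || (a == q.2).
  apply: contrapT => noq; apply: noiso; apply/(@allP circuit) => q qall.
  by rewrite -negb_or; apply/negP => aq; apply: noq; exists q.
have qV := valid qall; have [_ _ q2N _] := qV.
have supp : supported_on q (coord_vec (A `|` B)%fset f).
  move=> g; rewrite !inE negb_or => /andP[g2 g1]; apply: fz.
  by apply/eqP => ga; move: aq; rewrite -ga (negPf g1) (negPf g2).
have [qe|qo] := (all_circuitsP A B q).1 qall.
  apply: (even_decomposable valid qe); split=> //.
  apply: le_trans (geomean_ge0 _ _).
  by rewrite pmulr_lle0 ?Lambda_gt0 // oppr_le0.
apply: (odd_decomposable valid qo); split=> //.
have a2 : q.2 != a.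
  move: qo => /reduced_circuitsP[[_ q2B] _ _ _ _].
  by apply: contraL q2B => /eqP ->; exact: (disjAB AB_disj aA).
by rewrite fz // normr0 mul0r geomean_ge0.
Qed.

Lemma dec_ge0 f : {in A, forall a, 0 <= f a} -> {in B, forall b, f b = 0} -> dec f.
Proof.
move=> fA fB.
have main (r : seq V) : {subset r <= A} -> uniq r ->
    dec (fun g => if g \in r then f g else 0).
  elim: r => [_ _|a r IH rA /= /andP[ar ur]]; first exact: dec0.
  have aA : a \in A by apply: rA; rewrite mem_head.
  have {}IH : dec (fun g => if g \in r then f g else 0).
    by apply: IH => // c cr; apply: rA; rewrite inE cr orbT.
  apply: eq_dec (decD IH (dec_monomial aA (fA _ aA))) => g _.
  rewrite inE; case: eqVneq => [->|_] /=; last by rewrite mulr0 addr0.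
  by rewrite (negPf ar) add0r mulr1.
apply: eq_dec (main A (fun a => id) (fset_uniq _)) => g.
by rewrite in_fsetU; case: ifP => //= _ /fB ->.
Qed.

Section one_circuit.
Variables (Y : {fset V}) (mu rho : V -> R) (b : V) (e : R).
Hypotheses (YA : (Y `<=` A)%fset) (YI : affinely_independent Y)
  (mub : barycenter Y mu b) (bAB : b \in (A `|` B)%fset) (bY : b \notin Y)
  (rho_gt0 : {in Y, forall a, 0 < rho a})
  (eP : e = -1 \/ b \in B /\ `|e| <= 1).

(* The coefficients are rescaled by the exponential of the affine function that
   interpolates [ln rho] on the simplex, after which every circuit function
   that vanishes at the all-one point becomes a formal difference
   [sum lambda a - beta] of point masses. *)
Lemma dec_circuit : dec (fun a => (if a \in Y then mu a * rho a else 0)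
  + e * expR (\sum_(c <- Y) mu c * ln (rho c)) * (a == b)%:R).
Proof.
have [mu0 mu1 mub'] := mub.
(* The states of the walk; those in [Y] are absorbing. *)
pose S := (b |` [fset a in A | `[< convex_hull [set` Y] a >]])%fset.
have bS : b \in S by rewrite !inE eqxx.
have YS : (Y `<=` S)%fset.
  apply/fsubsetP => a aY; rewrite !inE (fsubsetP YA) //=.
  by apply/orP; right; apply/asboolP; exact: sub_convex_hull.
have bconv : convex_hull [set` Y] b.
  by apply/convex_hullP; exists mu; split=> // a aY; rewrite ltW ?mu0.
have Sconv g : g \in S -> convex_hull [set` Y] g.
  by rewrite !inE => /orP[/eqP -> //|/andP[_ /asboolP]].
have SA g : g \in S -> g != b -> g \in A.
  by rewrite !inE => /orP[/eqP ->|/andP[]//]; rewrite eqxx.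
have [bar barP] : {bar : V -> V -> R & forall g, g \in S ->
    [/\ {in Y, forall d, 0 <= bar g d}, mass Y (bar g) = 1 & moment Y (bar g) = g]}.
  apply: (@choice V (V -> R) (fun c f => c \in S ->
    [/\ {in Y, forall d, 0 <= f d}, mass Y f = 1 & moment Y f = c])) => c.
  have [/Sconv/convex_hullP[g gP]|_] := boolP (c \in S); first by exists g.
  by exists (fun=> 0).
pose ell g := \sum_(c <- Y) bar g c * ln (rho c).
have ellY a : a \in Y -> ell a = ln (rho a).
  move=> aY; have [_ b1 ba] := barP a (fsubsetP YS _ aY).
  have E : {in Y, bar a =1 (fun c => (c == a)%:R)}.
    by apply: aff_indep_inj => //; rewrite ?mass_dirac ?moment_dirac.
  rewrite /ell -(sum_dirac (U := R^o) (fun c => ln (rho c)) aY).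
  by apply: eq_big_seq => c cY; rewrite E.
have ellb : ell b = \sum_(c <- Y) mu c * ln (rho c).
  have [_ b1 ba] := barP b bS.
  have E : {in Y, bar b =1 mu} by apply: aff_indep_inj; rewrite // ?mu1 ?mub'.
  by apply: eq_big_seq => c cY; rewrite E.
have ell_affine q : valid_circuit q -> (q.1 `<=` S)%fset -> q.2 \in S ->
    ell q.2 = \sum_(a <- q.1) lambda q a * ell a.
  move=> [_ [l0 l1 lb] _ _] q1S q2S.
  have [_ b1 b2] := barP _ q2S.
  have E : {in Y, bar q.2 =1 (fun c => \sum_(a <- q.1) lambda q a * bar a c)}.
    apply: aff_indep_inj => //.
      rewrite b1 /mass exchange_big /= -[LHS]l1; apply: eq_big_seq => a aq.
      have [_ ba1 _] := barP a (fsubsetP q1S _ aq).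
      by rewrite -mulr_sumr -/(mass Y _) ba1 mulr1.
    rewrite b2 /moment; under [RHS]eq_bigr do rewrite scaler_suml.
    rewrite exchange_big /= -[LHS]lb; apply: eq_big_seq => a aq.
    have [_ _ ba1] := barP a (fsubsetP q1S _ aq).
    rewrite -[X in _ *: X = _]ba1 /moment scaler_sumr.
    by apply: eq_bigr => c _; rewrite scalerA.
  rewrite /ell (eq_big_seq (fun c => \sum_(a <- q.1) lambda q a * (bar a c * ln (rho c)))).
    by rewrite exchange_big /=; apply: eq_bigr => a _; rewrite mulr_sumr.
  by move=> c cY; rewrite E // mulr_suml; apply: eq_bigr => a _; rewrite mulrA.
(* The factor [- e] turns the point mass subtracted at [b] into the prescribed inner coefficient
   [e * expR (ell b)]. If [b] is in [A], then [e = -1] and the factor is 1. *)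
pose wt a := (if a == b then - e else 1) * expR (ell a).
have wtA a : a \in A -> wt a = expR (ell a).
  move=> aA; rewrite /wt; case: eqVneq => [ab|_]; last by rewrite mul1r.
  case: eP => [->|[bB _]]; first by rewrite opprK mul1r.
  by move: bB; rewrite -ab (negPf (disjAB AB_disj aA)).
have massE z g : g \in S -> mass S (fun a => z a - (a == g)%:R) = mass S z - 1.
  by move=> gS; rewrite -[X in _ = _ - X](mass_dirac gS) /mass sumrB.
have momentE z g : g \in S -> moment S (fun a => z a - (a == g)%:R) = moment S z - g.
  move=> gS; rewrite -[X in _ = _ - X](moment_dirac gS) /moment -sumrB.
  by apply: eq_bigr => a _; rewrite scalerBl.
(* Mass and moment are carried along to identify the law of absorption with [mu] at the end. *)
pose Z z := [/\ mass S z = 0, moment S z = 0 & dec (fun a => wt a * z a)].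
have [||||nu [nu0 nuY [nu1 nub nudec]]] := @eliminate R n S Y (fun a => dot a a) Z _ _ _ _ b bS bY.
- move=> z w [z1 zb zd] [w1 wb wd]; split.
  + by rewrite massD z1 w1 addr0.
  + by rewrite momentD zb wb addr0.
  + by apply: eq_dec (decD zd wd) => a _; rewrite mulrDr.
- move=> t z t0 [z1 zb zd]; split.
  + by rewrite massZ z1 mulr0.
  + by rewrite momentZ zb scaler0.
  + by apply: eq_dec (decZ t0 zd) => a _; rewrite mulrCA.
- by move=> z [].
- move=> g gS gY.
  (* One jump of the walk: from [g] to the vertices of an empty simplex among the other points of
     [A] in the big simplex. *)
  pose D := ([fset a in A | `[< convex_hull [set` Y] a >]] `\ g)%fset.
  have YD : (Y `<=` D)%fset.
    apply/fsubsetP => a aY; rewrite !inE (fsubsetP YA) //= andbC; apply/andP; split.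
      by apply/asboolP; exact: sub_convex_hull.
    by apply: contraNneq gY => <-.
  have gD : g \notin D by rewrite !inE eqxx.
  have gconvD : convex_hull [set` D] g.
    apply: (convex_hull_trans _ (Sconv _ gS)) => c cY.
    by apply: sub_convex_hull; exact: (fsubsetP YD).
  have [Y' [mu' [Y'D Y'I Y'b Y'e]]] := empty_simplex gD gconvD.
  pose q : circuit := (Y', g).
  have Y'A : (Y' `<=` A)%fset.
    by apply/fsubsetP => a /(fsubsetP Y'D); rewrite !inE => /andP[_ /andP[]].
  have Y'S : (Y' `<=` S)%fset.
    apply/fsubsetP => a /(fsubsetP Y'D); rewrite !inE => /andP[_ /andP[-> ->]].
    by rewrite orbT.
  have gAB : g \in (A `|` B)%fset.
    have [->//|gb] := eqVneq g b; by rewrite in_fsetU (SA _ gS gb).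
  have gY' : g \notin Y' by apply: contraNN gD => /(fsubsetP Y'D).
  (* The small simplex lies in the big one, so a simplex without further points of [D] has no
     further points of [A] except [g]. *)
  have qred C : g \in C -> q \in reduced_circuits A C.
    move=> gC; apply/reduced_circuitsP; split=> //; first by exists mu'.
    move=> a aA aq; have [->|ag] := eqVneq a g; [by right | left].
    apply: Y'e => //; rewrite !inE ag aA /=; apply/asboolP.
    apply: (convex_hull_trans _ aq) => c cY'.
    by have := fsubsetP Y'D _ cY'; rewrite !inE => /andP[_ /andP[_ /asboolP]].
  have qV := valid (qred _ gAB).
  have [_ [l0 l1 lb] _ _] := qV.
  pose nu a := if a \in Y' then lambda q a else 0.
  have nuE : {in Y', nu =1 lambda q} by move=> a; rewrite /nu => ->.
  have nuN a : a \notin Y' -> nu a = 0 by rewrite /nu => /negPf ->.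
  exists nu; split.
  + by move=> a; rewrite /nu; case: ifP => // /l0/ltW.
  + by move=> a aS; apply: nuN; apply: contraNN aS; exact: (fsubsetP Y'S).
  + split.
    * rewrite massE // -(mass_sub Y'S); last by move=> a _; exact: nuN.
      by rewrite (eq_mass nuE) l1 subrr.
    * rewrite momentE // -(moment_sub Y'S); last by move=> a _; exact: nuN.
      by rewrite (eq_moment nuE) lb subrr.
    set f := (fun a => wt a * _).
    have fE a : a \in (A `|` B)%fset -> fcoord (coord_vec (A `|` B)%fset f) a = f a.
      exact: coord_vecE.
    have fq a : a \in Y' -> f a = expR (ell a) * lambda q a.
      move=> aY'; rewrite /f nuE // wtA ?(fsubsetP Y'A) //.
      have -> : (a == g) = false by apply: contraNF gY' => /eqP <-.
      by rewrite subr0.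
    have fcq : {in Y', fcoord (coord_vec (A `|` B)%fset f)
        =1 (fun a => expR (ell a) * lambda q a)}.
      by move=> a aY'; rewrite fE ?fq // in_fsetU (fsubsetP Y'A).
    have f0 : {in Y', forall a, 0 <= fcoord (coord_vec (A `|` B)%fset f) a}.
      by move=> a aY'; rewrite fcq // mulr_ge0 ?expR_ge0 // ltW ?l0.
    have fg : fcoord (coord_vec (A `|` B)%fset f) g = - wt g.
      by rewrite fE // /f nuN // eqxx sub0r mulrN1.
    have supp : supported_on q (coord_vec (A `|` B)%fset f).
      move=> a; rewrite !inE negb_or => /andP[ag aY'].
      have [aS|aS] := boolP (a \in (A `|` B)%fset); last by rewrite fcoord_out.
      by rewrite fE // /f nuN // (negPf ag) subr0 mulr0.
    (* As [ell] is affine, the factors [expR (ell a)] have geometric mean [expR (ell g)]. *)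
    have geoE : geomean q (fcoord (coord_vec (A `|` B)%fset f)) = expR (ell g) * Lambda q.
      have e0 : {in q.1, forall a, 0 <= expR (ell a)} by move=> a _; exact: expR_ge0.
      have l0' : {in q.1, forall a, 0 <= lambda q a} by move=> a /l0/ltW.
      rewrite (@eq_geomean R n q _ _ fcq) (geomeanM e0 l0').
      rewrite -LambdaE; congr (_ * _).
      rewrite geomean_expR; last by move=> a _; exact: expR_gt0.
      rewrite -[g]/(q.2) ell_affine //; congr expR.
      by apply: eq_bigr => a _; rewrite expRK.
    have L0 := Lambda_gt0 qV.
    have [gA|gNA] := boolP (g \in A).
      apply: (even_decomposable valid (qred _ gA)); split=> //=.
      by rewrite fg geoE opprK wtA.
    have gb : g = b by apply/eqP; apply: contraNT gNA => /(SA _ gS).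
    have gB : g \in B by move: gAB; rewrite in_fsetU (negPf gNA).
    apply: (odd_decomposable valid (qred _ gB)); split=> //=.
    rewrite fg geoE normrN /wt gb eqxx normrM normrN ler_pM2r //.
    rewrite (ger0_norm (expR_ge0 _)) ger_pMl ?expR_gt0 //.
    by case: eP => [->|[]//]; rewrite normrN1.
  + have := energy_moment (X := Y') (mu := lambda q) (g := g).
    move=> /(_ _ l1 lb gY') H.
    have -> : \sum_(a <- S) (nu a - (a == g)%:R) * dot a a = energy S nu - dot g g.
      rewrite -(energy_dirac gS) /energy -sumrB.
      by apply: eq_bigr => a _; rewrite mulrBl.
    rewrite subr_gt0 -(energy_sub Y'S); last by move=> a _; exact: nuN.
    have -> : energy Y' nu = energy Y' (lambda q).
      by apply: eq_big_seq => a aY'; rewrite nuE.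
    by apply: H => a /l0/ltW.
have nuE : {in Y, nu =1 mu}.
  have nuS1 : mass S nu = 1.
    by move: nu1; rewrite massE // => /eqP; rewrite subr_eq0 => /eqP.
  have nuSb : moment S nu = b.
    by move: nub; rewrite momentE // => /eqP; rewrite subr_eq0 => /eqP.
  apply: aff_indep_inj => //.
    by rewrite mu1 (mass_sub YS) // => a _; exact: nuY.
  by rewrite mub' (moment_sub YS) // => a _; exact: nuY.
apply: eq_dec nudec => a aAB; rewrite -ellb.
have [ab|aNb] := eqVneq a b.
  by rewrite ab (negPf bY) nuY // /wt eqxx sub0r add0r !mulr1 mulrN1 mulNr opprK.
rewrite subr0 mulr0 addr0; have [aY|aY] := boolP (a \in Y); last by rewrite nuY ?mulr0.
by rewrite wtA ?(fsubsetP YA) // nuE // ellY // lnK 1?mulrC // posrE rho_gt0.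
Qed.

End one_circuit.
End decomposition.

(** * Equality of the primal cones, then duality *)

Section main.
Variables (R : realType) (n : nat).
Local Notation V := 'rV[R]_n.
Local Notation circuit := ({fset V} * V)%type.

(** Dividing by [expR (dot b t)] shifts the exponents to [a - b], and [balanced_of_lower_bound]
    applies. *)
Lemma balanced_weights (X : {fset V}) (c : V -> R) (b : V) (d : R) :
  {in X, forall a, 0 < c a} ->
  (forall t, d * expR (dot b t) <= \sum_(a <- X) c a * expR (dot a t)) ->
  exists nu : V -> R, [/\ forall a, 0 <= nu a, forall a, a \notin X -> nu a = 0,
    d <= mass X nu, moment X nu = mass X nu *: b
    & \sum_(a <- X) nu a * ln (nu a / c a) <= 0].
Proof.
move=> c0 cd; pose pt (i : 'I_(size X)) := tnth (in_tuple X) i.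
have ptX i : pt i \in X by exact: mem_tnth.
have [||nu [nu0 nud nub nuD]] := @balanced_of_lower_bound R n _ (fun i => c (pt i))
  (fun i => pt i - b) d.
- by move=> i; exact: c0.
- move=> t; rewrite -(ler_pM2r (expR_gt0 (dot b t))); apply: (le_trans (cd t)).
  rewrite mulr_suml big_tnth; apply: ler_sum => i _.
  by rewrite -mulrA -expRD dotBl subrK.
pose nu' a := if insub (index a X) is Some i then nu i else 0.
have nuE i : nu' (pt i) = nu i.
  rewrite /nu' /pt (tnth_nth 0) index_uniq ?fset_uniq ?ltn_ord //.
  by rewrite (insubT (fun k => k < size X)%N (ltn_ord i)); congr nu; exact: val_inj.
exists nu'; split.
- by move=> a; rewrite /nu'; case: insub.
- move=> a aX; rewrite /nu' insubF // index_mem; exact/negbTE.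
- rewrite /mass big_tnth; apply: (le_trans nud); apply: ler_sum => i _.
  by rewrite nuE.
- rewrite /moment /mass [LHS]big_tnth [in RHS]big_tnth scaler_suml.
  apply/eqP; rewrite -subr_eq0 -sumrB -[X in _ == X]nub; apply/eqP.
  by apply: eq_bigr => i _; rewrite nuE scalerBr.
- rewrite big_tnth; apply: le_trans nuD; apply: ler_sum => i _.
  by rewrite nuE.
Qed.

Variables A B : {fset V}.
Local Notation coef := {ffun (A `|` B)%fset -> R}.
Hypothesis AB_disj : [disjoint A & B]%fset.
Hypothesis valid : forall q, q \in all_circuits A B -> valid_circuit q.
Local Notation dec := (@dec R n A B).

(** The factor [e] covers both kinds of AG functions: -1 for the negative coefficient of an even
    one, the sign of the inner coefficient for an odd one. *)
Lemma dec_of_lower_bound (c : V -> R) (b : V) (d e : R) :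
  b \in (A `|` B)%fset -> e = -1 \/ b \in B /\ `|e| <= 1 -> 0 < d ->
  {in (A `\ b)%fset, forall a, 0 <= c a} ->
  (forall t, d * expR (dot b t) <= \sum_(a <- (A `\ b)%fset) c a * expR (dot a t)) ->
  dec (fun a => if a == b then e * d else if a \in A then c a else 0).
Proof.
move=> bAB eP d0 c0 cd.
(* The entropy requires positive coefficients, so the zero ones are dropped. *)
pose X := [fset a in (A `\ b)%fset | 0 < c a]%fset.
have XA : (X `<=` A `\ b)%fset by apply/fsubsetP => a; rewrite !inE => /andP[].
have Xc : {in X, forall a, 0 < c a} by move=> a; rewrite !inE => /andP[].
have bX : b \notin X by rewrite !inE eqxx.
have [||nu [nu0 nuX nud nub nuD]] := @balanced_weights X c b d => //.
  move=> t; rewrite (big_seq_support XA) // => a aA; rewrite !inE in aA *.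
  rewrite aA /= -leNgt => ca; have -> : c a = 0.
    by apply/eqP; rewrite eq_le ca c0 // !inE.
  by rewrite mul0r.
pose X0 := [fset a in X | 0 < nu a]%fset.
have X0X : (X0 `<=` X)%fset by apply/fsubsetP => a; rewrite !inE => /andP[].
have nu_gt0 : {in X0, forall a, 0 < nu a} by move=> a; rewrite !inE => /andP[].
have nuX0 a : a \notin X0 -> nu a = 0.
  have [aX|aX _] := boolP (a \in X); last exact: nuX.
  have -> : (a \in X0) = (0 < nu a) by move: aX; rewrite !inE => ->.
  by rewrite -leNgt => nua; apply/eqP; rewrite eq_le nua nu0.
pose rho a := c a / nu a.
have rho0 : {in X0, forall a, 0 < rho a}.
  by move=> a aX0; rewrite divr_gt0 ?nu_gt0 // Xc // (fsubsetP X0X).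
(* The lower bound on [D] is linear in [mu], which makes [Q] additive; on a simplex it follows from
   [1 + x <= expR x] at the mean of [ln rho]. *)
pose Q mu := exists2 D, mass X0 mu + \sum_(a <- X0) mu a * ln (rho a) <= D
  & dec (fun a => mu a * rho a + e * D * (a == b)%:R).
have [|||D nuDD decD'] := @caratheodory_ind R n X0 b Q _ _ nu nu0 nuX0.
- move=> mu1 mu2 [D1 HD1 dec1] [D2 HD2 dec2]; exists (D1 + D2).
    rewrite massD; under eq_bigr do rewrite mulrDl.
    by rewrite big_split /= addrACA lerD.
  by apply: eq_dec (decD valid dec1 dec2) => a _; ring.
- move=> Y mu YX0 YI mu0 muY mub.
  have m0 : 0 <= mass Y mu by rewrite /mass big_seq sumr_ge0 // => a /mu0/ltW.
  have mE : mass X0 mu = mass Y mu.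
    by rewrite (mass_sub YX0) // => a _; exact: muY.
  have lE : \sum_(a <- X0) mu a * ln (rho a) = \sum_(a <- Y) mu a * ln (rho a).
    by rewrite (big_seq_support YX0) // => a _ /muY ->; rewrite mul0r.
  have [m00|mN0] := eqVneq (mass Y mu) 0.
    have muz a : mu a = 0.
      have [aY|/muY //] := boolP (a \in Y); move: m00; rewrite /mass.
      move=> /eqP; rewrite big_seq psumr_eq0; last by move=> c' /mu0/ltW.
      by move=> /allP /(_ a aY); rewrite aY => /eqP.
    exists 0.
      by rewrite mE m00 add0r big1 // => a _; rewrite muz mul0r.
    by apply: eq_dec (dec0 valid) => a _; rewrite muz mulr0 !mul0r addr0.
  have mp : 0 < mass Y mu by rewrite lt_neqAle eq_sym mN0.
  pose l a := (mass Y mu)^-1 * mu a.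
  have lb : barycenter Y l b.
    split.
    + by move=> a /mu0 mua; rewrite mulr_gt0 ?invr_gt0.
    + by rewrite massZ mulVf.
    + by rewrite momentZ mub scalerA mulVf // scale1r.
  have YX : (Y `<=` X)%fset := fsubset_trans YX0 X0X.
  have YA : (Y `<=` A)%fset.
    by apply/fsubsetP => a /(fsubsetP YX)/(fsubsetP XA); rewrite !inE => /andP[].
  have bY : b \notin Y by apply: contraNN bX; exact: (fsubsetP YX).
  have rhoY : {in Y, forall a, 0 < rho a}.
    by move=> a /(fsubsetP YX0); exact: rho0.
  have := decZ valid m0 (dec_circuit AB_disj valid YA YI lb bAB bY rhoY eP).
  set E := expR _ => decE; exists (mass Y mu * E).
    rewrite mE lE; apply: (@le_trans _ _ (mass Y mu * (1 + \sum_(a <- Y) l a * ln (rho a)))).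
      rewrite mulrDr mulr1 lerD2l mulr_sumr; apply: ler_sum => a _.
      by rewrite !mulrA mulfV // mul1r.
    by rewrite ler_pM2l // expR_ge1Dx.
  apply: eq_dec decE => a _; rewrite mulrDr; congr (_ + _); last by ring.
  case: ifP => [_|/negbT/muY ->]; last by rewrite mulr0 mul0r.
  by rewrite !mulrA mulfV // mul1r.
- rewrite (moment_sub X0X); last by move=> a _; exact: nuX0.
  by rewrite (mass_sub X0X) // => a _; exact: nuX0.
(* The sum of the [nu a * ln (rho a)] is minus the relative entropy, hence nonnegative. *)
have dD : d <= D.
  apply: le_trans nuDD; apply: (le_trans nud).
  rewrite (mass_sub X0X); last by move=> a _; exact: nuX0.
  rewrite lerDl -oppr_le0; apply: le_trans nuD.
  rewrite -(big_seq_support X0X); last by move=> a _ /nuX0 ->; rewrite mul0r.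
  rewrite -sumrN big_seq [leRHS]big_seq; apply: ler_sum => a aX0.
  rewrite -mulrN -lnV ?posrE ?rho0 // /rho invf_div //.
have D0 : 0 < D by exact: lt_le_trans dD.
(* Scaling by [th <= 1] corrects the inner coefficient from [e * D] to [e * d]; what is left of [c]
   is nonnegative and goes into [r]. *)
pose th := d / D.
have th0 : 0 <= th by rewrite divr_ge0 // ltW.
have th1 : th <= 1 by rewrite ler_pdivrMr // mul1r.
have nurho a : nu a * rho a = if a \in X0 then c a else 0.
  case: ifP => [aX0|/negbT/nuX0 ->]; last by rewrite mul0r.
  by rewrite /rho mulrC divfK // gt_eqF // nu_gt0.
pose r a := if (a \in A) && (a != b) then c a - th * (nu a * rho a) else 0.
have decr : dec r.
  apply: dec_ge0 => // a; rewrite /r; last first.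
    by move=> aB; case: ifP => // /andP[/(disjAB AB_disj)]; rewrite aB.
  move=> aA; case: ifP => // /andP[_ ab]; rewrite nurho.
  have ca : 0 <= c a by apply: c0; rewrite !inE ab.
  by case: ifP => _; rewrite ?mulr0 ?subr0 // subr_ge0 ler_piMl.
apply: eq_dec (decD valid (decZ valid th0 decD') decr) => a aAB; rewrite /r.
have [->|ab] := eqVneq a b.
  have -> : nu b = 0 by apply: nuX.
  by rewrite andbF addr0 mulr1 mul0r add0r mulrCA /th divfK // gt_eqF.
rewrite mulr0 addr0 andbT; case: ifP => aA; first by rewrite addrC subrK.
rewrite nuX ?mul0r ?mulr0 ?addr0 //; apply: contraFN aA => /(fsubsetP XA).
by rewrite !inE => /andP[].
Qed.

Hypothesis B_nat : [set` B] `<=` nat_points R n `\` even_points R n.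

(** It suffices to evaluate at points with [|x_j| = expR (t_j)]: positive ones in the even case, and
    in the odd case signs for which the term of [b] is [- |c_b| expR (dot b t)]. *)
Lemma AG_decomposable (c : coef) : even_AG c \/ odd_AG c ->
  (forall x, 0 <= S_eval c x)%E -> @decomposable R n A B c.
Proof.
move=> cAG cge.
have decE f : dec f -> {in (A `|` B)%fset, f =1 fcoord c} -> @decomposable R n A B c.
  by move=> df fc; rewrite -(coord_vec_fcoord c) -(eq_coord_vec fc).
have sumA b t : b \notin A ->
    \sum_(a <- (A `\ b)%fset) fcoord c a * expR (dot a t)
    = \sum_(a <- A) fcoord c a * expR (dot a t).
  by move=> bA; rewrite mem_fsetD1.
case: cAG => [[one cB]|[cA one]].
  have [[b bA cb]|noneg] := pselect (exists2 b, b \in A & fcoord c b < 0); last first.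
    apply: (decE (fcoord c)) => //; apply: dec_ge0 => // a aA.
    by rewrite leNgt; apply/negP => ca; apply: noneg; exists a.
  apply: decE (@dec_of_lower_bound (fcoord c) b (- fcoord c b) (-1) _ _ _ _ _) _.
  - by rewrite in_fsetU bA.
  - by left.
  - by rewrite oppr_gt0.
  - move=> a; rewrite !inE => /andP[ab aA]; rewrite leNgt; apply/negP => ca.
    by move: ab; rewrite (one a b) // eqxx.
  - move=> t; pose x : V := \row_j expR (t 0 j).
    have xt j : `|x 0 j| = expR (t 0 j) by rewrite mxE ger0_norm ?expR_ge0.
    have := cge x; rewrite (S_eval_expR _ xt) lee_fin.
    rewrite [X in _ + X]big_seq [X in _ + X]big1 ?addr0; last first.
      by move=> g /cB ->; rewrite mul0r.
    by rewrite (big_fsetD1 b bA) /= addrC -[X in _ + X]opprK subr_ge0 -mulNr.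
  - move=> g; rewrite in_fsetU; case: eqVneq => [->|_]; first by rewrite mulN1r opprK.
    by case: ifP => //= _ /cB ->.
have [[b bB cb]|zero] := pselect (exists2 b, b \in B & fcoord c b != 0); last first.
  apply: (decE (fcoord c)) => //; apply: dec_ge0 => // b bB.
  by apply/eqP; apply: contrapT => /negP cb; apply: zero; exists b.
have bA : b \notin A by apply: contraL bB; exact: disjAB.
apply: decE (@dec_of_lower_bound (fcoord c) b `|fcoord c b| (Num.sg (fcoord c b)) _ _ _ _ _) _.
- by rewrite in_fsetU bB orbT.
- by right; rewrite normr_sg lern1 leq_b1.
- by rewrite normr_gt0.
- by move=> a; rewrite !inE => /andP[_]; exact: cA.
- move=> t; have [bN bE] := B_nat bB.
  have [x [xt xb]] := monomial_sign t (0 < fcoord c b) bN bE.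
  have := cge x; rewrite (S_eval_expR _ xt) lee_fin sumA //.
  rewrite (big_fsetD1 b bB) /= [X in _ + (_ + X)]big_seq.
  rewrite [X in _ + (_ + X)]big1 ?addr0; last first.
    move=> g; rewrite !inE => /andP[gb gB].
    have -> : fcoord c g = 0; last by rewrite mul0r.
    apply/eqP; apply: contrapT => /negP cg; move: gb.
    by rewrite (one g b) // eqxx.
  rewrite xb; case: (ltP 0 (fcoord c b)) => c0.
    by rewrite expr1 gtr0_norm // mulN1r mulrN subr_ge0.
  by rewrite expr0 ler0_norm // mul1r -[X in _ + X]opprK subr_ge0 -mulNr.
- move=> g; rewrite in_fsetU; case: eqVneq => [->|gb]; first by rewrite -numEsg.
  case: ifP => //= _ gB; apply/esym/eqP; apply: contrapT => /negP cg; move: gb.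
  by rewrite (one g b) // eqxx.
Qed.

Lemma even_circuitsP q : q \in even_circuits A ->
  [/\ valid_circuit q, (q.1 `<=` A)%fset & q.2 \in A].
Proof.
move=> qe; split; first by apply: valid; apply/all_circuitsP; left.
  by case/reduced_circuitsP: qe => -[].
by case/reduced_circuitsP: qe => -[].
Qed.

Lemma odd_circuitsP q : q \in odd_circuits A B ->
  [/\ valid_circuit q, (q.1 `<=` A)%fset & q.2 \in B].
Proof.
move=> qe; split; first by apply: valid; apply/all_circuitsP; right.
  by case/reduced_circuitsP: qe => -[].
by case/reduced_circuitsP: qe => -[].
Qed.

Lemma isolated_sub : (isolated_exponents A B `<=` A)%fset.
Proof. by apply/fsubsetP => a; rewrite !inE => /andP[]. Qed.

Lemma S_cone_decomposable : S_cone A B = @decomposable R n A B.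
Proof.
apply/seteqP; split.
  apply: conic_hull_min; first exact: decomposable_cone.
  by move=> c [cAG cge]; exact: AG_decomposable.
have cone := conic_hull_cone [set c : coef | (even_AG c \/ odd_AG c)
  /\ forall x, (0 <= S_eval c x)%E].
apply: decomposable_min => // [q qin|q qin|].
- have [qV qA q2] := even_circuitsP qin; move=> c [cs c0 cG].
  apply: sub_conic_hull; split; last by move=> x; exact: (even_circuit_S_eval AB_disj x qV).
  left; split.
    have H a : a \in A -> fcoord c a < 0 -> a = q.2.
      move=> aA ca; apply/eqP; apply: contraTT ca => a2; rewrite -leNgt.
      have [/c0 //|aq] := boolP (a \in q.1).
      by rewrite cs // !inE negb_or a2.
    by move=> a a' aA a'A ca ca'; rewrite (H a) // (H a').
  move=> b bB; apply: cs; rewrite !inE negb_or; apply/andP; split.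
    by apply: contraL bB => /eqP ->; exact: (disjAB AB_disj q2).
  by apply: contraL bB => /(fsubsetP qA)/(disjAB AB_disj).
- have [qV qA q2] := odd_circuitsP qin; move=> c [cs c0 cG].
  apply: sub_conic_hull; split.
    right; split.
      move=> a aA; have [/c0 //|aq] := boolP (a \in q.1).
      rewrite cs // !inE negb_or aq andbT; apply: contraTneq q2 => <-.
      exact: (disjAB AB_disj aA).
    have H b : b \in B -> fcoord c b != 0 -> b = q.2.
      move=> bB cb; apply/eqP; apply: contraNT cb => b2; apply/eqP; apply: cs.
      rewrite !inE negb_or b2; apply: contraL bB => /(fsubsetP qA).
      exact: disjAB.
    by move=> b b' bB b'B cb cb'; rewrite (H b) // (H b').
  by move=> x; apply: (odd_circuit_S_eval AB_disj x qV) => //; case: (B_nat q2).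
- move=> c cI.
  have c_ge0 g : 0 <= fcoord c g.
    have [c1 c2] := cI g.
    by have [/c1 //|/c2 ->] := boolP (g \in isolated_exponents A B).
  have cB : {in B, forall b, fcoord c b = 0}.
    move=> b bB; have [_ c2] := cI b; apply: c2; apply: contraL bB.
    by move=> /(fsubsetP isolated_sub)/(disjAB AB_disj).
  apply: sub_conic_hull; split; last by move=> x; apply: S_eval_ge0 => // a _.
  by left; split=> // a a' _ _; rewrite ltNge c_ge0.
Qed.

(** Homogeneous form of a variational principle: the geometric mean of [v] is the infimum of
    [sum lambda_a u_a v_a] over positive [u] of geometric mean 1. For positive [v] a multiple of
    [1 / v] attains it; if some [v a0] is 0, the infimum 0 is approached by letting [u a0] grow. *)
Lemma dual_geomean_bound (q : circuit) (v : V -> R) x : valid_circuit q ->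
  {in q.1, forall a, 0 <= v a} ->
  (forall u : V -> R, {in q.1, forall a, 0 < u a} ->
     x * geomean q u <= \sum_(a <- q.1) lambda q a * u a * v a) ->
  x <= geomean q v.
Proof.
move=> qV v0 H; have l0 := lambda_gt0 qV.
have [[a0 a0q /eqP va0]|noz] := pselect (exists2 a, a \in q.1 & v a == 0).
  rewrite (geomean_eq0 qV a0q va0) leNgt; apply/negP => x0.
  (* Off [a0] each term on the right is then at most [lambda q a], and the term at [a0] is 0. *)
  pose w a := if a == a0 then 1 else (v a + 1)^-1.
  have w0 : {in q.1, forall a, 0 < w a}.
    move=> a aq; rewrite /w; case: ifP => // _.
    by rewrite invr_gt0 ltr_wpDl ?v0.
  have G0 := geomean_gt0 w0.
  (* Makes the left side 2 against a right side of at most 1; [M] reaches the mean [K] by enlarging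
     the entry at [a0] alone. *)
  pose K := 2 / (x * geomean q w).
  have K0 : 0 < K by rewrite divr_gt0 // mulr_gt0.
  pose M a := if a == a0 then K `^ (lambda q a0)^-1 else 1.
  have M0 : {in q.1, forall a, 0 < M a}.
    by move=> a _; rewrite /M; case: ifP => // _; rewrite powR_gt0.
  have GM : geomean q M = K.
    rewrite /geomean (big_fsetD1 a0) //= big_seq big1 ?mulr1; last first.
      by move=> a; rewrite !inE /M => /andP[/negPf -> _]; rewrite powR1.
    by rewrite /M eqxx -powRrM mulVf ?powRr1 ?ltW // gt_eqF // l0.
  have := H (fun a => M a * w a).
  rewrite geomeanM; [|by move=> a /M0/ltW|by move=> a /w0/ltW].
  rewrite GM /K mulrCA divfK ?gt_eqF ?mulr_gt0 // => /(_ _) Hx.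
  have : (2 : R) <= 1.
    apply: le_trans (Hx _) _; first by move=> a aq; rewrite mulr_gt0 ?M0 ?w0.
    rewrite -(sum_lambda qV) !big_seq; apply: ler_sum => a aq.
    have [->|aNa0] := eqVneq a a0; first by rewrite va0 mulr0 ltW // l0.
    rewrite /M /w (negPf aNa0) mul1r -mulrA ger_pMr ?l0 //.
    by rewrite mulrC ler_pdivrMr ?mul1r ?lerDl // ltr_wpDl ?v0.
  by rewrite lern1.
have vp : {in q.1, forall a, 0 < v a}.
  move=> a aq; rewrite lt_neqAle v0 // andbT eq_sym; apply/negP => va.
  by apply: noz; exists a.
have vVp : {in q.1, forall a, 0 < (v a)^-1} by move=> a /vp; rewrite invr_gt0.
have E : geomean q (fun a => (v a)^-1) * geomean q v = 1.
  rewrite -geomeanM //; last by move=> a /vVp/ltW.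
  rewrite -[RHS](geomean_const qV ler01); apply: eq_geomean => a /vp va.
  by rewrite mulVf // gt_eqF.
have := H _ vVp; rewrite -(ler_pM2r (geomean_gt0 vp)) -mulrA E mulr1 => /le_trans; apply.
rewrite ger_pMl ?geomean_gt0 // -(sum_lambda qV) !big_seq; apply: ler_sum => a aq.
by rewrite mulfVK // gt_eqF // vp.
Qed.

Definition pairing (v c : coef) : R := \sum_g v g * c g.

Lemma pairingE v c :
  pairing v c = \sum_(g <- (A `|` B)%fset) fcoord v g * fcoord c g.
Proof.
by rewrite big_seq_fsetE; apply: eq_bigr => g _; rewrite !fcoord_val.
Qed.

Lemma pairing_cone v : convex_cone [set c | 0 <= pairing v c].
Proof.
split=> [|x y|t x]; rewrite /= /pairing.
- by rewrite big1 // => g _; rewrite ffunE mulr0.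
- move=> x0 y0; under eq_bigr do rewrite ffunE mulrDr.
  by rewrite big_split addr_ge0.
- move=> t0 x0; under eq_bigr do rewrite ffunE mulrCA.
  by rewrite -mulr_sumr mulr_ge0.
Qed.

Lemma pairing_circuit (q : circuit) v c : (q.1 `<=` A)%fset -> q.2 \notin q.1 ->
  q.2 \in (A `|` B)%fset -> supported_on q c ->
  pairing v c = fcoord v q.2 * fcoord c q.2
    + \sum_(a <- q.1) fcoord v a * fcoord c a.
Proof.
move=> qA q2N q2 cs; rewrite pairingE -(big_seq_support (X := (q.2 |` q.1)%fset)).
- by rewrite big_fsetU1.
- rewrite fsubUset fsub1set q2; apply: fsubset_trans qA _; exact: fsubsetUl.
- by move=> a _ aq; rewrite cs // mulr0.
Qed.

Definition dual_feasible (v : coef) : Prop :=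
  (forall q, q \in even_circuits A -> [/\ {in q.1, forall a, 0 <= fcoord v a},
     0 <= fcoord v q.2 & fcoord v q.2 <= geomean q (fcoord v)])
  /\ (forall q, q \in odd_circuits A B -> {in q.1, forall a, 0 <= fcoord v a}
     /\ `|fcoord v q.2| <= geomean q (fcoord v)).

(** From right to left, [circuit_amgm] settles the pairing on each circuit cone. From left to right,
    [v] is tested against monomials, for the signs, and against the circuit functions with
    coefficients [lambda q a * u a] and [e * geomean q u], [|e| = 1]; [dual_geomean_bound] then
    eliminates [u]. *)
Lemma dual_S_coneP v : dual_S_cone A B v <-> dual_feasible v /\ isolated_dual A B v.
Proof.
split=> [vdual|[[veven vodd] viso] c]; last first.
  rewrite S_cone_decomposable; apply: (decomposable_min (pairing_cone v)) => [q|q|].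
  - move=> qin d [ds d0 dG]; have [qV qA q2] := even_circuitsP qin.
    have [v0 v20 vG] := veven q qin; have [_ _ q2N _] := qV.
    rewrite /= (pairing_circuit _ qA q2N) // ?in_fsetU ?q2 //.
    have [d2|d2] := leP 0 (fcoord d q.2).
      rewrite addr_ge0 ?mulr_ge0 // big_seq sumr_ge0 // => a aq.
      by rewrite mulr_ge0 ?v0 ?d0.
    have := circuit_amgm qV d0 v0 dG; under eq_bigr do rewrite mulrC.
    rewrite -subr_ge0 => H; apply: (le_trans H); rewrite [leRHS]addrC lerD2l.
    by rewrite mulNr opprK mulrC ler_wnM2r // ltW.
  - move=> qin d [ds d0 dG]; have [qV qA q2] := odd_circuitsP qin.
    have [v0 vG] := vodd q qin; have [_ _ q2N _] := qV.
    rewrite /= (pairing_circuit _ qA q2N) // ?in_fsetU ?q2 ?orbT //.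
    have := circuit_amgm qV d0 v0 dG; under eq_bigr do rewrite mulrC.
    rewrite -subr_ge0 => H; apply: (le_trans H); rewrite [leRHS]addrC lerD2l.
    rewrite lerNl; apply: le_trans (ler_norm _) _.
    by rewrite normrN normrM mulrC ler_wpM2l.
  - move=> d dI; rewrite /= pairingE sumr_ge0 // => g _; have [d1 d2] := dI g.
    have [gI|/d2 ->] := boolP (g \in isolated_exponents A B); last by rewrite mulr0.
    by rewrite mulr_ge0 ?d1 ?viso.
have {}vdual c : @decomposable R n A B c -> 0 <= pairing v c.
  by rewrite -S_cone_decomposable; exact: vdual.
have vA a : a \in A -> 0 <= fcoord v a.
  move=> aA; have := vdual _ (dec_monomial AB_disj valid aA ler01).
  have aAB : a \in (A `|` B)%fset by rewrite in_fsetU aA.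
  rewrite pairingE (big_fsetD1 a) //= big_seq big1 ?addr0; last first.
    move=> g; rewrite !inE => /andP[/negPf ga gAB].
    by rewrite coord_vecE ?inE // ga !mulr0.
  by rewrite coord_vecE // eqxx !mulr1.
have bound q (e : R) : valid_circuit q -> (q.1 `<=` A)%fset ->
    q.2 \in (A `|` B)%fset ->
    (forall u : V -> R, {in q.1, forall a, 0 < u a} ->
       let f g := if g == q.2 then e * geomean q u
                  else if g \in q.1 then lambda q g * u g else 0 in
       dec f) ->
    - (e * fcoord v q.2) <= geomean q (fcoord v).
  move=> qV qA q2 fdec; have [_ _ q2N _] := qV; apply: dual_geomean_bound => //.
    by move=> a /(fsubsetP qA); exact: vA.
  move=> u u0; have := vdual _ (fdec u u0); set f := coord_vec _ _.
  have fE g : g \in (A `|` B)%fset -> fcoord f g = if g == q.2 then e * geomean q u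
                  else if g \in q.1 then lambda q g * u g else 0.
    by move=> gAB; rewrite /f coord_vecE.
  have fs : supported_on q f.
    move=> g; rewrite !inE negb_or => /andP[g2 gq].
    have [gAB|gAB] := boolP (g \in (A `|` B)%fset); last by rewrite fcoord_out.
    by rewrite fE // (negPf g2) (negPf gq).
  rewrite (pairing_circuit _ qA q2N) // fE // eqxx.
  have -> : \sum_(a <- q.1) fcoord v a * fcoord f a =
      \sum_(a <- q.1) lambda q a * u a * fcoord v a.
    apply: eq_big_seq => a aq; rewrite fE ?in_fsetU ?(fsubsetP qA) // aq mulrC.
    by have -> : (a == q.2) = false by apply: contraNF q2N => /eqP <-.
  by rewrite -[X in X + _]opprK addrC subr_ge0 => /(le_trans _); apply; nra.
have coneE q (e : R) (u : V -> R) : valid_circuit q -> (q.1 `<=` A)%fset ->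
    q.2 \in (A `|` B)%fset -> {in q.1, forall a, 0 < u a} ->
    let f := coord_vec (A `|` B)%fset (fun g => if g == q.2 then e * geomean q u
      else if g \in q.1 then lambda q g * u g else 0) in
    [/\ supported_on q f, {in q.1, forall a, 0 <= fcoord f a},
        fcoord f q.2 = e * geomean q u
      & geomean q (fcoord f) = Lambda q * geomean q u].
  move=> qV qA q2 u0 f; have [_ _ q2N _] := qV.
  have fE g : g \in (A `|` B)%fset -> fcoord f g = if g == q.2 then e * geomean q u
                  else if g \in q.1 then lambda q g * u g else 0.
    by move=> gAB; rewrite /f coord_vecE.
  have fq : {in q.1, fcoord f =1 (fun a => lambda q a * u a)}.
    move=> a aq; rewrite fE ?in_fsetU ?(fsubsetP qA) // aq.
    by have -> : (a == q.2) = false by apply: contraNF q2N => /eqP <-.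
  split.
  - move=> g; rewrite !inE negb_or => /andP[g2 gq].
    have [gAB|gAB] := boolP (g \in (A `|` B)%fset); last by rewrite fcoord_out.
    by rewrite fE // (negPf g2) (negPf gq).
  - by move=> a aq; rewrite fq // mulr_ge0 // ltW ?u0 ?lambda_gt0.
  - by rewrite fE // eqxx.
  - rewrite (eq_geomean fq) geomeanM //; last by move=> a /u0/ltW.
    by move=> a /(lambda_gt0 qV)/ltW.
split; last by move=> a /(fsubsetP isolated_sub); exact: vA.
split=> q qin.
  have [qV qA q2] := even_circuitsP qin.
  have q2AB : q.2 \in (A `|` B)%fset by rewrite in_fsetU q2.
  split; [by move=> a /(fsubsetP qA); exact: vA | exact: vA |].
  rewrite -[leLHS]opprK -[- fcoord v q.2]mulN1r; apply: bound => // u u0.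
  have [fs f0 f2 fG] := coneE q (-1) u qV qA q2AB u0.
  apply: (even_decomposable valid qin); split=> //.
  by rewrite f2 fG mulN1r opprK mulrC.
have [qV qA q2] := odd_circuitsP qin.
have q2AB : q.2 \in (A `|` B)%fset by rewrite in_fsetU q2 orbT.
split; first by move=> a /(fsubsetP qA); exact: vA.
have oddP (e : R) : `|e| = 1 -> - (e * fcoord v q.2) <= geomean q (fcoord v).
  move=> e1; apply: bound => // u u0.
  have [fs f0 f2 fG] := coneE q e u qV qA q2AB u0.
  apply: (odd_decomposable valid qin); split=> //.
  by rewrite f2 fG normrM e1 mul1r mulrC ger0_norm ?geomean_ge0.
rewrite ler_norml lerNl -[X in - X]mul1r oddP ?normr1 //=.
by rewrite -[leLHS]opprK -[- fcoord v q.2]mulN1r oddP // normrN1.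
Qed.

Variable s : circuit -> seq (option V).
Hypothesis s_leaves : forall q, q \in all_circuits A B -> perm_eq (s q) (leaves q).

(** Each circuit has its own auxiliary variables, so solutions found circuit by circuit combine into
    one lifted point. *)
Lemma lifted_dualP v : (fst @` lifted_dual A B s) v <-> dual_feasible v.
Proof.
have even_all q : q \in even_circuits A -> q \in all_circuits A B.
  by move=> qe; apply/all_circuitsP; left.
have odd_all q : q \in odd_circuits A B -> q \in all_circuits A B.
  by move=> qo; apply/all_circuitsP; right.
split=> [[[w [yb y]] [wo we] <-]|[veven vodd]] /=.
  split=> q qin.
    by have [qV _ _] := even_circuitsP qin;
      exact: (dual_matrix_le qV (s_leaves (even_all _ qin)) (we q qin)).
  have [qV _ _] := odd_circuitsP qin.
  have /psd_rcons[P /psd_block2_sym wy] := wo q qin.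
  have [w0 _ yG] := dual_matrix_le qV (s_leaves (odd_all _ qin)) P.
  by split=> //; exact: le_trans yG.
(* The root entry: the least admissible [y_beta] for an odd circuit, the coordinate [v_beta] for an
   even one. No circuit is of both kinds, as [A] and [B] are disjoint. *)
pose z q := if q \in odd_circuits A B then `|fcoord v q.2| else fcoord v q.2.
have [y yP] : {y : circuit -> nat -> nat -> R & forall q, q \in all_circuits A B ->
    forall y', (forall k i, (0 < k < depth q)%N -> (0 < i <= 2 ^ (depth q - k))%N ->
      y' k i = y q k i) -> psd (dual_matrix q (s q) (fcoord v) (z q) y')}.
  apply: (@choice circuit (nat -> nat -> R) (fun q y => q \in all_circuits A B ->
    forall y', (forall k i, (0 < k < depth q)%N -> (0 < i <= 2 ^ (depth q - k))%N ->
      y' k i = y k i) -> psd (dual_matrix q (s q) (fcoord v) (z q) y'))) => q.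
  have [qall|_] := boolP (q \in all_circuits A B); last by exists (fun _ _ => 0).
  have qV := valid qall; have ql := s_leaves qall.
  suff [v0 z0 zG] : [/\ {in q.1, forall a, 0 <= fcoord v a}, 0 <= z q
      & z q <= geomean q (fcoord v)].
    by have [y yP] := dual_matrix_ex qV ql v0 z0 zG; exists y.
  rewrite /z; case: ifP => [/vodd[v0 vG]|qo]; first by split.
  have [/veven[v0 v2 vG]|] := (all_circuitsP A B q).1 qall; first by split.
  by rewrite qo.
pose ys : {ffun dual_index A B -> R} := [ffun g => y (val g).1 (val g).2.1 (val g).2.2].
pose yb : {ffun odd_circuits A B -> R} := [ffun q => z (val q)].
have ysE q k i : q \in all_circuits A B -> (0 < k < depth q)%N ->
    (0 < i <= 2 ^ (depth q - k))%N -> fcoord ys (q, (k, i)) = y q k i.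
  move=> qall kd im.
  have gin : (q, (k, i)) \in dual_index A B.
    rewrite !inE; apply/allpairsPdep; exists q, (k, i); split=> //.
    by rewrite tree_index_mem im andbT; move/andP: kd => [-> kd]; rewrite -subn1 leq_subRL ?add1n // (leq_ltn_trans _ kd).
  by rewrite -[(q, (k, i))]/(val [` gin]%fset) fcoord_val ffunE.
exists (v, (yb, ys)) => //; split=> q qin.
  have qall := odd_all _ qin; apply/psd_rcons.
  have -> : fcoord yb q = `|fcoord v q.2|.
    by rewrite -[in LHS](erefl : val [` qin]%fset = q) fcoord_val ffunE /z qin.
  split; last exact/psd_block2_sym.
  have := yP q qall _ (fun k i => @ysE q k i qall).
  have -> // : z q = `|fcoord v q.2| by rewrite /z qin.
have qall := even_all _ qin.
have := yP q qall _ (fun k i => @ysE q k i qall).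
have -> // : z q = fcoord v q.2.
rewrite /z; case: ifP => // /odd_circuitsP[_ _ qB].
by have [_ _ /(disjAB AB_disj)] := even_circuitsP qin; rewrite qB.
Qed.

End main.

Theorem corollary4p3 (R : realType) (n : nat) (A B : {fset 'rV[R]_n})
  (A_neq0 : A != fset0)
  (A_rat : [set` A] `<=` rational_points R n)
  (B_nat : [set` B] `<=` nat_points R n `\` even_points R n)
  (AB_disj : [disjoint A & B]%fset)
  (s : {fset 'rV[R]_n} * 'rV[R]_n -> seq (option 'rV[R]_n))
  (s_leaves : forall q, q \in all_circuits A B -> perm_eq (s q) (leaves q)) :
  (isolated_exponents A B = fset0 ->
     dual_S_cone A B = fst @` lifted_dual A B s
     /\ S_cone A B = fst @` lifted_primal A B s)
  /\ dual_S_cone A B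
     = fst @` lifted_dual A B s `&` isolated_dual A B
  /\ S_cone A B
     = minkowski_add (fst @` lifted_primal A B s)
                     (isolated_primal A B).
Proof.
have nat_rat : nat_points R n `<=` rational_points R n.
  by move=> b bN j; have [k ->] := bN j; exists k%:R; rewrite ratr_nat.
have valid q : q \in all_circuits A B -> valid_circuit q.
  apply: (@reduced_circuit_valid _ _ _ _ _ (rational_points R n)) => //.
  move=> a; rewrite /= in_fsetU => /orP[/A_rat //|aB].
  by apply: nat_rat; case: (B_nat a aB).
have dualE : dual_S_cone A B = fst @` lifted_dual A B s `&` isolated_dual A B.
  apply/seteqP; split=> v.
    by move=> /(dual_S_coneP AB_disj valid B_nat)[vf vi]; split=> //; apply/lifted_dualP.
  move=> [/lifted_dualP vf vi]; apply/(dual_S_coneP AB_disj valid B_nat).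
  by split=> //; exact: vf.
have primalE : S_cone A B
    = minkowski_add (fst @` lifted_primal A B s) (isolated_primal A B).
  by rewrite (S_cone_decomposable AB_disj valid B_nat) (fst_lifted_primal s_leaves valid).
(* Without isolated exponents, [isolated_dual] is the whole space and [isolated_primal] is reduced
   to 0. *)
split=> // iso0; split.
  rewrite dualE; apply/seteqP; split=> [v []//|v vl]; split=> // a.
  by rewrite iso0 inE.
rewrite primalE; apply/seteqP; split=> [_ [c cl [d dI <-]]|c cl].
  suff -> : d = 0 by rewrite addr0.
  apply: fcoord_inj => g _; rewrite fcoord0; have [_ d2] := dI g.
  by apply: d2; rewrite iso0 inE.
exists c => //; exists 0; last by rewrite addr0.
by move=> g; rewrite fcoord0.
Qed.
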